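(* Let $n\ge1$, $\alpha=(\alpha_1,\dots,\alpha_n)\in(0,2]^n$, $\beta=(\beta_1,\dots,\beta_n)\in(0,\infty)^n$, and let $S^{\#}_{\alpha,\beta}(\omega)$, $\omega\in\mathbb{R}^n$, be the spectral density of the centered stationary Gaussian field on $\mathbb{R}^n$ with covariance $C^{\#}_{\alpha,\beta}(\tau)=\prod_{i=1}^n(1+|\tau_i|^{\alpha_i})^{-\beta_i}$. The high frequency limit of $S^{\#}_{\alpha,\beta}$ is given by $$S^{\#}_{\alpha,\beta}(\omega)\sim\prod_{i=1}^n\mathcal{H}_i(\alpha_i,\beta_i;\omega_i),\qquad \Vert\omega\Vert\to\infty,$$ where $$\mathcal{H}_i(\alpha_i,\beta_i;\omega_i)=\frac{\beta_i}{\pi}\Gamma(\alpha_i+1)\sin\frac{\pi\alpha_i}{2}\,|\omega_i|^{-\alpha_i-1}\quad\text{if }\alpha_i\in(0,2),$$ and $$\mathcal{H}_i(\alpha_i,\beta_i;\omega_i)=\frac{|\omega_i|^{\beta_i-1}}{2^{\beta_i}\Gamma(\beta_i)}e^{-|\omega_i|}\quad\text{if }\alpha_i=2.$$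
   Context: $\Vert\cdot\Vert$ is the Euclidean norm on $\mathbb{R}^n$, and $\sim$ denotes leading asymptotic behavior. The spectral density of a stationary field with covariance $C(t)$ is the Fourier transform $S(\omega)=\frac{1}{(2\pi)^n}\int_{\mathbb{R}^n}e^{-i\omega\cdot t}C(t)\,d^nt$ if this integral converges, and otherwise the Fourier transform (same normalization) of $C$ as a generalized function on Schwartz space; alternatively, it is the function $S$ satisfying $C(t)=\int_{\mathbb{R}^n}e^{i\omega\cdot t}S(\omega)\,d^n\omega$.
   Formalization: The limit ‖ω‖→∞ is read as every |ω_i|→∞ jointly (the same for n=1); for n≥2 the unrestricted limit fails, e.g. n=2, α=β=(2,2), ω=(1,t), t→∞, where the ratio tends to 2. S is the version continuous where all ω_i≠0. *)

(* Defs.v *)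
From HB Require Import structures.
From mathcomp Require Import all_boot all_order all_algebra.
From mathcomp Require Import all_classical all_reals all_analysis.

Set Implicit Arguments.
Unset Strict Implicit.
Unset Printing Implicit Defensive.

Import Order.TTheory GRing.Theory Num.Theory.
Import numFieldNormedType.Exports.

Local Open Scope classical_set_scope.
Local Open Scope ring_scope.

Section cons_measure.
Local Open Scope ereal_scope.
Context {R : realType} {n : nat}.
Notation T := (measurableTypeR R).
Variable mu : {sigma_finite_measure set (n.-tuple T) -> \bar R}.

Definition tuple_cons (p : T * n.-tuple T) : n.+1.-tuple T :=
  [tuple of p.1 :: p.2].

Lemma measurable_tuple_cons : measurable_fun [set: T * n.-tuple T] tuple_cons.
Proof. by apply: measurable_cons; [exact: measurable_fst|exact: measurable_snd]. Qed.

Definition cons_measure : set (n.+1.-tuple T) -> \bar R :=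
  pushforward (lebesgue_measure \x mu) tuple_cons.

Let cons_measure0 : cons_measure set0 = 0.
Proof. by rewrite /cons_measure /pushforward preimage_set0 measure0. Qed.

Let cons_measure_ge0 A : 0 <= cons_measure A.
Proof. by rewrite /cons_measure /pushforward. Qed.

Let cons_measure_sigma_additive : semi_sigma_additive cons_measure.
Proof.
move=> F mF tF mUF; rewrite /cons_measure /pushforward preimage_bigcup.
have mp A : measurable A -> measurable (tuple_cons @^-1` A).
  by move=> mA; rewrite -[X in measurable X]setTI; exact: measurable_tuple_cons.
apply: measure_semi_sigma_additive.
- by move=> k; exact: mp.
- apply/trivIsetP => /= i j _ _ ij; rewrite -preimage_setI.
  by move/trivIsetP : tF => /(_ _ _ _ _ ij) ->//; rewrite preimage_set0.
- by rewrite -preimage_bigcup; exact: mp.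
Qed.

HB.instance Definition _ := isMeasure.Build _ _ _ cons_measure
  cons_measure0 cons_measure_ge0 cons_measure_sigma_additive.

Let cons_measure_sigma_finite : sigma_finite setT cons_measure.
Proof.
have /sigma_finiteP[F [FT ndF Foo]] :=
  sigma_finiteT (@lebesgue_measure R : {sigma_finite_measure set T -> \bar R}).
have /sigma_finiteP[G [GT ndG Goo]] := sigma_finiteT mu.
pose u (x : n.+1.-tuple T) : (T * n.-tuple T)%type :=
  (thead x, [tuple of behead x]).
have uK p : u (tuple_cons p) = p.
  by case: p => a b; rewrite /u /=; congr pair; apply/val_inj.
have mu_ : measurable_fun setT u.
  apply/measurable_fun_pairP; split.
    exact: (@measurable_tnth _ T n.+1 ord0).
  exact: measurable_behead.
exists (fun k => u @^-1` (F k `*` G k)).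
  rewrite -preimage_bigcup; apply/esym; rewrite -subTset => x _ /=.
  have : setT (u x).1 by [].
  have : setT (u x).2 by [].
  rewrite FT {1}GT => -[k _ Gk] [m _ Fm]; exists (maxn m k) => //; split.
  - by move: Fm; exact/subsetPset/ndF/leq_maxl.
  - by move: Gk; exact/subsetPset/ndG/leq_maxr.
move=> k; have [mF Fk] := Foo k; have [mG Gk] := Goo k; split.
  by rewrite -[X in measurable X]setTI; apply: mu_ => //; exact: measurableX.
rewrite /cons_measure /pushforward -comp_preimage.
rewrite (_ : u \o tuple_cons = id); last exact/funext/uK.
by rewrite product_measure1E// lte_mul_pinfty// ge0_fin_numE.
Qed.

HB.instance Definition _ := Measure_isSigmaFinite.Build _ _ _ cons_measure
  cons_measure_sigma_finite.

End cons_measure.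

(* Lebesgue measure on R^n, as an iterated product of one-dimensional Lebesgue
   measures. *)
Fixpoint lebesgue_tuple (R : realType) (n : nat) :
    {sigma_finite_measure set (n.-tuple (measurableTypeR R)) -> \bar R} :=
  match n with
  | 0 => \d_[tuple]
  | n'.+1 => cons_measure (lebesgue_tuple R n')
  end.

(* The library puts the product sigma-algebra on tuples and the topology on row
   vectors: points of R^n are row vectors, and integration goes through this
   bijection. *)
Definition rV_of_tuple (R : realType) (n : nat)
  (x : n.-tuple (measurableTypeR R)) : 'rV[R]_n := \row_i tnth x i.

Definition dotrV (R : realType) (n : nat) (w t : 'rV[R]_n) : R :=
  \sum_(i < n) w ord0 i * t ord0 i.

Definition rV_integrable (R : realType) (n : nat) (f : 'rV[R]_n -> R) : Prop :=
  (lebesgue_tuple R n).-integrable setT (fun x => (f (rV_of_tuple x))%:E).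

Definition rV_integral (R : realType) (n : nat) (f : 'rV[R]_n -> R) : R :=
  \int[lebesgue_tuple R n]_x f (rV_of_tuple x).

(* [S] is a spectral density of the real covariance function [C], that is
   C(t) = \int exp(i w.t) S(w) dw for every t, the complex integral being written
   out as its real and imaginary parts.  Such an [S] is determined only up to a
   null set, so a pointwise statement has to fix a version: for
   [cauchy_sheet_cov] it is the one continuous where no coordinate of w vanishes.
   It agrees there with the Fourier integral (2 pi)^-n \int exp(-i w.t) C(t) dt
   when C is integrable; on the coordinate hyperplanes the density may be
   infinite. *)
Definition is_spectral_density (R : realType) (n : nat)
    (C S : 'rV[R]_n -> R) : Prop :=
  rV_integrable S /\
  forall t : 'rV[R]_n,
    rV_integral (fun w => cos (dotrV w t) * S w) = C t /\
    rV_integral (fun w => sin (dotrV w t) * S w) = 0.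

Definition cauchy_sheet_cov (R : realType) (n : nat) (alpha beta : 'I_n -> R)
    (t : 'rV[R]_n) : R :=
  \prod_(i < n) (1 + `|t ord0 i| `^ alpha i) `^ (- beta i).

Definition Gamma (R : realType) (x : R) : R :=
  \int[lebesgue_measure]_(t in `]0, +oo[) (t `^ (x - 1) * expR (- t)).

(* For 0 < a <= 2 and b > 0. *)
Definition high_freq (R : realType) (a b w : R) : R :=
  if a == 2 then `|w| `^ (b - 1) / (2 `^ b * Gamma b) * expR (- `|w|)
  else b / pi * Gamma (a + 1) * sin (pi * a / 2) * `|w| `^ (- a - 1).

(* High-frequency limit: every |w_i| tends to infinity (for n = 1 this is
   ||w|| -> infinity).  For n >= 2 the set ||w|| -> infinity also contains
   directions along which some w_i stays bounded, where a product of
   one-dimensional tail equivalents cannot be an equivalent: with n = 2,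
   alpha = beta = (2, 2) the density is the product of the
   (1 + |w_i|) exp(-|w_i|) / 4, while high_freq 2 2 w_i = |w_i| exp(-|w_i|) / 4. *)
Definition high_frequency (R : realType) (n : nat) : set_system 'rV[R]_n :=
  [set A | exists M : R, forall w : 'rV[R]_n, (forall i, M < `|w ord0 i|) -> A w].
Arguments high_frequency : clear implicits.

#[global] Instance high_frequency_filter (R : realType) (n : nat) :
  ProperFilter (high_frequency R n).
Proof.
split.
  move=> [M /(_ (const_mx (`|M| + 1)))]; apply => i.
  by rewrite mxE ger0_norm ?addr_ge0// (le_lt_trans (ler_norm M))// ltrDl.
split.
- by exists 0.
- move=> A B [M MA] [N NB]; exists (Num.max M N) => w MNw.
  by split; [apply: MA|apply: NB] => i; apply: le_lt_trans (MNw i);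
    rewrite le_max lexx ?orbT.
- by move=> A B AB [M MA]; exists M => w /MA /AB.
Qed.

Canonical high_frequency_filterType (R : realType) (n : nat) :=
  FilterType (high_frequency R n) _.
Canonical high_frequency_pfilterType (R : realType) (n : nat) :=
  PFilterType (high_frequency R n) (filter_not_empty _).

(* Main.v *)
Require Import Defs.
From HB Require Import structures.
From mathcomp Require Import all_boot all_order all_algebra.
From mathcomp Require Import all_classical all_reals all_analysis.
From mathcomp Require Import measurable_realfun ring lra.
Set Implicit Arguments.
Unset Strict Implicit.
Import Order.TTheory GRing.Theory Num.Theory.
Import numFieldNormedType.Exports.
Local Open Scope classical_set_scope.
Local Open Scope ring_scope.

(** The spectral density is recovered from the covariance by Gaussian smoothing.
   By Fubini, one coordinate at a time, the integral of [S] against the Gaussian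
   approximate identity at [w] is a product of one-dimensional integrals
   [smoothed_density (alpha i) (beta i) eps (w i)], up to the factor (2 pi)^n;
   it tends to [S w] as [eps] tends to 0, [S] being integrable and continuous at [w].
   Everything is thereby reduced to one variable.

   If alpha < 2, a shift by pi changes the sign of the cosine, so a cosine transform
   is -1/8 times that of the third difference of the function.  Third differences
   of t |-> exp (- eps t^2) (1 + |t|^alpha)^-beta are O(t^(alpha-3)) uniformly in
   [eps], which is integrable at infinity.  Dominated convergence then shows that
   only the singularity - beta |t|^alpha at the origin matters, up to a constant
   depending on alpha alone, which is read off from the explicit transform of
   |t|^alpha exp (- |t|).  The limit is uniform in [eps].

   If alpha = 2, the covariance is a gamma mixture of Gaussians, so that the density
   is a gamma mixture of Gaussian densities, and Laplace's method applies. *)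

(** * Calculus and integration on the line *)

(** The covariance is integrable only if every alpha i * beta i exceeds 1, so its Fourier integral
    may diverge; the Gaussian factor makes every one-dimensional integral absolutely convergent. Two
    limits follow, [eps] to 0 and the frequency to infinity. The frequency threshold must not depend
    on [eps], while the range of [eps] may depend on the frequency. For alpha < 2 this comes from
    proving the limit along arbitrary pairs of sequences.

    The order of the differences is forced: a difference of order k of |t|^alpha decays like
    t^(alpha - k), and integrability for every alpha < 2 requires k = 3. The coefficients 1, 3, 3, 1
    all receive the same sign after the shifts, whence 1/8. The bound t^(alpha - 3) is homogeneous,
    so it survives rescaling by the frequency.

    At alpha = 2 the algebraic coefficient, proportional to sin (pi alpha / 2), vanishes: the decay
    is exponential, which calls for formulas exact in the exponent.

    In n variables the individual ratios are only shown to be close to 1 for small [eps];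
    convergence is known for their product. *)

Section derivatives.
Context {R : realType}.
Implicit Types (f g : R -> R) (x : R).

Lemma is_derive_add f g x df dg : is_derive x 1 f df -> is_derive x 1 g dg ->
  is_derive x 1 (fun t => f t + g t) (df + dg).
Proof. by move=> hf hg; exact: (@is_deriveD _ _ _ f g). Qed.

Lemma is_derive_opp f x df : is_derive x 1 f df ->
  is_derive x 1 (fun t => - f t) (- df).
Proof. by move=> hf; exact: (@is_deriveN _ _ _ f). Qed.

Lemma is_derive_mul f g x df dg : is_derive x 1 f df -> is_derive x 1 g dg ->
  is_derive x 1 (fun t => f t * g t) (f x * dg + g x * df).
Proof. by move=> hf hg; exact: (@is_deriveM _ _ f g). Qed.

Lemma is_derive_const (c x : R) : is_derive x 1 (fun _ : R => c) 0.
Proof. exact: is_derive_cst. Qed.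

Lemma is_derive_var x : is_derive x 1 (fun t : R => t) 1.
Proof. exact: is_derive_id. Qed.

Lemma is_derive_scale c f x df : is_derive x 1 f df ->
  is_derive x 1 (fun t => c * f t) (c * df).
Proof.
move=> hf; have := is_derive_mul (is_derive_const c x) hf.
by rewrite mulr0 addr0.
Qed.

Lemma is_derive_chain f g x df dg :
  is_derive x 1 f df -> is_derive (f x) 1 g dg ->
  is_derive x 1 (fun t => g (f t)) (dg * df).
Proof. by move=> hf hg; exact: (@is_derive1_comp R g f). Qed.

Lemma is_derive_continuous f x df : is_derive x 1 f df -> {for x, continuous f}.
Proof.
by move=> [h _]; exact/differentiable_continuous/derivable1_diffP.
Qed.

End derivatives.

(** * Affine changes of variable for Lebesgue measure *)

Section affine.
Context {R : realType}.
Notation mu := (@lebesgue_measure R).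

Lemma measurable_affine (c d : R) :
  measurable_fun setT (fun x : R => c * x + d : measurableTypeR R).
Proof. by apply: measurable_funD => //; exact: mulrl_measurable. Qed.

Let phi (c d : R) (x : measurableTypeR R) : measurableTypeR R := c * x + d.

HB.instance Definition _ (c d : R) := isMeasurableFun.Build _ _ _ _ (phi c d) (measurable_affine c d).

(** Both sides are measures in [A], so uniqueness of Lebesgue measure leaves only the intervals ]a,
    b]. For c < 0 the preimage is closed at the other end, which does not change its length. *)
Lemma lebesgue_measure_affine (c d : R) (c0 : c != 0) (A : set (measurableTypeR R)) : measurable A ->
  mu A = (`|c|%:E * mu (phi c d @^-1` A))%E.
Proof.
move=> mA.
have -> : (`|c|%:E * mu (phi c d @^-1` A))%E =
  mscale (`|c|%:nng) (pushforward mu (phi c d)) A by rewrite /mscale /pushforward.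
apply: lebesgue_measure_unique => // X [[a b] _ <-] /=.
rewrite /mscale /= /pushforward.
have [cn|cp|/eqP] := ltgtP c 0; last by rewrite (negbTE c0).
- have -> : phi c d @^-1` `]a, b] = `[(b - d) / c, (a - d) / c[%classic.
    apply/seteqP; split => x /=; rewrite /phi !in_itv/=.
    + move=> /andP[h1 h2]; rewrite ler_ndivrMr// ltr_ndivlMr//.
      by apply/andP; split; [rewrite lerBrDr mulrC|rewrite ltrBlDr mulrC].
    + rewrite ler_ndivrMr// ltr_ndivlMr// => /andP[h1 h2].
      by apply/andP; split; [rewrite -ltrBlDr mulrC|rewrite -lerBrDr mulrC].
  rewrite !lebesgue_measure_itv/= !lte_fin ltr_ndivrMr// divfK// ltrBlDr subrK.
  case: ifPn => ab; last by rewrite mule0.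
  by rewrite -!EFinD -EFinM (ltr0_norm cn); congr EFin; field.
- have -> : phi c d @^-1` `]a, b] = `](a - d) / c, (b - d) / c]%classic.
    apply/seteqP; split => x /=; rewrite /phi !in_itv/=.
    + move=> /andP[h1 h2]; rewrite ltr_pdivrMr// ler_pdivlMr//.
      by apply/andP; split; [rewrite ltrBlDr mulrC|rewrite lerBrDr mulrC].
    + rewrite ltr_pdivrMr// ler_pdivlMr// => /andP[h1 h2].
      by apply/andP; split; [rewrite -ltrBlDr mulrC|rewrite -lerBrDr mulrC].
  rewrite !lebesgue_measure_itv/= !lte_fin ltr_pdivrMr// divfK// ltrBlDr subrK.
  case: ifPn => ab; last by rewrite mule0.
  by rewrite -!EFinD -EFinM (gtr0_norm cp); congr EFin; field.
Qed.

Lemma ge0_integral_affine (c d : R) (f : measurableTypeR R -> \bar R) : c != 0 -> measurable_fun setT f ->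
  (forall x, 0 <= f x)%E ->
  (\int[mu]_x f x = `|c|%:E * \int[mu]_x f (c * x + d)%R)%E.
Proof.
move=> c0 mf f0.
rewrite (eq_measure_integral (mscale (`|c|%:nng) (pushforward mu (phi c d)))); last first.
  by move=> A mA _; exact: lebesgue_measure_affine.
rewrite ge0_integral_mscale//; congr (_ * _)%E.
by rewrite ge0_integral_pushforward// preimage_setT.
Qed.

Lemma integrable_affine (c d : R) (f : R -> R) : c != 0 ->
  mu.-integrable setT (EFin \o f) ->
  mu.-integrable setT (EFin \o (fun x => f (c * x + d))).
Proof.
move=> c0 /integrableP[mf fi]; apply/integrableP; split.
  exact: (measurableT_comp mf (measurable_affine c d)).
move: fi; rewrite (@ge0_integral_affine c d)//; last exact: measurableT_comp.
have : (0 <= \int[mu]_x `|(EFin \o (fun x => f (c * x + d)%R)) x|)%E by exact: integral_ge0.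
rewrite /=; case: (integral _ _ _) => //= [r _ _|_]; first exact: ltry.
by rewrite gt0_muley ?lte_fin ?normr_gt0.
Qed.

Lemma Rintegral_affine (c d : R) (f : R -> R) : c != 0 ->
  mu.-integrable setT (EFin \o f) ->
  (\int[mu]_x f x = `|c| * \int[mu]_x f (c * x + d)).
Proof.
move=> c0 fi; rewrite -RintegralZl//; last exact: integrable_affine.
rewrite /Rintegral; congr fine; rewrite [LHS]integralE [RHS]integralE.
have mf : measurable_fun setT (EFin \o f) by case/integrableP : fi.
rewrite (@ge0_integral_affine c d)//; last exact: measurable_funepos.
rewrite (@ge0_integral_affine c d _ c0 (measurable_funeneg mf))//.
have cge : (0 <= `|c|%:E)%E by rewrite lee_fin.
rewrite -ge0_integralZl//; last first.
  exact: (measurableT_comp (measurable_funepos mf) (measurable_affine c d)).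
rewrite -ge0_integralZl//; last first.
  exact: (measurableT_comp (measurable_funeneg mf) (measurable_affine c d)).
congr (_ - _)%E; apply: eq_integral => x _.
  by rewrite !funeposE /= maxeMr// mule0.
by rewrite !funenegE /= maxeMr// mule0; congr (maxe (EFin _) _); exact: mulrN.
Qed.

End affine.

Section convergence.
Context d (T : measurableType d) {R : realType} (mu : {measure set T -> \bar R}).

Lemma integrable_bounded_by (D : set T) (f g : T -> R) : measurable D ->
  measurable_fun D f -> mu.-integrable D (EFin \o g) ->
  (forall x, D x -> `|f x| <= g x) -> mu.-integrable D (EFin \o f).
Proof.
move=> mD mf gi fg; apply: le_integrable gi => //; first exact/measurable_EFinP.
by move=> x Dx /=; rewrite lee_fin (le_trans (fg _ Dx))// ler_norm.
Qed.

Lemma Rintegral_dominated_cvg (D : set T) (f_ : nat -> T -> R) (f g : T -> R) :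
  measurable D -> (forall n, measurable_fun D (f_ n)) ->
  (forall x, D x -> f_ n x @[n --> \oo] --> f x) ->
  mu.-integrable D (EFin \o g) ->
  (forall n x, D x -> `|f_ n x| <= g x) ->
  mu.-integrable D (EFin \o f) /\
  \int[mu]_(x in D) f_ n x @[n --> \oo] --> \int[mu]_(x in D) f x.
Proof.
move=> mD mf ff gi fg.
have mF : measurable_fun D f by apply: (measurable_fun_cvg mf).
have ae_ff : {ae mu, forall x, D x -> (EFin \o f_ n) x @[n --> \oo] --> (EFin \o f) x}.
  by apply: aeW => x Dx; apply: cvg_EFin; [exact: nearW|exact: ff].
have ae_fg : {ae mu, forall x n, D x -> (`|(EFin \o f_ n) x| <= (EFin \o g) x)%E}.
  by apply: aeW => x n Dx; rewrite lee_fin; exact: fg.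
have [fi _ fcv] := @dominated_convergence _ _ _ mu D mD (fun n => EFin \o f_ n)
  (EFin \o f) (EFin \o g) (fun n => (measurable_EFinP D (f_ n)).2 (mf n))
  ((measurable_EFinP D f).2 mF) ae_ff gi ae_fg.
split => //; apply: fine_cvg; rewrite fineK//; exact: integrable_fin_num.
Qed.

End convergence.

(** * The fundamental theorem of calculus on the open half line *)

Section half_line.
Context {R : realType}.
Notation mu := (@lebesgue_measure R).
Notation pos := (`]0, +oo[%classic : set R).
Implicit Types G g : R -> R.

(** Compact intervals exhausting ]0, +oo[; the shift by 2 gives low n < 1 < upp n from n = 0 on. *)
Let low n : R := n.+2%:R^-1.
Let upp n : R := n.+2%:R.
Let I n : set R := `[low n, upp n].

Let low_gt0 n : 0 < low n. Proof. by rewrite invr_gt0. Qed.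
Let low_upp n : low n < upp n.
Proof.
rewrite (@lt_trans _ _ 1)//; last by rewrite ltr1n.
by rewrite invf_lt1// ltr1n.
Qed.

Let I_pos n : I n `<=` pos.
Proof.
move=> x; rewrite /I /= !in_itv/= andbT => /andP[+ _].
exact: lt_le_trans.
Qed.

Let nondecreasing_I : nondecreasing_seq I.
Proof.
apply/nondecreasing_seqP => n; apply/subsetPset => x; rewrite /I /= !in_itv/=.
move=> /andP[h1 h2]; apply/andP; split.
  by apply: le_trans h1; rewrite lef_pV2 ?posrE// ler_nat.
by apply: le_trans h2 _; rewrite ler_nat.
Qed.

Let pos_I (x : R) : pos x -> \forall n \near \oo, I n x.
Proof.
rewrite /= in_itv/= andbT => x0; near=> n; rewrite /I/= in_itv/=; apply/andP; split.
- rewrite /low -(invrK x) lef_pV2 ?posrE ?invr_gt0//.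
  rewrite (@le_trans _ _ n%:R)// ?ler_nat; last by rewrite -addn2 leq_addr.
  by near: n; exact: nbhs_infty_ger.
- rewrite (@le_trans _ _ n%:R)// ?ler_nat; last by rewrite -addn2 leq_addr.
  by near: n; exact: nbhs_infty_ger.
Unshelve. all: by end_near. Qed.

Let bigcup_I : \bigcup_n I n = pos.
Proof.
apply/seteqP; split => [x [n _]|x /pos_I [N _ h]]; first exact: I_pos.
by exists N => //; apply: h => /=.
Qed.

Lemma measurable_pos_continuous g :
  (forall x : R, 0 < x -> {for x, continuous g}) -> measurable_fun pos g.
Proof.
move=> cg; apply: open_continuous_measurable_fun => // x.
by rewrite inE/= in_itv/= andbT => /cg.
Qed.

Section FTC.
Variables G g : R -> R.
Hypothesis Gg : forall x : R, 0 < x -> is_derive x 1 G (g x).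
Hypothesis cg : forall x : R, 0 < x -> {for x, continuous g}.

Let FTC n : (\int[mu]_(x in I n) (g x)%:E = (G (upp n))%:E - (G (low n))%:E)%E.
Proof.
have dG (x : R) : low n <= x -> is_derive x 1 G (g x).
  by move=> h; apply: Gg; exact: lt_le_trans h.
rewrite (@continuous_FTC2 _ g G)//.
- apply: continuous_in_subspaceT => x; rewrite inE/= in_itv/= => /andP[h _].
  by apply: cg; exact: lt_le_trans h.
- split.
  + by move=> x; rewrite in_itv/= => /andP[/ltW/dG[]].
  + apply: cvg_at_right_filter; exact: (is_derive_continuous (dG (low n) (lexx _))).
  + apply: cvg_at_left_filter; exact: (is_derive_continuous (dG (upp n) (ltW (low_upp n)))).
- by move=> x; rewrite in_itv/= => /andP[/ltW/dG[? <-] _]; rewrite derive1E.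
Qed.

(** Over [I n] the integral of [g] is a difference of two values of [G], hence at most 2 M, and
    monotone convergence carries the bound to the half line. *)
Lemma integrable_pos_FTC (M : R) : (forall x : R, 0 < x -> 0 <= g x) ->
  (forall x : R, 0 < x -> `|G x| <= M) -> mu.-integrable pos (EFin \o g).
Proof.
move=> g0 GM; apply/integrableP; split.
  apply/measurable_EFinP; exact: measurable_pos_continuous.
have mg : measurable_fun pos (EFin \o g).
  apply/measurable_EFinP; exact: measurable_pos_continuous.
have -> : (\int[mu]_(x in pos) `|(EFin \o g) x| = \int[mu]_(x in pos) (EFin \o g) x)%E.
  apply: eq_integral => x; rewrite inE/= in_itv/= andbT => x0.
  by rewrite ger0_norm// g0.
have mgI n : measurable_fun (I n) (EFin \o g).
  by apply: measurable_funS mg => //; exact: I_pos.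
have gI0 n x : I n x -> (0 <= (EFin \o g) x)%E.
  by move=> /I_pos; rewrite /= in_itv/= andbT lee_fin => /g0.
have mI n : measurable (I n) by exact: measurable_itv.
have := @ge0_nondecreasing_set_cvg_integral _ (measurableTypeR R) _ I (EFin \o g) mu nondecreasing_I mI mgI gI0.
rewrite bigcup_I => /cvg_lim <-//.
apply: (@le_lt_trans _ _ (2 * M)%:E); last exact: ltry.
apply: lime_le.
  apply: ereal_nondecreasing_is_cvgn.
  exact: ge0_nondecreasing_set_nondecreasing_integral.
apply: nearW => n; rewrite FTC -EFinD lee_fin.
rewrite (le_trans (ler_norm _))// (le_trans (ler_normB _ _))// mulr_natl mulr2n lerD// GM//.
Qed.

(** The truncations of [g] to [I n] are dominated by |g|, so their integrals, which are G (upp n) -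
    G (low n), converge to the whole integral. *)
Lemma Rintegral_pos_FTC (l l' : R) : mu.-integrable pos (EFin \o g) ->
  G x @[x --> 0^'+] --> l -> G x @[x --> +oo] --> l' ->
  \int[mu]_(x in pos) g x = l' - l.
Proof.
move=> gi Gl Gl'.
pose f n := g \_ (I n).
have mI n : measurable (I n) by exact: measurable_itv.
have mg : measurable_fun pos g by exact: measurable_pos_continuous.
have [||||_ fcv] := @Rintegral_dominated_cvg _ _ _ mu pos f g (fun x => `|g x|) (measurable_itv _).
- move=> n; apply: measurable_funTS; apply/(measurable_restrictT g) => //.
  by apply: measurable_funS mg.
- move=> x px; apply: cvg_near_cst; near=> n.
  by rewrite /f patchE mem_set//; near: n; exact: pos_I.
- by move/integrable_abse : gi; apply: eq_integrable.
- by move=> n x _; rewrite /f patchE; case: ifPn => // _; rewrite normr0.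
have fE n : \int[mu]_(x in pos) f n x = G (upp n) - G (low n).
  rewrite /f -Rintegral_mkcondr setIC (setIidl (@I_pos n)) /Rintegral FTC.
  by rewrite -EFinD.
have fcv2 : \int[mu]_(x in pos) f n x @[n --> \oo] --> l' - l.
  under eq_fun do rewrite fE.
  apply: cvgB.
    move/cvg_pinftyP : Gl' => /(_ upp); apply.
    apply/cvgryPge => r; near=> n.
    rewrite (@le_trans _ _ n%:R)// ?ler_nat; last by rewrite -addn2 leq_addr.
    by near: n; exact: nbhs_infty_ger.
  move/cvg_at_rightP : Gl => /(_ low); apply; split => //.
  by have := @cvg_harmonic R; rewrite -cvg_shiftS.
by move: fcv2 => /cvg_lim <-//; move/cvg_lim : fcv => ->.
Unshelve. all: by end_near. Qed.

End FTC.

End half_line.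

Section pointwise_calculus.
Context {R : realType}.
Implicit Types (f g : R -> R).

Lemma is_derive_inv f (x df : R) : f x != 0 -> is_derive x 1 f df ->
  is_derive x 1 (fun t => (f t)^-1) (- (f x) ^- 2 * df).
Proof. by move=> fx h; exact: is_deriveV. Qed.

Lemma continuous_for_mul f g (x : R) : {for x, continuous f} ->
  {for x, continuous g} -> {for x, continuous (fun t => f t * g t)}.
Proof. by move=> cf cg; exact: cvgM. Qed.

Lemma continuous_for_add f g (x : R) : {for x, continuous f} ->
  {for x, continuous g} -> {for x, continuous (fun t => f t + g t)}.
Proof. by move=> cf cg; exact: cvgD. Qed.

Lemma continuous_for_const (c x : R) : {for x, continuous (fun _ : R => c)}.
Proof. exact: cst_continuous. Qed.

Lemma continuous_for_comp f g (x : R) : {for x, continuous f} ->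
  {for f x, continuous g} -> {for x, continuous (fun t => g (f t))}.
Proof. by move=> cf cg; exact: (@continuous_comp _ _ _ f g). Qed.

End pointwise_calculus.

Section real_integrable.
Context d (T : measurableType d) {R : realType} (mu : {measure set T -> \bar R}).
Variables (D : set T) (mD : measurable D).

Lemma integrable_scale (c : R) (f : T -> R) : mu.-integrable D (EFin \o f) ->
  mu.-integrable D (EFin \o (fun t => c * f t)).
Proof. by move=> fi; have := integrableZl mD c fi; apply: eq_integrable. Qed.

Lemma integrable_add (f g : T -> R) : mu.-integrable D (EFin \o f) ->
  mu.-integrable D (EFin \o g) -> mu.-integrable D (EFin \o (fun t => f t + g t)).
Proof. by move=> fi gi; have := integrableD mD fi gi; apply: eq_integrable. Qed.

Lemma integrable_measurable (f : T -> R) : mu.-integrable D (EFin \o f) ->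
  measurable_fun D f.
Proof. by move=> /integrableP[/measurable_EFinP]. Qed.

End real_integrable.

(** * Gamma and polynomial weights, and the Gamma function *)

Section half_line_weights.
Context {R : realType}.
Notation mu := (@lebesgue_measure R).
Notation pos := (`]0, +oo[%classic : set R).

Lemma is_derive_powR (p x : R) : 0 < x ->
  is_derive x 1 (fun t : R => t `^ p) (p * x `^ (p - 1)).
Proof. exact: is_derive1_powR. Qed.

Lemma is_derive_expRN (x : R) : is_derive x 1 (fun t : R => expR (- t)) (- expR (- x)).
Proof.
have := is_derive_chain (is_derive_opp (is_derive_var x)) (is_derive_expR (- x)).
by rewrite mulrN mulr1.
Qed.

Lemma continuous_powR (p x : R) : 0 < x -> {for x, continuous (fun t : R => t `^ p)}.
Proof. by move=> x0; exact: is_derive_continuous (is_derive_powR p x0). Qed.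

(** With [N] the integer part of [p] and s = c t: for s > 1, s^p <= s^(N+1) <= (N+1)! exp s by one
    term of the exponential series; for s <= 1, s^p <= 1 <= exp s. The factor 1 + (N+1)! serves both
    cases. *)
Lemma powR_le_expR (p c : R) : 0 <= p -> 0 < c ->
  exists2 K : R, 0 < K & forall t : R, 0 <= t -> t `^ p <= K * expR (c * t).
Proof.
move=> p0 c0; pose N := Num.truncn p; pose F : R := N.+1`!%:R.
have F0 : 0 < F by rewrite ltr0n fact_gt0.
exists ((1 + F) / c `^ p).
  by rewrite divr_gt0 ?powR_gt0// addr_gt0.
move=> t t0; rewrite mulrAC ler_pdivlMr ?powR_gt0//.
rewrite -powRM ?(ltW c0)// mulrC; set s := c * t.
have s0 : 0 <= s by rewrite mulr_ge0// ltW.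
have [s1|s1] := leP s 1.
  have : s `^ p <= 1 `^ p by rewrite ge0_ler_powR ?nnegrE.
  rewrite powR1.
  have : 1 <= expR s by rewrite -expR0 ler_expR.
  by move: F0 => F0 h1 h2; nra.
have h : s ^+ N.+1 <= F * expR s.
  by rewrite mulrC -ler_pdivrMr// (le_trans _ (@expR_ge1Dxn _ s N s0))// lerDr.
apply: (@le_trans _ _ (s `^ N.+1%:R)).
- by apply: ler_powR; [exact: ltW|apply/ltW; exact: truncnS_gt].
- rewrite powR_mulrn// (le_trans h)// ler_pM2r ?expR_gt0//; lra.
Qed.

Lemma measurable_pos : measurable (pos : set (measurableTypeR R)).
Proof. exact: measurable_itv. Qed.

Lemma measurable_gamma_weight (x : R) :
  measurable_fun setT (fun t : R => t `^ (x - 1) * expR (- t)).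
Proof.
apply: measurable_funM => //.
by apply: measurableT_comp => //.
Qed.

(** Comparison with x t^(x-1) / (1 + t^x)^2, the derivative of the bounded function - 1 / (1 + t^x),
    which has the same singularity at 0. *)
Lemma integrable_gamma_weight (x : R) : 0 < x ->
  mu.-integrable pos (EFin \o (fun t => t `^ (x - 1) * expR (- t))).
Proof.
move=> x0.
have [K K0 HK] := @powR_le_expR (2 * x) 1 (mulr_ge0 (ler0n _ 2) (ltW x0)) ltr01.
pose G t : R := - (1 + t `^ x)^-1.
pose g t : R := x * t `^ (x - 1) / (1 + t `^ x) ^+ 2.
have tx (t : R) : 0 < t -> 0 < 1 + t `^ x by move=> t0; rewrite addr_gt0// powR_gt0.
have dtx (t : R) : 0 < t -> is_derive t 1 (fun t => 1 + t `^ x) (x * t `^ (x - 1)).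
  move=> t0; have := is_derive_add (is_derive_const 1 t) (is_derive_powR x t0).
  by rewrite add0r.
have Gg (t : R) : 0 < t -> is_derive t 1 G (g t).
  move=> t0; have h := dtx _ t0.
  apply: (is_derive_eq (is_derive_opp (@is_derive_inv _ (fun t => 1 + t `^ x) _ _ (lt0r_neq0 (tx _ t0)) h))).
  by rewrite /g mulNr opprK mulrC.
have cg (t : R) : 0 < t -> {for t, continuous g}.
  move=> t0; apply: continuous_for_mul.
    by apply: continuous_for_mul; [exact: continuous_for_const|exact: continuous_powR].
  apply: (@continuousV _ _ (fun t => (1 + t `^ x) ^+ 2)).
    by rewrite expf_neq0// gt_eqF// tx.
  by apply: continuous_for_mul; exact: (is_derive_continuous (dtx _ t0)).
have gi : mu.-integrable pos (EFin \o g).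
  apply: (integrable_pos_FTC Gg cg (M := 1)) => t t0.
    by rewrite /g divr_ge0 ?sqr_ge0// mulr_ge0 ?powR_ge0// ltW.
  by rewrite /G normrN gtr0_norm ?invr_gt0 ?tx// invf_le1 ?tx// lerDl powR_ge0.
(* (1 + t^x)^2 <= 2 + 2 t^(2x) <= (2 + 2 K) exp t, as [K] was obtained for the exponent 2 x. *)
pose C := (2 + 2 * K) / x.
have Cgi : mu.-integrable pos (EFin \o (fun t => C * g t)).
  exact: integrable_scale.
apply: (integrable_bounded_by _ _ Cgi) => //.
  apply: measurable_funTS; exact: measurable_gamma_weight.
move=> t; rewrite /= in_itv/= andbT => t0.
rewrite ger0_norm ?mulr_ge0 ?powR_ge0 ?expR_ge0//.
have -> : C * g t = t `^ (x - 1) * ((2 + 2 * K) / (1 + t `^ x) ^+ 2).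
  by rewrite /C /g; field; rewrite !gt_eqF ?tx.
rewrite ler_pM2l ?powR_gt0// ler_pdivlMr ?exprn_gt0 ?tx// mulrC expRN.
rewrite ler_pdivrMr ?expR_gt0//.
have /(_ (ltW t0)) := HK t; rewrite mul1r mulrC powRrM powR_mulrn ?powR_ge0// => h.
have e1 : 1 <= expR t by rewrite -expR0 ler_expR ltW.
have := sqr_ge0 (1 - t `^ x); nra.
Qed.

Lemma integrable_polynomial_weight (q : R) : 1 < q ->
  mu.-integrable pos (EFin \o (fun t => (1 + t) `^ (- q))).
Proof.
move=> q1.
pose G t : R := (1 + t) `^ (1 - q) / (1 - q).
have tx (t : R) : 0 < t -> 0 < 1 + t by move=> t0; rewrite addr_gt0.
have dt (t : R) : is_derive t 1 (fun t => 1 + t) (1 : R).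
  by have := is_derive_add (is_derive_const 1 t) (is_derive_var t); rewrite add0r.
have q0 : 1 - q != 0 by lra.
have Gg (t : R) : 0 < t -> is_derive t 1 G ((1 + t) `^ (- q)).
  move=> t0; apply: (is_derive_eq (is_derive_mul
    (is_derive_chain (dt t) (is_derive_powR (1 - q) (tx _ t0)))
    (is_derive_const _ _))).
  rewrite mulr0 add0r mulr1 mulKf//; congr (_ `^ _); ring.
have cg (t : R) : 0 < t -> {for t, continuous (fun t : R => (1 + t) `^ (- q))}.
  by move=> t0; exact: (@continuous_for_comp _ (fun t : R => 1 + t) (fun t : R => t `^ (- q)) t (is_derive_continuous (dt t)) (continuous_powR (tx _ t0))).
apply: (integrable_pos_FTC Gg cg (M := (q - 1)^-1)) => t t0.
- exact: powR_ge0.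
- rewrite /G normrM normfV (ler0_norm (_ : 1 - q <= 0)) ?opprB; last by lra.
  rewrite ler_piMl ?invr_ge0 ?subr_ge0 ?(ltW q1)// ger0_norm ?powR_ge0//.
  rewrite -[leRHS](powRr0 (1 + t)); apply: ler_powR; lra.
Qed.

(** f |x| is the sum of [f] extended by 0, of its reflection, and of a function carried by the
    origin, which is negligible. *)
Lemma integrable_even_extension (f : R -> R) : mu.-integrable pos (EFin \o f) ->
  mu.-integrable setT (EFin \o (fun x => f `|x|)) /\
  \int[mu]_x f `|x| = 2 * \int[mu]_(x in pos) f x.
Proof.
move=> fi.
pose h := f \_ pos.
have hi : mu.-integrable setT (EFin \o h).
  by have /(integrable_mkcond _ measurable_pos) := fi; rewrite restrict_EFin.
pose h' x := h (-1 * x + 0).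
have N10 : (-1 : R) != 0 by rewrite oppr_eq0 oner_eq0.
have hi' : mu.-integrable setT (EFin \o h') by exact: integrable_affine.
pose k : R -> R := cst (f 0) \_ [set 0].
have k0 : \int[mu]_x k x = 0 by rewrite /k -Rintegral_mkcond Rintegral_set1.
have mk : measurable_fun setT k.
  by apply/(measurable_restrictT (cst (f 0) : R -> R)) => //; exact: measurable_set1.
have ki : mu.-integrable setT (EFin \o k).
  apply/integrableP; split; first exact/measurable_EFinP.
  have -> : (\int[mu]_x `|(EFin \o k) x| = \int[mu]_(x in [set 0%R]) `|f 0|%:E)%E.
    rewrite [RHS]integral_mkcond; apply: eq_integral => x _.
    by rewrite /k /= !patchE; case: ifPn => //=; rewrite normr0.
  by rewrite integral_set1.
have hp x : 0 < x -> h x = f x.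
  by move=> x0; rewrite /h patchE mem_set//= in_itv/= x0.
have hn x : x <= 0 -> h x = 0.
  by move=> x0; rewrite /h patchE memNset//= in_itv/= andbT ltNge x0.
have kn x : x != 0 -> k x = 0.
  by move=> x0; rewrite /k patchE memNset//=; apply/eqP.
have E x : f `|x| = h x + h' x + k x.
  rewrite /h' mulN1r addr0; have [x0|x0|->] := ltgtP x 0.
  - by rewrite hn ?ltW// hp ?oppr_gt0// kn ?lt_eqF// add0r addr0 ltr0_norm.
  - by rewrite hp// hn ?oppr_le0 ?ltW// kn ?gt_eqF// !addr0 gtr0_norm.
  - by rewrite oppr0 hn// /k patchE mem_set//= normr0 !add0r.
have -> : (fun x => f `|x|) = (fun x => h x + h' x + k x) by exact/funext.
have hhi := integrable_add measurableT hi hi'.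
split; first exact: integrable_add.
rewrite RintegralD// k0 addr0 RintegralD//.
have := Rintegral_affine 0 N10 hi; rewrite normrN1 mul1r => <-.
by rewrite -Rintegral_mkcond; ring.
Qed.

(** If the integral vanished, the integrand would vanish almost everywhere on ]0, +oo[; being
    positive at every point there, it would make the half line negligible. *)
Lemma Gamma_gt0 (x : R) : 0 < x -> 0 < Gamma x.
Proof.
move=> x0; have gi := integrable_gamma_weight x0.
pose f (t : R) := t `^ (x - 1) * expR (- t).
have f0 (t : R) : 0 <= f t by rewrite mulr_ge0 ?powR_ge0// expR_ge0.
rewrite lt_neqAle Rintegral_ge0 ?andbT => [|t _]; last exact: f0.
apply/eqP => /esym; rewrite /Gamma /Rintegral => h.
have fin := integrable_fin_num measurable_pos gi.
have h0 : (\int[mu]_(t in pos) `|(EFin \o f) t| = 0)%E.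
  transitivity (\int[mu]_(t in pos) (EFin \o f) t)%E.
    by apply: eq_integral => t _; rewrite /= ger0_norm.
  by rewrite -(fineK fin) h.
have mf : measurable_fun pos (EFin \o f) by case/integrableP : gi.
have [N [mN N0 /= sN]] := (ae_eq_integral_abs mu measurable_pos mf).1 h0.
have : (mu pos <= mu N)%E.
  apply: le_measure; [exact: (mem_set measurable_pos)|exact: mem_set|].
  move=> t pt; apply: sN => /= /(_ pt)[]/eqP.
  rewrite mulf_eq0 expR_eq0 orbF powR_eq0 => /andP[/eqP t0 _].
  by move: pt; rewrite /= in_itv/= t0 ltxx.
by rewrite N0 lebesgue_measure_itv/= ltry.
Qed.

Lemma Rintegral_pos_scale (c : R) (f : R -> R) : 0 < c ->
  mu.-integrable pos (EFin \o f) ->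
  mu.-integrable pos (EFin \o (fun t => f (c * t))) /\
  \int[mu]_(t in pos) f t = c * \int[mu]_(t in pos) f (c * t).
Proof.
move=> c0 /(integrable_mkcond _ measurable_pos); rewrite restrict_EFin => fi.
have c0' : c != 0 by rewrite gt_eqF.
have E : (fun t => (f \_ pos) (c * t + 0)) = (fun t => f (c * t)) \_ pos.
  apply/funext => t; rewrite !patchE addr0; have [t0|t0] := ltP 0 t.
    by rewrite !mem_set/= ?in_itv/= ?andbT ?mulr_gt0.
  by rewrite !memNset/= ?in_itv/= ?andbT -?leNgt ?pmulr_rle0//; apply/negP; rewrite -leNgt ?pmulr_rle0.
split.
  apply/(integrable_mkcond _ measurable_pos); rewrite restrict_EFin -E.
  exact: integrable_affine.
rewrite Rintegral_mkcond [in RHS]Rintegral_mkcond (Rintegral_affine 0 c0' fi) gtr0_norm//.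
by rewrite E.
Qed.

(** With x = beta and c = 1 + t^2 this exhibits (1 + t^2)^(-beta) as a gamma mixture of Gaussians in
    [t]. *)
Lemma Gamma_scale (x c : R) : 0 < x -> 0 < c ->
  mu.-integrable pos (EFin \o (fun t => t `^ (x - 1) * expR (- (c * t)))) /\
  \int[mu]_(t in pos) (t `^ (x - 1) * expR (- (c * t))) = c `^ (- x) * Gamma x.
Proof.
move=> x0 c0; have [fi fE] := Rintegral_pos_scale c0 (integrable_gamma_weight x0).
have c0' : c != 0 by rewrite gt_eqF.
have E (t : R) : 0 < t -> t `^ (x - 1) * expR (- (c * t)) =
    c `^ (1 - x) * ((c * t) `^ (x - 1) * expR (- (c * t))).
  move=> t0; rewrite powRM ?ltW// !mulrA -powRD ?c0' ?implybT//.
  by rewrite (_ : 1 - x + (x - 1) = 0) ?powRr0 ?mul1r//; ring.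
split.
  have := integrable_scale measurable_pos (c `^ (1 - x)) fi.
  apply: eq_integrable => // t; rewrite inE/= in_itv/= andbT => t0; by rewrite E.
rewrite {1}/Gamma fE mulrA.
have -> : c `^ (- x) * c = c `^ (1 - x).
  by rewrite [in RHS]addrC powRD ?c0' ?implybT// powRr1// ltW.
rewrite -(RintegralZl _ measurable_pos fi); apply: eq_Rintegral => t.
by rewrite inE/= in_itv/= andbT => t0; rewrite E.
Qed.

End half_line_weights.

(** * Cosine transforms of the Gaussian and gamma weights *)

Section cosine_transform.
Context {R : realType}.
Notation mu := (@lebesgue_measure R).
Notation pos := (`]0, +oo[%classic : set R).

Lemma sin_le1_norm (x : R) : `|sin x| <= 1.
Proof. by rewrite ler_norml sin_geN1 sin_le1. Qed.

Lemma cos_le1_norm (x : R) : `|cos x| <= 1.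
Proof. by rewrite ler_norml cos_geN1 cos_le1. Qed.

Lemma is_derive_scale_var (c x : R) : is_derive x 1 (fun t => c * t) c.
Proof. by have := is_derive_scale c (is_derive_var x); rewrite mulr1. Qed.

Lemma is_derive_cos_scale (c x : R) :
  is_derive x 1 (fun t => cos (c * t)) (- (c * sin (c * x))).
Proof.
have := is_derive_chain (is_derive_scale_var c x) (is_derive_cos (c * x)).
by rewrite mulNr mulrC.
Qed.

Lemma is_derive_sin_scale (c x : R) :
  is_derive x 1 (fun t => sin (c * t)) (c * cos (c * x)).
Proof.
have := is_derive_chain (is_derive_scale_var c x) (is_derive_sin (c * x)).
by rewrite mulrC.
Qed.

Lemma measurable_cos_scale (c : R) (D : set R) : measurable_fun D (fun t : R => cos (c * t)).
Proof.
apply: measurable_funTS; apply: continuous_measurable_fun => x.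
exact: is_derive_continuous (is_derive_cos_scale c x).
Qed.

Lemma measurable_sin_scale (c : R) (D : set R) : measurable_fun D (fun t : R => sin (c * t)).
Proof.
apply: measurable_funTS; apply: continuous_measurable_fun => x.
exact: is_derive_continuous (is_derive_sin_scale c x).
Qed.

Lemma integrable_mul_bounded (D : set R) (w h : R -> R) : measurable (D : set (measurableTypeR R)) ->
  mu.-integrable D (EFin \o w) -> measurable_fun D h -> (forall t, `|h t| <= 1) ->
  mu.-integrable D (EFin \o (fun t => w t * h t)).
Proof.
move=> mD wi mh h1.
have wi' : mu.-integrable D (EFin \o (fun t => `|w t|)).
  by have := integrable_abse wi; apply: eq_integrable.
apply: (integrable_bounded_by mD _ wi').
  by apply: measurable_funM => //; exact: (integrable_measurable wi).
by move=> t _; rewrite normrM ler_piMr.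
Qed.

Variable w : R -> R.
Hypothesis wi : mu.-integrable pos (EFin \o w).
Hypothesis twi : mu.-integrable pos (EFin \o (fun t => t * w t)).

Let twi' : mu.-integrable pos (EFin \o (fun t => `|t * w t|)).
Proof. by have := integrable_abse twi; apply: eq_integrable. Qed.

Let is_derive_transform (f f' : R -> R -> R) (x : R) :
  (forall y, mu.-integrable pos (EFin \o f y)) ->
  (forall y t : R, is_derive y 1 (f ^~ t) (f' y t)) ->
  (forall y t : R, `|f' y t| <= `|t * w t|) ->
  is_derive x 1 (fun y => \int[mu]_(t in pos) f y t) (\int[mu]_(t in pos) f' x t).
Proof.
move=> fi df f'le.
have xI : `](x - 1), (x + 1)[%classic x by rewrite /= in_itv/=; lra.
have d1 (y t : R) : partial1of2 f y t = f' y t.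
  by rewrite partial1of2E; have [] := df y t.
have h1 (y : R) (_ : `](x - 1), (x + 1)[%classic y) := fi y.
have h2 (y t : R) (_ : `](x - 1), (x + 1)[%classic y) (_ : pos t) : derivable (f ^~ t) y 1.
  by have [] := df y t.
have h3 (y t : R) (_ : `](x - 1), (x + 1)[%classic y) (_ : pos t) :
  `|partial1of2 f y t| <= `|t * w t| by rewrite d1.
have dd := derivable_under_integral measurable_pos xI h1 h2 (fun=> normr_ge0 _) twi' h3.
apply: DeriveDef; first exact: dd.
rewrite -derive1E (differentiation_under_integral measurable_pos xI h1 h2 (fun=> normr_ge0 _) twi' h3).
by apply: eq_Rintegral => t _; rewrite d1.
Qed.

Lemma is_derive_cos_transform (x : R) :
  is_derive x 1 (fun x => \int[mu]_(t in pos) (w t * cos (x * t)))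
    (- \int[mu]_(t in pos) (t * w t * sin (x * t))).
Proof.
have si : mu.-integrable pos (EFin \o (fun t => t * w t * sin (x * t))).
  apply: integrable_mul_bounded => // [|t]; last exact: sin_le1_norm.
  exact: measurable_sin_scale.
rewrite -mulN1r -(RintegralZl _ measurable_pos si).
apply: (is_derive_transform (f := fun x t => w t * cos (x * t))
  (f' := fun x t => -1 * (t * w t * sin (x * t)))) => [y|y t|y t].
- apply: integrable_mul_bounded => // [|t]; last exact: cos_le1_norm.
  exact: measurable_cos_scale.
- have -> : (fun y => w t * cos (y * t)) = (fun y => w t * cos (t * y)).
    by apply/funext => z; rewrite (mulrC t).
  apply: (is_derive_eq (is_derive_scale (w t) (is_derive_cos_scale t y))).
  rewrite (mulrC t y); ring.
- rewrite mulN1r normrN normrM ler_piMr//; exact: sin_le1_norm.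
Qed.

Lemma is_derive_sin_transform (x : R) :
  is_derive x 1 (fun x => \int[mu]_(t in pos) (w t * sin (x * t)))
    (\int[mu]_(t in pos) (t * w t * cos (x * t))).
Proof.
apply: (is_derive_transform (f := fun x t => w t * sin (x * t))
  (f' := fun x t => t * w t * cos (x * t))) => [y|y t|y t].
- apply: integrable_mul_bounded => // [|t]; last exact: sin_le1_norm.
  exact: measurable_sin_scale.
- have -> : (fun y => w t * sin (y * t)) = (fun y => w t * sin (t * y)).
    by apply/funext => z; rewrite (mulrC t).
  apply: (is_derive_eq (is_derive_scale (w t) (is_derive_sin_scale t y))).
  rewrite (mulrC t y); ring.
- rewrite normrM ler_piMr//; exact: cos_le1_norm.
Qed.

End cosine_transform.

(** * The Gaussian weight *)

Section gaussian_transform.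
Context {R : realType}.
Notation mu := (@lebesgue_measure R).
Notation pos := (`]0, +oo[%classic : set R).

Let w (t : R) := expR (- t ^+ 2).

Let is_derive_w (x : R) : is_derive x 1 w (- (2 * x) * w x).
Proof.
have h1 := is_derive_opp (is_derive_mul (is_derive_var x) (is_derive_var x)).
have h2 := is_derive_chain h1 (is_derive_expR (- (x * x))).
have -> : w = (fun t => expR (- (t * t))) by apply/funext => t; rewrite /w expr2.
by apply: (is_derive_eq h2); rewrite mulr1; ring.
Qed.

Let wi : mu.-integrable pos (EFin \o w).
Proof.
apply: integrableS (@integrableT_gauss R) => //; exact: measurable_pos.
Qed.

Let w_cvg : w x @[x --> +oo] --> (0 : R).
Proof. exact: cvg_gauss_fun. Qed.

Let twi : mu.-integrable pos (EFin \o (fun t => t * w t)).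
Proof.
have Gg (x : R) : 0 < x -> is_derive x 1 (fun t => - 2^-1 * w t) (x * w x).
  move=> _; apply: (is_derive_eq (is_derive_scale (- 2^-1) (is_derive_w x))); by field.
have cg (x : R) : 0 < x -> {for x, continuous (fun t : R => t * w t)}.
  move=> _; apply: continuous_for_mul; first exact: (is_derive_continuous (is_derive_var x)).
  exact: is_derive_continuous (is_derive_w x).
apply: (integrable_pos_FTC Gg cg (M := 1)) => x x0.
  by rewrite mulr_ge0 ?expR_ge0// ltW.
rewrite mulNr normrN ger0_norm ?mulr_ge0 ?invr_ge0 ?expR_ge0//.
have : w x <= 1 by rewrite -expR0 ler_expR oppr_le0 sqr_ge0.
have := expR_ge0 (- x ^+ 2); rewrite -/(w x); lra.
Qed.

(** Let A be the left side and B the integral of t exp (- t^2) sin (x t). Then A' = - B, and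
    integrating the derivative of exp (- t^2) sin (x t) gives x A = 2 B. Hence A exp (x^2 / 4) is
    constant, and its value at 0 is the Gauss integral. *)
Lemma gaussian_cos_transform (x : R) :
  \int[mu]_(t in pos) (expR (- t ^+ 2) * cos (x * t)) = Num.sqrt pi / 2 * expR (- x ^+ 2 / 4).
Proof.
pose A (x : R) := \int[mu]_(t in pos) (w t * cos (x * t)).
pose B (x : R) := \int[mu]_(t in pos) (t * w t * sin (x * t)).
have dA (y : R) : is_derive y 1 A (- B y) := is_derive_cos_transform wi twi y.
have ibp (y : R) : y * A y = 2 * B y.
  have i1 : mu.-integrable pos (EFin \o (fun t => w t * cos (y * t))).
    apply: integrable_mul_bounded => // [|t]; last exact: cos_le1_norm.
    exact: measurable_cos_scale.
  have i2 : mu.-integrable pos (EFin \o (fun t => t * w t * sin (y * t))).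
    apply: integrable_mul_bounded => // [|t]; last exact: sin_le1_norm.
    exact: measurable_sin_scale.
  pose g t := y * (w t * cos (y * t)) + (-2) * (t * w t * sin (y * t)).
  have gi : mu.-integrable pos (EFin \o g).
    by apply: integrable_add; [exact: measurable_pos|apply: integrable_scale..] => //; exact: measurable_pos.
  have cw (t : R) := is_derive_continuous (is_derive_w t).
  have cg (t : R) : 0 < t -> {for t, continuous g}.
    move=> _; apply: continuous_for_add.
      apply: continuous_for_mul; first exact: continuous_for_const.
      apply: continuous_for_mul; first exact: cw.
      exact: (is_derive_continuous (is_derive_cos_scale y t)).
    apply: continuous_for_mul; first exact: continuous_for_const.
    apply: continuous_for_mul; last exact: (is_derive_continuous (is_derive_sin_scale y t)).
    apply: continuous_for_mul; last exact: cw.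
    exact: (is_derive_continuous (is_derive_var t)).
  have Gg0 (t : R) : is_derive t 1 (fun t => w t * sin (y * t)) (g t).
    apply: (is_derive_eq (is_derive_mul (is_derive_w t) (is_derive_sin_scale y t))).
    rewrite /g; ring.
  have gE : \int[mu]_(t in pos) g t = y * A y + -2 * B y.
    rewrite (RintegralD measurable_pos (integrable_scale measurable_pos y i1) (integrable_scale measurable_pos (-2) i2)).
    by rewrite (RintegralZl _ measurable_pos i1) (RintegralZl _ measurable_pos i2).
  have := Rintegral_pos_FTC (fun t _ => Gg0 t) cg (l := 0) (l' := 0) gi.
  rewrite subrr gE => h.
  suff : y * A y + -2 * B y = 0 by lra.
  apply: h => //.
    apply: cvg_at_right_filter; have := is_derive_continuous (Gg0 0).
    by rewrite /prop_for /continuous_at mulr0 sin0 mulr0.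
  apply: norm_cvg0; apply: (@squeeze_cvgr _ _ _ _ (cst 0) w _ _ _ (cvg_cst _) w_cvg).
  apply: nearW => t; rewrite normr_ge0/= normrM ger0_norm ?expR_ge0// ler_piMr ?expR_ge0//.
  exact: sin_le1_norm.
pose E (y : R) := expR (4^-1 * (y * y)).
have dE (y : R) : is_derive y 1 E (y / 2 * E y).
  have h1 := is_derive_scale 4^-1 (is_derive_mul (is_derive_var y) (is_derive_var y)).
  apply: (is_derive_eq (is_derive_chain h1 (is_derive_expR _))).
  by rewrite /E mulr1; field.
have dAE (y : R) : is_derive y 1 (fun y => A y * E y) 0.
  apply: (is_derive_eq (is_derive_mul (dA y) (dE y))).
  have := ibp y; set a := A y; set b := B y; set e := E y => h.
  have -> : b = y * a / 2 by lra.
  by field.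
have := is_derive_0_is_cst x 0 dAE.
have -> : A 0 = Num.sqrt pi / 2.
  rewrite /A; under eq_Rintegral do rewrite mul0r cos0 mulr1.
  have := @integral0y_gauss R; rewrite /Rintegral -integral_itv_obnd_cbnd; last first.
    by case/integrableP : wi.
  by rewrite /w /gauss_fun => ->.
rewrite /E !mulr0 expR0 mulr1 -/(A x) => <-.
by rewrite -mulrA -expRD (_ : _ + _ = 0) ?expR0 ?mulr1//; field.
Qed.

End gaussian_transform.

(** * The gamma weight *)

Section gamma_transform.
Context {R : realType}.
Notation mu := (@lebesgue_measure R).
Notation pos := (`]0, +oo[%classic : set R).
Variable s : R.
Hypothesis s0 : 0 < s.

Let w (t : R) := t `^ (s - 1) * expR (- t).
Let W (t : R) := t `^ s * expR (- t).

Let tw (t : R) : 0 < t -> t * w t = W t.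
Proof. by move=> t0; rewrite /w mulrA mulr_powRB1// ltW. Qed.

Let wi : mu.-integrable pos (EFin \o w) := integrable_gamma_weight s0.

Let twi : mu.-integrable pos (EFin \o (fun t => t * w t)).
Proof.
have s1 : 0 < s + 1 by rewrite addr_gt0.
have := integrable_gamma_weight s1; apply: eq_integrable; first exact: measurable_pos.
by move=> t; rewrite inE/= in_itv/= andbT addrK => t0; rewrite tw.
Qed.

Let is_derive_W (t : R) : 0 < t -> is_derive t 1 W (s * w t - t * w t).
Proof.
move=> t0; apply: (is_derive_eq (is_derive_mul (is_derive_powR s t0) (is_derive_expRN t))).
rewrite tw// /W /w; ring.
Qed.

Let continuous_w (t : R) : 0 < t -> {for t, continuous w}.
Proof.
move=> t0; apply: continuous_for_mul; first exact: continuous_powR.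
exact: is_derive_continuous (is_derive_expRN t).
Qed.

Let W_cvg0 : W t @[t --> 0^'+] --> (0 : R).
Proof.
apply: (@squeeze_cvgr _ _ _ _ (cst 0) (fun t => t `^ s) _ _ _ (cvg_cst _) (powR_cvg0 s0)).
near=> t; rewrite mulr_ge0 ?powR_ge0 ?expR_ge0//= ler_piMr ?powR_ge0//.
rewrite -expR0 ler_expR oppr_le0; apply/ltW; near: t; exact: nbhs_right_gt.
Unshelve. all: by end_near. Qed.

Let W_cvgy : W t @[t --> +oo] --> (0 : R).
Proof.
have h2 : (0 : R) < 2^-1 by rewrite invr_gt0.
have [K K0 HK] := powR_le_expR (ltW s0) h2.
have Kc : K * expR (- (2^-1 * t)) @[t --> +oo] --> (0 : R).
  rewrite -(mulr0 K); apply: cvgM; first exact: cvg_cst.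
  apply: (cvg_comp _ _ _ (@cvgr_expR R)).
  by apply: gt0_cvgMry => //; exact: cvg_id.
apply: (@squeeze_cvgr _ _ _ _ (cst 0) _ _ _ _ (cvg_cst _) Kc).
near=> t; rewrite mulr_ge0 ?powR_ge0 ?expR_ge0//=.
have t0 : 0 <= t by near: t; exact: nbhs_pinfty_ge.
rewrite (_ : - (2^-1 * t) = 2^-1 * t - t); last by field.
rewrite expRD mulrA ler_pM2r ?expR_gt0//; exact: HK.
Unshelve. all: by end_near. Qed.

(** The derivative of W h integrates to 0: [W] vanishes at 0 because s > 0, and at infinity by
    exponential decay. *)
Let ibp (h dh : R -> R) : (forall t : R, is_derive t 1 h (dh t)) -> continuous dh ->
  (forall t, `|h t| <= 1) -> 
  mu.-integrable pos (EFin \o (fun t => t * w t * dh t)) ->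
  s * (\int[mu]_(t in pos) (w t * h t)) - \int[mu]_(t in pos) (t * w t * h t) +
    \int[mu]_(t in pos) (t * w t * dh t) = 0.
Proof.
move=> hd cdh h1 i3.
have ch (t : R) : {for t, continuous h} := is_derive_continuous (hd t).
have mh : measurable_fun pos h.
  by apply: measurable_funTS; exact: continuous_measurable_fun.
have i1 := integrable_mul_bounded measurable_pos wi mh h1.
have i2 := integrable_mul_bounded measurable_pos twi mh h1.
pose g t := s * (w t * h t) + -1 * (t * w t * h t) + t * w t * dh t.
have j1 := integrable_scale measurable_pos s i1.
have j2 := integrable_scale measurable_pos (-1) i2.
have j12 := integrable_add measurable_pos j1 j2.
have gi : mu.-integrable pos (EFin \o g) := integrable_add measurable_pos j12 i3.
have cg (t : R) : 0 < t -> {for t, continuous g}.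
  move=> t0; have cw := continuous_w t0.
  have cv := is_derive_continuous (is_derive_var t).
  repeat (apply: continuous_for_add || apply: continuous_for_mul) => //;
    try exact: continuous_for_const; exact: cdh.
have Gg (t : R) : 0 < t -> is_derive t 1 (fun t => W t * h t) (g t).
  move=> t0; apply: (is_derive_eq (is_derive_mul (is_derive_W t0) (hd t))).
  rewrite /g -(tw t0); ring.
have b t : `|W t * h t| <= W t.
  have W0 : 0 <= W t by rewrite mulr_ge0 ?powR_ge0 ?expR_ge0.
  by rewrite normrM (ger0_norm W0) ler_piMr.
have c0 : W t * h t @[t --> 0^'+] --> (0 : R).
  apply: norm_cvg0; apply: (@squeeze_cvgr _ _ _ _ (cst 0) W _ _ _ (cvg_cst _) W_cvg0).
  by apply: nearW => t; rewrite normr_ge0/=.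
have cy : W t * h t @[t --> +oo] --> (0 : R).
  apply: norm_cvg0; apply: (@squeeze_cvgr _ _ _ _ (cst 0) W _ _ _ (cvg_cst _) W_cvgy).
  by apply: nearW => t; rewrite normr_ge0/=.
have := Rintegral_pos_FTC Gg cg gi c0 cy.
rewrite subrr (RintegralD measurable_pos j12 i3) (RintegralD measurable_pos j1 j2).
by rewrite (RintegralZl _ measurable_pos i1) (RintegralZl _ measurable_pos i2) mulN1r.
Qed.

(** The real part of the formula Gamma s (1 - i x)^(-s) for the integral A + i B of t^(s-1) exp (-
    t) exp (i x t). Integration by parts gives (1 - i x) (A + i B)' = i s (A + i B), so (1 - i x)^s
    (A + i B) is constant. *)
Lemma gamma_cos_transform (x : R) :
  \int[mu]_(t in pos) (t `^ (s - 1) * expR (- t) * cos (x * t)) =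
  Gamma s * (1 + x ^+ 2) `^ (- (s / 2)) * cos (s * atan x).
Proof.
pose A (x : R) := \int[mu]_(t in pos) (w t * cos (x * t)).
pose B (x : R) := \int[mu]_(t in pos) (w t * sin (x * t)).
pose A1 (x : R) := \int[mu]_(t in pos) (t * w t * cos (x * t)).
pose B1 (x : R) := \int[mu]_(t in pos) (t * w t * sin (x * t)).
have dA (y : R) : is_derive y 1 A (- B1 y) := is_derive_cos_transform wi twi y.
have dB (y : R) : is_derive y 1 B (A1 y) := is_derive_sin_transform wi twi y.
have iA1 (y : R) : mu.-integrable pos (EFin \o (fun t => t * w t * cos (y * t))).
  apply: (integrable_mul_bounded measurable_pos twi (@measurable_cos_scale R y _)) => t; exact: cos_le1_norm.
have iB1 (y : R) : mu.-integrable pos (EFin \o (fun t => t * w t * sin (y * t))).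
  apply: (integrable_mul_bounded measurable_pos twi (@measurable_sin_scale R y _)) => t; exact: sin_le1_norm.
have E1 (y : R) : s * A y - A1 y - y * B1 y = 0.
  rewrite -[RHS](ibp (is_derive_cos_scale y) _ (fun t => cos_le1_norm _)).
  - congr (_ + _); rewrite -mulNr -(RintegralZl _ measurable_pos (iB1 y)).
    by apply: eq_Rintegral => t _; ring.
  - move=> t; apply: (@continuous_for_comp _ (fun t => y * sin (y * t)) -%R t); last exact: opp_continuous.
    apply: continuous_for_mul; first exact: continuous_for_const.
    exact: is_derive_continuous (is_derive_sin_scale y t).
  - have := integrable_scale measurable_pos (- y) (iB1 y).
    by apply: eq_integrable; [exact: measurable_pos|move=> t _ /=; congr EFin; ring].
have E2 (y : R) : s * B y - B1 y + y * A1 y = 0.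
  rewrite -[RHS](ibp (is_derive_sin_scale y) _ (fun t => sin_le1_norm _)).
  - congr (_ + _); rewrite -(RintegralZl _ measurable_pos (iA1 y)).
    by apply: eq_Rintegral => t _; ring.
  - move=> t; apply: continuous_for_mul; first exact: continuous_for_const.
    exact: is_derive_continuous (is_derive_cos_scale y t).
  - have := integrable_scale measurable_pos y (iA1 y).
    by apply: eq_integrable; [exact: measurable_pos|move=> t _ /=; congr EFin; ring].
have q0 (y : R) : 0 < 1 + y ^+ 2 by rewrite ltr_wpDr// sqr_ge0.
pose P (y : R) := (1 + y ^+ 2) `^ (s / 2).
have dP (y : R) : is_derive y 1 P (s * y / (1 + y ^+ 2) * P y).
  have h1 := is_derive_add (is_derive_const 1 y) (is_derive_mul (is_derive_var y) (is_derive_var y)).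
  have -> : P = (fun y => (1 + y * y) `^ (s / 2)) by apply/funext => z; rewrite /P expr2.
  have qy : 0 < 1 + y * y by rewrite -expr2.
  apply: (is_derive_eq (is_derive_chain h1 (is_derive_powR (s / 2) qy))).
  rewrite powRB ?(gt_eqF qy) ?implybT// powRr1 ?ltW// expr2; field.
  by rewrite gt_eqF.
have dc (y : R) : is_derive y 1 (fun y => cos (s * atan y)) (- (s * sin (s * atan y)) / (1 + y ^+ 2)).
  by apply: (is_derive_eq (is_derive_chain (is_derive1_atan y) (is_derive_cos_scale s _))).
have ds (y : R) : is_derive y 1 (fun y => sin (s * atan y)) ((s * cos (s * atan y)) / (1 + y ^+ 2)).
  by apply: (is_derive_eq (is_derive_chain (is_derive1_atan y) (is_derive_sin_scale s _))).
have A1E (y : R) : A1 y = (s * A y - y * s * B y) / (1 + y ^+ 2).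
  by apply: (mulIf (lt0r_neq0 (q0 y))); rewrite divfK ?gt_eqF//; have := E1 y; have := E2 y; nra.
have B1E (y : R) : B1 y = (s * B y + y * s * A y) / (1 + y ^+ 2).
  by apply: (mulIf (lt0r_neq0 (q0 y))); rewrite divfK ?gt_eqF//; have := E1 y; have := E2 y; nra.
(* In polar form (1 - i y)^s = P y * exp (- i s atan y); [dU] and [dV] concern the real part and the
   opposite of the imaginary part of (1 - i y)^s (A + i B). *)
have dU (y : R) : is_derive y 1 (fun y => P y * (A y * cos (s * atan y) + B y * sin (s * atan y))) 0.
  apply: (is_derive_eq (is_derive_mul (dP y) (is_derive_add (is_derive_mul (dA y) (dc y)) (is_derive_mul (dB y) (ds y))))).
  rewrite A1E B1E; field; by rewrite gt_eqF.
have dV (y : R) : is_derive y 1 (fun y => P y * (A y * sin (s * atan y) + - (B y * cos (s * atan y)))) 0.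
  apply: (is_derive_eq (is_derive_mul (dP y) (is_derive_add (is_derive_mul (dA y) (ds y)) (is_derive_opp (is_derive_mul (dB y) (dc y)))))).
  rewrite A1E B1E; field; by rewrite gt_eqF.
have U0 := is_derive_0_is_cst x 0 dU.
have V0 := is_derive_0_is_cst x 0 dV.
have P0 : P 0 = 1 by rewrite /P expr0n addr0 powR1.
have A0 : A 0 = Gamma s.
  by rewrite /A; under eq_Rintegral do rewrite mul0r cos0 mulr1.
have B0 : B 0 = 0.
  rewrite /B; under eq_Rintegral do rewrite mul0r sin0 mulr0.
  by rewrite Rintegral_cst ?mul0r//; exact: measurable_pos.
move: U0 V0; rewrite P0 A0 B0 atan0 mulr0 sin0 cos0 !mulr0 !mul0r !mulr1 !addr0 oppr0 mul1r.
rewrite powRN -/(P x) -/(A x); have : 0 < P x by exact: powR_gt0.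
have := cos2Dsin2 (s * atan x).
set c := cos _; set sn := sin _; move: (P x) (A x) (B x) (Gamma s) => p a b g cs p0 U0 V0.
have {}V0 : a * sn = b * c.
  by move/eqP: V0; rewrite addr0 mulr0 mulf_eq0 gt_eqF// subr_eq0 => /eqP.
apply: (mulfI (lt0r_neq0 p0)).
have -> : p * (g / p * c) = g * c by field; rewrite gt_eqF.
(* Multiplying p a by c^2 + sn^2 = 1 and replacing a sn by b c turns it into c times the constant of
   [U0]. *)
rewrite -U0 -[LHS]mulr1 -cs.
have -> : p * a * (c ^+ 2 + sn ^+ 2) = p * (a * c ^+ 2 + (a * sn) * sn) by ring.
by rewrite V0; ring.
Qed.

End gamma_transform.

(** * Tails of cosine transforms through third differences *)

Section third_difference.
Context {R : realType}.
Notation mu := (@lebesgue_measure R).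
Notation pos := (`]0, +oo[%classic : set R).
Implicit Types f g : R -> R.

Definition third_diff (h : R) f (y : R) : R :=
  f (y + 3 * h) - 3 * f (y + 2 * h) + 3 * f (y + h) - f y.

Lemma is_derive_shift_var f df (h x : R) : is_derive (x + h) 1 f df ->
  is_derive x 1 (fun t => f (t + h)) df.
Proof.
move=> hf; have hs := is_derive_add (is_derive_var x) (is_derive_const h x).
by have := is_derive_chain hs hf; rewrite addr0 mulr1.
Qed.

Lemma mean_value_pos f df (y h : R) : 0 < y -> 0 < h ->
  (forall t : R, 0 < t -> is_derive t 1 f (df t)) ->
  exists2 z, y < z & f (y + h) - f y = h * df z.
Proof.
move=> y0 h0 hf; have yh : y < y + h by rewrite ltrDl.
have [||z] := @MVT R f df y (y + h) yh.
- by move=> t; rewrite in_itv/= => /andP[yt _]; apply: hf; exact: lt_trans yt.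
- apply: derivable_within_continuous => t; rewrite in_itv/= => /andP[yt _].
  by have [] := hf _ (lt_le_trans y0 yt).
by rewrite in_itv/= => /andP[yz _] ->; exists z => //; rewrite addrAC subrr add0r mulrC.
Qed.

(** A third difference is three nested first differences. The mean value theorem applied to each
    moves the point to the right only, so the value is h^3 times [f3] at some point beyond [y]. *)
Lemma third_diff_le f f1 f2 f3 (h y M : R) : 0 < y -> 0 < h ->
  (forall t : R, 0 < t -> is_derive t 1 f (f1 t)) ->
  (forall t : R, 0 < t -> is_derive t 1 f1 (f2 t)) ->
  (forall t : R, 0 < t -> is_derive t 1 f2 (f3 t)) ->
  (forall t : R, y < t -> `|f3 t| <= M) ->
  `|third_diff h f y| <= h ^+ 3 * M.
Proof.
move=> y0 h0 d1 d2 d3 fM.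
have h2 : 0 < 2 * h by rewrite mulr_gt0.
pose D g (t : R) := g (t + h) - g t.
have dD g g' : (forall t : R, 0 < t -> is_derive t 1 g (g' t)) ->
    forall t : R, 0 < t -> is_derive t 1 (D g) (D g' t).
  move=> dg t t0; apply: is_derive_add; last exact: is_derive_opp (dg _ t0).
  by apply: is_derive_shift_var; apply: dg; rewrite addr_gt0.
have [z1 yz1 E1] := mean_value_pos y0 h0 (dD _ _ (dD _ _ d1)).
have z10 := lt_trans y0 yz1.
have [z2 z12 E2] := mean_value_pos z10 h0 (dD _ _ d2).
have z20 := lt_trans z10 z12.
have [z3 z23 E3] := mean_value_pos z20 h0 d3.
have -> : third_diff h f y = h ^+ 3 * f3 z3.
  transitivity (D (D f) (y + h) - D (D f) y).
    rewrite /third_diff /D.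
    have -> : y + 3 * h = y + h + h + h by ring.
    have -> : y + 2 * h = y + h + h by ring.
    by ring.
  rewrite E1 -[D (D f1) z1]/(D f1 (z1 + h) - D f1 z1) E2.
  by rewrite -[D f2 z2]/(f2 (z2 + h) - f2 z2) E3; ring.
rewrite normrM normrX (gtr0_norm h0) ler_pM2l ?exprn_gt0// fM//.
exact: lt_trans (lt_trans yz1 z12) z23.
Qed.

Lemma cos_pi_multiple (x : R) : [/\ cos (x + pi) = - cos x,
  cos (x + 2 * pi) = cos x & cos (x + 3 * pi) = - cos x].
Proof.
have h1 y : cos (y + pi) = - cos y :> R by rewrite cosD cospi sinpi; ring.
split => //.
  by rewrite (_ : x + 2 * pi = x + pi + pi) ?h1 ?opprK//; ring.
by rewrite (_ : x + 3 * pi = x + pi + pi + pi) ?h1 ?opprK//; ring.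
Qed.

Lemma measurable_cos_setT : measurable_fun setT (fun y : R => cos y).
Proof. by apply: continuous_measurable_fun; exact: continuous_cos. Qed.

Lemma integrable_cos_mul f : mu.-integrable setT (EFin \o f) ->
  mu.-integrable setT (EFin \o (fun y => f y * cos y)).
Proof.
move=> fi; apply: (integrable_mul_bounded measurableT fi measurable_cos_setT) => t.
exact: cos_le1_norm.
Qed.

(** Shifting by k pi multiplies the cosine by (-1)^k, so the terms with coefficients 1, -3, 3, -1
    all contribute with the same sign: the total is -(1 + 3 + 3 + 1) times the transform. *)
Lemma cos_transform_third_diff f : mu.-integrable setT (EFin \o f) ->
  mu.-integrable setT (EFin \o (fun y => third_diff pi f y * cos y)) /\
  \int[mu]_y (f y * cos y) = - 8^-1 * \int[mu]_y (third_diff pi f y * cos y).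
Proof.
move=> fi; have fci := integrable_cos_mul fi.
pose g c y := f (1 * y + c) * cos y.
have gi c : mu.-integrable setT (EFin \o (g c)).
  by apply: integrable_cos_mul; apply: integrable_affine.
have shift c (e : R) : (forall y : R, cos (y + c) = e * cos y) ->
    \int[mu]_y (f y * cos y) = e * \int[mu]_y g c y.
  move=> ec; rewrite (Rintegral_affine c (oner_neq0 R) fci) normr1 mul1r.
  rewrite -(RintegralZl _ measurableT (gi c)); apply: eq_Rintegral => y _.
  by rewrite /g mul1r ec; ring.
have s1 : \int[mu]_y (f y * cos y) = -1 * \int[mu]_y g pi y.
  by apply: shift => y; have [-> _ _] := cos_pi_multiple y; rewrite mulN1r.
have s2 : \int[mu]_y (f y * cos y) = 1 * \int[mu]_y g (2 * pi) y.
  by apply: shift => y; have [_ -> _] := cos_pi_multiple y; rewrite mul1r.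
have s3 : \int[mu]_y (f y * cos y) = -1 * \int[mu]_y g (3 * pi) y.
  by apply: shift => y; have [_ _ ->] := cos_pi_multiple y; rewrite mulN1r.
pose u1 y := g (3 * pi) y + -3 * g (2 * pi) y.
pose u2 y := 3 * g pi y + -1 * (f y * cos y).
have j2 := integrable_scale measurableT (-3) (gi (2 * pi)).
have j1 := integrable_scale measurableT 3 (gi pi).
have j0 := integrable_scale measurableT (-1) fci.
have u1i : mu.-integrable setT (EFin \o u1) := integrable_add measurableT (gi _) j2.
have u2i : mu.-integrable setT (EFin \o u2) := integrable_add measurableT j1 j0.
have E : (fun y => third_diff pi f y * cos y) = (fun y => u1 y + u2 y).
  by apply/funext => y; rewrite /u1 /u2 /g /third_diff !mul1r; ring.
rewrite E; split; first exact: integrable_add.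
rewrite (RintegralD measurableT u1i u2i) (RintegralD measurableT (gi _) j2).
rewrite (RintegralD measurableT j1 j0) (RintegralZl _ measurableT (gi (2 * pi))).
rewrite (RintegralZl _ measurableT (gi pi)) (RintegralZl _ measurableT fci).
by move: s1 s2 s3; set a := Rintegral _ _ _; move=> s1 s2 s3; lra.
Qed.

(** * The contribution of a singularity |t|^alpha to the tail *)

Section abelian.
Variable alpha : R.
Hypothesis alpha02 : 0 < alpha < 2.

(** A regularised value of the divergent integral of |y|^alpha cos y: on an integrable function the
    same formula gives the true cosine transform. *)
Definition abel_const : R :=
  - 8^-1 * \int[mu]_y (third_diff pi (fun y => `|y| `^ alpha) y * cos y).

Let alpha0 : 0 < alpha. Proof. by case/andP : alpha02. Qed.

Lemma powR_neg_le (p x y : R) : 0 < x -> x <= y -> 0 <= p -> y `^ (- p) <= x `^ (- p).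
Proof.
move=> x0 xy p0; rewrite !powRN lef_pV2 ?posrE ?powR_gt0//; last exact: lt_le_trans xy.
by apply: ge0_ler_powR => //; rewrite nnegrE; [exact: ltW|apply/ltW/(lt_le_trans x0)].
Qed.

Lemma powR_mulN (p x : R) : 0 < x -> x `^ p * x `^ (- p) = 1.
Proof. by move=> x0; rewrite powRN mulfV// gt_eqF// powR_gt0. Qed.

(** 8 = 1 + 3 + 3 + 1 accounts for the coefficients, (6 pi + 1)^alpha bounds |y + k|^alpha for |y|
    <= 3 pi + 1 and 0 <= k <= 3 pi, and (3 pi + 2)^(3 - alpha) is the cost of replacing the distance
    from [y] to [-3 pi, 0] by 1 + |y|. *)
Let Cst (K : R) : R := 8 * K * (6 * pi + 1) `^ alpha * (3 * pi + 2) `^ (3 - alpha).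

Let pi0 := pi_gt0 R.

(** Three zones. For y >= 1 the bound on third differences applies directly; for y <= -(3 pi + 1)
    evenness reflects the four nodes into the right half line ([refl]); in between the nodes may
    straddle the singularity at 0, and the bound on f - c takes over. *)
Let third_diff_dominated (f : R -> R) (c K : R) : 0 <= K ->
  (forall y, f (- y) = f y) ->
  (forall y, 0 < y -> `|third_diff pi f y| <= K * y `^ (- (3 - alpha))) ->
  (forall y, `|f y - c| <= K * `|y| `^ alpha) ->
  forall y, `|third_diff pi f y| <= Cst K * (1 + `|y|) `^ (- (3 - alpha)).
Proof.
move=> K0 fN fd fc.
have a3 : 0 <= 3 - alpha by case/andP: alpha02 => _ ?; lra.
have B1 : 1 <= (6 * pi + 1) `^ alpha :> R.
  rewrite -[leLHS](powRr0 (6 * pi + 1)); apply: ler_powR; last exact: ltW.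
  by rewrite lerDr mulr_ge0// ltW.
have B0 : 0 <= (3 * pi + 2) `^ (3 - alpha) :> R by exact: powR_ge0.
have half (z y : R) : 0 < z -> 1 + `|y| <= (3 * pi + 2) * z ->
    K * z `^ (- (3 - alpha)) <= Cst K * (1 + `|y|) `^ (- (3 - alpha)).
  move=> z0 yz; rewrite /Cst.
  have h : ((3 * pi + 2) * z) `^ (- (3 - alpha)) <= (1 + `|y|) `^ (- (3 - alpha)).
    by apply: powR_neg_le => //; rewrite ltr_pwDl.
  have pp : 0 < 3 * pi + 2 :> R by rewrite addr_gt0// mulr_gt0.
  rewrite (powRM _ (ltW pp) (ltW z0)) in h.
  have -> : z `^ (- (3 - alpha)) = (3 * pi + 2) `^ (3 - alpha) * ((3 * pi + 2) `^ (- (3 - alpha)) * z `^ (- (3 - alpha))).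
    by rewrite mulrA powR_mulN// mul1r.
  rewrite mulrA; apply: ler_pM; [exact: mulr_ge0|by rewrite mulr_ge0 ?powR_ge0| |exact: h].
  by rewrite ler_wpM2r//; nra.
have refl y : third_diff pi f (- y - 3 * pi) = - third_diff pi f y.
  rewrite /third_diff.
  have -> : - y - 3 * pi + 3 * pi = - y by ring.
  have -> : - y - 3 * pi + 2 * pi = - (y + pi) by ring.
  have -> : - y - 3 * pi + pi = - (y + 2 * pi) by ring.
  have -> : - y - 3 * pi = - (y + 3 * pi) by ring.
  rewrite !fN; ring.
move=> y; have [y1|y1] := leP 1 y.
  apply: le_trans (fd _ (lt_le_trans ltr01 y1)) _; apply: half; first lra.
  rewrite ger0_norm; last lra. have : 0 <= (3 * pi) * y :> R by have p0 := pi0; apply: mulr_ge0; lra.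
  by lra.
have [y2|y2] := leP y (- (3 * pi + 1)).
  have z1 : 1 <= - y - 3 * pi by lra.
  rewrite -normrN -refl; apply: le_trans (fd _ (lt_le_trans ltr01 z1)) _.
  apply: half; first lra.
  rewrite ler0_norm; last by have := pi0; lra.
  have : 0 <= (3 * pi + 1) * (- y - 3 * pi - 1) :> R.
    by have p0 := pi0; apply: mulr_ge0; lra.
  by lra.
have yy : `|y| <= 3 * pi + 1 by rewrite ler_norml; apply/andP; split; have := pi0; lra.
have b k : 0 <= k <= 3 * pi -> `|f (y + k) - c| <= K * (6 * pi + 1) `^ alpha.
  move=> /andP[k0 k3]; apply: le_trans (fc _) _; rewrite ler_wpM2l//.
  apply: ge0_ler_powR; rewrite ?nnegrE//; first exact: ltW.
    by rewrite addr_ge0// mulr_ge0// ltW.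
  apply: le_trans (ler_normD _ _) _; rewrite (ger0_norm k0); lra.
have b3 := b (3 * pi); have b2 := b (2 * pi); have b1 := b pi; have b0 := b 0.
have : `|third_diff pi f y| <= 8 * (K * (6 * pi + 1) `^ alpha).
  (* A third difference annihilates constants, so [f] may be replaced by f - c. *)
  have -> : third_diff pi f y = (f (y + 3 * pi) - c) - 3 * (f (y + 2 * pi) - c) + 3 * (f (y + pi) - c) - (f (y + 0) - c).
    by rewrite /third_diff addr0; ring.
  move: b3 b2 b1 b0; rewrite !ler_norml.
  set A := f _; set B := f _; set C := f _; set E := f _; set M := K * _.
  have := pi0 => p0.
  move=> /(_ _)/andP[|b31 b32]; first by apply/andP; split; lra.
  move=> /(_ _)/andP[|b21 b22]; first by apply/andP; split; lra.
  move=> /(_ _)/andP[|b11 b12]; first by apply/andP; split; lra.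
  move=> /(_ _)/andP[|b01 b02]; first by apply/andP; split; lra.
  by apply/andP; split; lra.
move=> /le_trans; apply.
have M0 : 0 <= 8 * (K * (6 * pi + 1) `^ alpha) by rewrite !mulr_ge0 ?powR_ge0.
have -> : Cst K * (1 + `|y|) `^ (- (3 - alpha)) = 8 * (K * (6 * pi + 1) `^ alpha) *
  ((3 * pi + 2) `^ (3 - alpha) * (1 + `|y|) `^ (- (3 - alpha))) by rewrite /Cst; ring.
have y0 : 0 < 1 + `|y| by rewrite ltr_pwDl.
rewrite ler_peMr// powRN ler_pdivlMr ?powR_gt0// mul1r.
have p0 := pi0; apply: ge0_ler_powR => //; rewrite ?nnegrE; lra.
Qed.

(** The third differences of [phi k] do not see the constants [c k], converge to those of b
    |y|^alpha and are dominated uniformly in [k], with integrable bound since 3 - alpha > 1. The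
    limit function itself has no convergent cosine integral. *)
Lemma cos_transform_abel (phi : nat -> R -> R) (c : nat -> R) (K b : R) : 0 <= K ->
  (forall k, mu.-integrable setT (EFin \o (phi k))) ->
  (forall k y, phi k (- y) = phi k y) ->
  (forall k y, 0 < y -> `|third_diff pi (phi k) y| <= K * y `^ (- (3 - alpha))) ->
  (forall k y, `|phi k y - c k| <= K * `|y| `^ alpha) ->
  (forall y, phi k y - c k @[k --> \oo] --> b * `|y| `^ alpha) ->
  \int[mu]_y (phi k y * cos y) @[k --> \oo] --> b * abel_const.
Proof.
move=> K0 phii phiN phid phic phicv.
have q1 : 1 < 3 - alpha by case/andP: alpha02 => _ ?; lra.
have [wi _] := integrable_even_extension (integrable_polynomial_weight q1).
have Cwi := integrable_scale measurableT (Cst K) wi.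
pose T := third_diff pi (fun y : R => `|y| `^ alpha).
have [] := @Rintegral_dominated_cvg _ _ _ mu setT
  (fun k y => third_diff pi (phi k) y * cos y)
  (fun y => b * (T y * cos y)) _ measurableT _ _ Cwi.
- move=> k; have [h _] := cos_transform_third_diff (phii k).
  exact: integrable_measurable h.
- move=> y _.
  have -> : b * (T y * cos y) = third_diff pi (fun y => b * `|y| `^ alpha) y * cos y.
    by rewrite /T /third_diff; ring.
  apply: cvgM; last exact: cvg_cst.
  have -> : (fun k => third_diff pi (phi k) y) = (fun k => third_diff pi (fun y => phi k y - c k) y).
    by apply/funext => k; rewrite /third_diff; ring.
  rewrite /third_diff; apply: cvgB => //; apply: cvgD; last by apply: cvgM => //; exact: cvg_cst.
  by apply: cvgB => //; apply: cvgM => //; exact: cvg_cst.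
- move=> k y _; rewrite normrM.
  have := third_diff_dominated K0 (phiN k) (phid k) (phic k) y.
  by apply: le_trans; rewrite ler_piMr//; exact: cos_le1_norm.
move=> bTi bTcv.
have -> : b * abel_const = - 8^-1 * \int[mu]_y (b * (T y * cos y)).
  (* Dominated convergence gives the integrability of b T cos only; that of T cos follows on
     dividing by [b], and for b = 0 both sides vanish. *)
  rewrite /abel_const -/T; have [->|b0] := eqVneq b 0.
    under [in RHS]eq_Rintegral do rewrite mul0r.
    by rewrite Rintegral_cst// !mul0r mulr0.
  rewrite RintegralZl//; first ring.
  have := integrable_scale measurableT b^-1 bTi.
  by apply: eq_integrable => // y _ /=; rewrite mulKf.
under eq_fun => k do rewrite (cos_transform_third_diff (phii k)).2.
by apply: cvgM => //; exact: cvg_cst.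
Qed.

(** Rescaling by y = a t. The bound t^(alpha - 3) on the third derivative is homogeneous, so with
    step pi / a the powers of [a] cancel and the third differences in [y] are at most pi^3 K
    y^(alpha - 3), uniformly in [k]. *)
Lemma cos_transform_abel_scaled (g g1 g2 g3 : nat -> R -> R) (gamma a : nat -> R) (K b : R) :
  0 <= K -> (forall k, 0 < a k) ->
  (forall k, mu.-integrable setT (EFin \o (g k))) ->
  (forall k y, g k (- y) = g k y) ->
  (forall k (t : R), 0 < t -> is_derive t 1 (g k) (g1 k t)) ->
  (forall k (t : R), 0 < t -> is_derive t 1 (g1 k) (g2 k t)) ->
  (forall k (t : R), 0 < t -> is_derive t 1 (g2 k) (g3 k t)) ->
  (forall k t, 0 < t -> `|g3 k t| <= K * t `^ (- (3 - alpha))) ->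
  (forall k t, `|g k t - gamma k| <= K * `|t| `^ alpha) ->
  (forall y, a k `^ alpha * (g k (y / a k) - gamma k) @[k --> \oo] --> b * `|y| `^ alpha) ->
  a k `^ (alpha + 1) * \int[mu]_t (g k t * cos (a k * t)) @[k --> \oo] --> b * abel_const.
Proof.
move=> K0 a0 gi gN d1 d2 d3 g3le gle gcv.
pose phi k y := a k `^ alpha * g k (y / a k).
have p3 : 1 <= pi ^+ 3 :> R by rewrite exprn_ege1// (le_trans _ (pi_ge2 R))// ler1n.
have -> : (fun k => a k `^ (alpha + 1) * \int[mu]_t (g k t * cos (a k * t))) =
    (fun k => \int[mu]_y (phi k y * cos y)).
  apply/funext => k; have ak0 : a k != 0 by rewrite gt_eqF.
  have gci : mu.-integrable setT (EFin \o (fun t => g k t * cos (a k * t))).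
    apply: (integrable_mul_bounded measurableT (gi k) (@measurable_cos_scale R (a k) _)) => t.
    exact: cos_le1_norm.
  have ik0 : (a k)^-1 != 0 by rewrite invr_eq0.
  rewrite (Rintegral_affine 0 ik0 gci) gtr0_norm ?invr_gt0// mulrA.
  rewrite powRD ?ak0 ?implybT// powRr1 ?ltW// mulfK//.
  have := integrable_affine 0 ik0 gci => gci'.
  rewrite -(RintegralZl _ measurableT gci'); apply: eq_Rintegral => y _.
  by rewrite /phi addr0 mulVKf// mulrA (mulrC y).
apply: (@cos_transform_abel phi (fun k => a k `^ alpha * gamma k) (pi ^+ 3 * K)) => //.
- by rewrite mulr_ge0// exprn_ge0// ltW.
- move=> k; apply: integrable_scale => //.
  have ik0 : (a k)^-1 != 0 by rewrite invr_eq0 gt_eqF.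
  have := integrable_affine 0 ik0 (gi k).
  by apply: eq_integrable => // y _ /=; rewrite addr0 mulrC.
- by move=> k y; rewrite /phi mulNr gN.
- move=> k y y0; have ak := a0 k.
  have h0 : 0 < pi / a k by rewrite divr_gt0.
  have ya0 : 0 < y / a k by rewrite divr_gt0.
  have M (t : R) : y / a k < t -> `|g3 k t| <= K * (y / a k) `^ (- (3 - alpha)).
    move=> yt; apply: le_trans (g3le _ _ (lt_trans ya0 yt)) _.
    rewrite ler_wpM2l//; apply: powR_neg_le => //; first exact: ltW.
    by case/andP: alpha02 => _ ?; lra.
  have := third_diff_le ya0 h0 (d1 k) (d2 k) (d3 k) M.
  have -> : third_diff pi (phi k) y = a k `^ alpha * third_diff (pi / a k) (g k) (y / a k).
    have e (m : R) : (y + m * pi) / a k = y / a k + m * (pi / a k) by ring.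
    by rewrite /third_diff /phi !e (_ : (y + pi) / a k = y / a k + pi / a k); ring.
  move=> h; rewrite normrM (ger0_norm (powR_ge0 _ _)).
  apply: le_trans (ler_wpM2l (powR_ge0 _ _) h) _.
  rewrite le_eqVlt; apply/orP; left; apply/eqP.
  have ik : 0 < (a k)^-1 by rewrite invr_gt0.
  rewrite (powRM _ (ltW y0) (ltW ik)).
  have -> : (a k)^-1 `^ (- (3 - alpha)) = a k ^+ 3 / a k `^ alpha.
    rewrite -(powR_inv1 (ltW ak)) -powRrM mulN1r opprK powRB ?(gt_eqF ak) ?implybT//.
    by rewrite (powR_mulrn 3 (ltW ak)).
  move: (powR_gt0 alpha ak); set Y := y `^ _; set A := a k `^ alpha => A0.
  by field; rewrite !gt_eqF.
- move=> k y; rewrite /phi -mulrBr normrM ger0_norm ?powR_ge0//.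
  apply: le_trans (ler_wpM2l (powR_ge0 _ _) (gle k _)) _.
  have ak := a0 k; have ik : 0 < (a k)^-1 by rewrite invr_gt0.
  rewrite normrM normfV (gtr0_norm ak) (powRM _ (normr_ge0 y) (ltW ik)).
  have -> : (a k)^-1 `^ alpha = (a k `^ alpha)^-1.
    by rewrite -powRN -(powR_inv1 (ltW ak)) -powRrM mulN1r.
  rewrite mulrCA [X in K * X]mulrCA mulfV ?gt_eqF ?powR_gt0// mulr1.
  by rewrite -mulrA ler_peMl// mulr_ge0// powR_ge0.
- by move=> y; have := gcv y; rewrite /phi; under eq_fun do rewrite mulrBr.
Qed.

End abelian.
End third_difference.

(** * Evaluation of the constant *)

Section abel_constant.
Context {R : realType}.
Notation mu := (@lebesgue_measure R).
Notation pos := (`]0, +oo[%classic : set R).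

Lemma is_derive_even (f : R -> R) (t d : R) : 0 < t -> is_derive t 1 f d ->
  is_derive t 1 (fun t => f `|t|) d.
Proof.
move=> t0; apply: near_eq_is_derive; near=> z; rewrite gtr0_norm//.
near: z; exact: lt_nbhsr.
Unshelve. all: by end_near. Qed.

Variable alpha : R.
Hypothesis alpha02 : 0 < alpha < 2.

Let alpha0 : 0 < alpha. Proof. by case/andP : alpha02. Qed.

Let T (p t : R) := t `^ p * expR (- t).

Let is_derive_T (p t : R) : 0 < t ->
  is_derive t 1 (T p) (p * T (p - 1) t + -1 * T p t).
Proof.
move=> t0; apply: (is_derive_eq (is_derive_mul (is_derive_powR p t0) (is_derive_expRN t))).
rewrite /T; ring.
Qed.

(** t^(alpha - j) = t^(alpha - 3) t^(3 - j), and the second power, of nonnegative exponent, is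
    absorbed by exp (- t). *)
Let T_le (j : nat) : (j <= 3)%N -> exists2 K : R, 0 <= K & forall t : R, 0 < t ->
  `|T (alpha - j%:R) t| <= K * t `^ (- (3 - alpha)).
Proof.
move=> j3; have p0 : 0 <= 3 - j%:R :> R by rewrite subr_ge0 ler_nat.
have [K K0 HK] := powR_le_expR p0 ltr01; exists K; first exact: ltW.
move=> t t0; rewrite ger0_norm ?mulr_ge0 ?powR_ge0 ?expR_ge0// /T.
have -> : alpha - j%:R = - (3 - alpha) + (3 - j%:R) by ring.
rewrite powRD ?(gt_eqF t0) ?implybT// mulrC mulrCA mulrC ler_wpM2r ?powR_ge0//.
rewrite expRN mulrC ler_pdivrMr ?expR_gt0//.
by have := HK t (ltW t0); rewrite mul1r.
Qed.

(** The function |t|^alpha exp (- |t|) has an explicit transform, and its leading term at 0 is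
    |t|^alpha with coefficient 1. The abelian statement and the explicit formula give two limits of
    one sequence, [abel_const] and 2 Gamma s cos (s pi / 2) with s = alpha + 1. *)
Lemma abel_constE : abel_const alpha = - 2 * Gamma (alpha + 1) * sin (pi * alpha / 2).
Proof.
pose s := alpha + 1; have s0 : 0 < s by rewrite addr_gt0.
pose T1 (p t : R) := p * T (p - 1) t + -1 * T p t.
pose f1 t := T1 alpha t.
pose f2 t := alpha * T1 (alpha - 1) t + -1 * T1 alpha t.
pose f3 t := alpha * ((alpha - 1) * T1 (alpha - 1 - 1) t + -1 * T1 (alpha - 1) t) +
  -1 * (alpha * T1 (alpha - 1) t + -1 * T1 alpha t).
have dT1 p (t : R) : 0 < t -> is_derive t 1 (T1 p) (p * T1 (p - 1) t + -1 * T1 p t).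
  move=> t0; apply: is_derive_add; apply: is_derive_scale; exact: is_derive_T.
pose g (t : R) := `|t| `^ alpha * expR (- `|t|).
have [K K0 HK] : exists2 K : R, 0 <= K & forall t : R, 0 < t -> `|f3 t| <= K * t `^ (- (3 - alpha)).
  have [K0 K00 H0] := T_le (isT : (0 <= 3)%N).
  have [K1 K10 H1] := T_le (isT : (1 <= 3)%N).
  have [K2 K20 H2] := T_le (isT : (2 <= 3)%N).
  have [K3 K30 H3] := T_le (isT : (3 <= 3)%N).
  exists (`|alpha * (alpha - 1) * (alpha - 2)| * K3 + `|3 * alpha * (alpha - 1)| * K2 + `|3 * alpha| * K1 + K0).
    by rewrite !addr_ge0// mulr_ge0.
  move=> t t0; have := H0 t t0; have := H1 t t0; have := H2 t t0; have := H3 t t0.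
  rewrite subr0; set u := t `^ _.
  have -> : f3 t = alpha * (alpha - 1) * (alpha - 2) * T (alpha - 3) t
     - 3 * alpha * (alpha - 1) * T (alpha - 2) t + 3 * alpha * T (alpha - 1) t - T alpha t.
    rewrite /f3 /T1 (_ : alpha - 1 - 1 = alpha - 2); last by ring.
    by rewrite (_ : alpha - 2 - 1 = alpha - 3); ring.
  move=> h3 h2 h1 h0.
  have -> : (`|alpha * (alpha - 1) * (alpha - 2)| * K3 + `|3 * alpha * (alpha - 1)| * K2 + `|3 * alpha| * K1 + K0) * u =
    `|alpha * (alpha - 1) * (alpha - 2)| * (K3 * u) + `|3 * alpha * (alpha - 1)| * (K2 * u) + `|3 * alpha| * (K1 * u) + K0 * u by ring.
  apply: le_trans (ler_normB _ _) _; apply: lerD => //.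
  apply: le_trans (ler_normD _ _) _; apply: lerD.
    apply: le_trans (ler_normB _ _) _; apply: lerD.
      by rewrite normrM ler_wpM2l.
    by rewrite normrM ler_wpM2l.
  by rewrite normrM ler_wpM2l.
have wi : mu.-integrable pos (EFin \o (fun t => t `^ (s - 1) * expR (- t))).
  exact: integrable_gamma_weight.
have sE : s - 1 = alpha by rewrite /s addrK.
have gi : mu.-integrable setT (EFin \o g).
  by have [] := integrable_even_extension wi; rewrite sE.
pose a k : R := k.+1%:R.
have a0 k : 0 < a k by rewrite ltr0n.
have gE x : \int[mu]_t (g t * cos (x * t)) =
    2 * (Gamma s * (1 + x ^+ 2) `^ (- (s / 2)) * cos (s * atan x)).
  rewrite -gamma_cos_transform// sE.
  have wci : mu.-integrable pos (EFin \o (fun t => t `^ alpha * expR (- t) * cos (x * t))).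
    rewrite sE in wi.
    apply: (integrable_mul_bounded measurable_pos wi (@measurable_cos_scale R x _)) => t.
    exact: cos_le1_norm.
  have [_ <-] := integrable_even_extension wci; apply: eq_Rintegral => t _.
  rewrite /g; congr (_ * _); have [t0|t0] := ler0P t; last by [].
  by rewrite mulrN cosN.
have gN t : g (- t) = g t by rewrite /g normrN.
have aK (y : R) k : a k `^ alpha * `|y / a k| `^ alpha = `|y| `^ alpha.
  rewrite -powRM ?(ltW (a0 k))// normrM normfV (gtr0_norm (a0 k)).
  by rewrite mulrCA mulfV ?mulr1// gt_eqF.
have E0 (x : R) : 0 <= x -> expR (- x) <= 1 by move=> x0; rewrite -expR0 ler_expR oppr_le0.
have lim1 := @cos_transform_abel_scaled R alpha alpha02 (fun=> g) (fun=> f1) (fun=> f2) (fun=> f3)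
  (fun=> 0) a (K + 1) 1.
have {}lim1 : a k `^ (alpha + 1) * \int[mu]_t (g t * cos (a k * t)) @[k --> \oo] --> abel_const alpha.
  rewrite -[abel_const _]mul1r; apply: lim1 => //.
  - by rewrite addr_ge0.
  - by move=> _ t t0; exact: (is_derive_even t0 (is_derive_T alpha t0)).
  - by move=> _ t t0; exact: (is_derive_add (is_derive_scale alpha (dT1 (alpha - 1) _ t0)) (is_derive_scale (-1) (dT1 alpha _ t0))).
  - move=> _ t t0; apply: le_trans (HK _ t0) _; rewrite ler_wpM2r ?powR_ge0//; lra.
  - move=> _ t; rewrite subr0 /g ger0_norm ?mulr_ge0 ?powR_ge0 ?expR_ge0//.
    rewrite mulrC ler_wpM2r ?powR_ge0// (le_trans (E0 _ (normr_ge0 _)))//; lra.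
  - move=> y; rewrite mul1r.
    have -> : (fun k => a k `^ alpha * (g (y / a k) - 0)) = (fun k => `|y| `^ alpha * expR (- (`|y| / a k))).
      by apply/funext => k; rewrite subr0 /g mulrA aK normrM normfV (gtr0_norm (a0 k)).
    rewrite -[X in _ --> X]mulr1 -expR0; apply: cvgM; first exact: cvg_cst.
    apply: continuous_cvg; first exact: continuous_expR.
    rewrite -oppr0; apply: cvgN; rewrite -(mulr0 `|y|); apply: cvgM; first exact: cvg_cst.
    exact: cvg_harmonic.
have lim2 : a k `^ (alpha + 1) * \int[mu]_t (g t * cos (a k * t)) @[k --> \oo] -->
    2 * (Gamma s * 1 `^ (- (s / 2)) * cos (s * (pi / 2))).
  have ay : a k @[k --> \oo] --> +oo.
    by have := @cvgr_idn R; rewrite -cvg_shiftS.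
  (* a^(alpha + 1) = (a^(-2))^(-s/2) merges with (1 + a^2)^(-s/2) into (1 + a^(-2))^(-s/2), which
     tends to 1. *)
  have -> : (fun k => a k `^ (alpha + 1) * \int[mu]_t (g t * cos (a k * t))) =
      (fun k => 2 * (Gamma s * (1 + (a k)^-1 * (a k)^-1) `^ (- (s / 2)) * cos (s * atan (a k)))).
    apply/funext => k; have ak := a0 k; have ik : 0 < (a k)^-1 by rewrite invr_gt0.
    have e : a k `^ (alpha + 1) = ((a k)^-1 * (a k)^-1) `^ (- (s / 2)).
      rewrite (powRM _ (ltW ik) (ltW ik)) -powRD ?(gt_eqF ik) ?implybT//.
      rewrite -(powR_inv1 (ltW ak)) -powRrM; congr (_ `^ _); rewrite /s; by field.
    have iik := mulr_ge0 (ltW ik) (ltW ik).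
    have aa : 0 <= 1 + a k ^+ 2 by rewrite addr_ge0// sqr_ge0.
    have -> : (1 + (a k)^-1 * (a k)^-1) = ((a k)^-1 * (a k)^-1) * (1 + a k ^+ 2).
      by rewrite expr2; field; rewrite gt_eqF.
    by rewrite gE (powRM _ iik aa) e; ring.
  apply: cvgM; first exact: cvg_cst.
  apply: cvgM.
    apply: cvgM; first exact: cvg_cst.
    have c1 := @continuous_powR R (- (s / 2)) 1 ltr01.
    apply: (continuous_cvg _ c1).
    rewrite -[X in _ --> X]addr0 -(mulr0 0); apply: cvgD; first exact: cvg_cst.
    by apply: cvgM; exact: cvg_harmonic.
  apply: continuous_cvg; first exact: continuous_cos.
  apply: cvgM; first exact: cvg_cst.
  by move/cvg_pinftyP : (@cvgy_atan R) => /(_ _ ay).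
rewrite (norm_cvg_unique lim1 lim2) powR1 mulr1 -/s.
have -> : s * (pi / 2) = pi * alpha / 2 + pi / 2 by rewrite /s; field.
by rewrite cosD cos_pihalf sin_pihalf; ring.
Qed.

End abel_constant.

(** * The case alpha < 2 *)

Section smoothed_covariance.
Context {R : realType}.
Notation mu := (@lebesgue_measure R).
Notation pos := (`]0, +oo[%classic : set R).

Definition cauchy_cov (alpha beta t : R) : R := (1 + `|t| `^ alpha) `^ (- beta).

Lemma is_derive_gaussian (eps t : R) :
  is_derive t 1 (fun t => expR (- (eps * (t * t)))) (- 2 * (eps * t) * expR (- (eps * (t * t)))).
Proof.
have h := is_derive_opp (is_derive_scale eps (is_derive_mul (is_derive_var t) (is_derive_var t))).
apply: (is_derive_eq (is_derive_chain h (is_derive_expR _))); ring.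
Qed.

Lemma integrable_gaussian (eps : R) : 0 < eps ->
  mu.-integrable setT (EFin \o (fun t => expR (- (eps * (t * t))))).
Proof.
move=> e0; have s0 : Num.sqrt eps != 0 by rewrite gt_eqF// sqrtr_gt0.
have := integrable_affine 0 s0 (@integrableT_gauss R).
apply: eq_integrable => // t _ /=; congr (expR (- _))%:E.
by rewrite addr0 exprMn sqr_sqrtr ?ltW// expr2.
Qed.

Section estimates.
Variables alpha beta : R.
Hypothesis alpha02 : 0 < alpha < 2.
Hypothesis beta0 : 0 < beta.

Let alpha0 : 0 < alpha. Proof. by case/andP : alpha02. Qed.

(* With [y = beta + m], the monomials
   [eps^n t^(alpha m + 2 n - j) (1 + t^alpha)^(-y) exp(-eps t^2)]
   occurring in the j-th derivative of the smoothed covariance. *)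
Let M (eps : R) (j m n : nat) (t : R) :=
  eps ^+ n * (t `^ (alpha * m%:R + 2 * n%:R - j%:R) *
    ((1 + t `^ alpha) `^ (- (beta + m%:R)) * expR (- (eps * (t * t))))).

(** The product rule stays inside the family: differentiating the power of [t] keeps (m, n),
    differentiating the power of 1 + t^alpha raises [m], differentiating the Gaussian raises [n],
    and each raises [j]. *)
Let D (eps : R) (j m n : nat) (t : R) :=
  (alpha * m%:R + 2 * n%:R - j%:R) * M eps j.+1 m n t +
  (- (alpha * (beta + m%:R)) * M eps j.+1 m.+1 n t + -2 * M eps j.+1 m n.+1 t).

Let is_derive_M (eps : R) j m n (t : R) : 0 < t ->
  is_derive t 1 (M eps j m n) (D eps j m n t).
Proof.
move=> t0; set x := alpha * m%:R + 2 * n%:R - j%:R.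
have q0 : 0 < 1 + t `^ alpha by rewrite addr_gt0// powR_gt0.
have dq := is_derive_chain (is_derive_add (is_derive_const 1 t) (is_derive_powR alpha t0))
  (is_derive_powR (- (beta + m%:R)) q0).
apply: (is_derive_eq (is_derive_scale (eps ^+ n) (is_derive_mul (is_derive_powR x t0)
  (is_derive_mul dq (is_derive_gaussian eps t))))).
have e1 : alpha * m%:R + 2 * n%:R - j.+1%:R = x - 1 by rewrite /x -natr1; ring.
have e2 : alpha * m.+1%:R + 2 * n%:R - j.+1%:R = x + (alpha - 1) by rewrite /x -!natr1; ring.
have e3 : alpha * m%:R + 2 * n.+1%:R - j.+1%:R = x + 1 by rewrite /x -!natr1; ring.
have e4 : - (beta + m.+1%:R) = - (beta + m%:R) - 1 by rewrite -natr1; ring.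
rewrite /D /M e1 e2 e3 e4 -/x (exprS _ n).
rewrite (@powRD _ t x (alpha - 1)) ?(gt_eqF t0) ?implybT//.
rewrite (@powRD _ t x 1) ?(gt_eqF t0) ?implybT// (powRr1 (ltW t0)); ring.
Qed.

(** With r = t^alpha / (1 + t^alpha) and e = eps t^2, the monomial is r^m (1 + t^alpha)^(-beta) e^n
    exp (- e) t^(-j). A factor t^alpha has to be extracted: from r <= t^alpha if m > 0, otherwise
    from e^n exp (- e) <= K' e^(alpha/2) <= K' t^alpha, which uses n >= 1 > alpha / 2 and eps <= 1.
    For m = n = 0 there is no such factor. *)
Let M_le (j m n : nat) : (0 < m + n)%N -> exists2 K : R, 0 <= K &
  forall eps t : R, 0 < eps <= 1 -> 0 < t -> `|M eps j m n t| <= K * t `^ (- (j%:R - alpha)).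
Proof.
move=> mn.
have [K K0 HK] := powR_le_expR (ler0n R n) ltr01.
have a2 : 0 <= alpha / 2 by rewrite divr_ge0// ltW.
have tE (t : R) : 0 < t -> t `^ (alpha * m%:R + 2 * n%:R - j%:R) =
    (t `^ alpha) ^+ m * (t * t) ^+ n * t `^ (- j%:R).
  move=> t0; rewrite powRD ?(gt_eqF t0) ?implybT// powRD ?(gt_eqF t0) ?implybT//.
  rewrite powRrM (powR_mulrn _ (powR_ge0 _ _)) -natrM (powR_mulrn _ (ltW t0)).
  by rewrite exprM expr2.
have jE (t : R) : 0 < t -> t `^ (- (j%:R - alpha)) = t `^ alpha * t `^ (- j%:R).
  by move=> t0; rewrite -powRD ?(gt_eqF t0) ?implybT//; congr (_ `^ _); ring.
have qE (t : R) : 0 < t -> (t `^ alpha) ^+ m * (1 + t `^ alpha) `^ (- (beta + m%:R)) =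
    (t `^ alpha / (1 + t `^ alpha)) ^+ m * (1 + t `^ alpha) `^ (- beta).
  move=> t0; have q0 : 0 < 1 + t `^ alpha by rewrite addr_gt0// powR_gt0.
  rewrite opprD powRD ?(gt_eqF q0) ?implybT// (powRN _ m%:R) (powR_mulrn _ (ltW q0)).
  by rewrite exprMn exprVn; ring.
have q1 (t : R) : 0 < t -> (1 + t `^ alpha) `^ (- beta) <= 1.
  move=> t0; rewrite -[leRHS](powRr0 (1 + t `^ alpha)); apply: ler_powR.
    by rewrite lerDl powR_ge0.
  by rewrite oppr_le0 ltW.
have MA (eps t : R) : 0 < t -> M eps j m n t = (t `^ alpha / (1 + t `^ alpha)) ^+ m *
   (1 + t `^ alpha) `^ (- beta) * ((eps * (t * t)) ^+ n * expR (- (eps * (t * t)))) * t `^ (- j%:R).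
  by move=> t0; rewrite /M tE// -qE// (exprMn _ eps); ring.
have expn_le (e : R) : 0 <= e -> e ^+ n * expR (- e) <= K.
  move=> e0; rewrite expRN ler_pdivrMr ?expR_gt0// -(powR_mulrn _ e0).
  by have := HK e e0; rewrite mul1r.
case: m mn tE qE MA => [|m] mn tE qE MA.
  have n0 : 1 <= n%:R :> R by rewrite ler1n.
  have p0 : 0 <= n%:R - alpha / 2 by case/andP: alpha02 => _ ?; lra.
  have [K' K'0 HK'] := powR_le_expR p0 ltr01.
  exists K'; first exact: ltW.
  move=> eps t /andP[e0 e1] t0; rewrite MA// jE// expr0 mul1r.
  set e := eps * (t * t); have ee0 : 0 < e by rewrite !mulr_gt0.
  rewrite normrM (ger0_norm (powR_ge0 _ (- j%:R))) [leRHS]mulrA ler_wpM2r ?powR_ge0//.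
  rewrite normrM ger0_norm ?powR_ge0// ger0_norm ?mulr_ge0 ?exprn_ge0 ?expR_ge0 ?(ltW ee0)//.
  have h1 : e ^+ n * expR (- e) <= K' * t `^ alpha.
    have -> : e ^+ n = e `^ (n%:R - alpha / 2) * e `^ (alpha / 2).
      by rewrite -powRD ?(gt_eqF ee0) ?implybT// subrK powR_mulrn// ltW.
    rewrite mulrAC; apply: ler_pM; rewrite ?mulr_ge0 ?powR_ge0 ?expR_ge0//.
      by rewrite expRN ler_pdivrMr ?expR_gt0//; have := HK' e (ltW ee0); rewrite mul1r.
    have -> : t `^ alpha = (t * t) `^ (alpha / 2).
      rewrite (powRM _ (ltW t0) (ltW t0)) -powRD ?(gt_eqF t0) ?implybT//; congr (_ `^ _); by field.
    apply: ge0_ler_powR => //; rewrite ?nnegrE ?(ltW ee0) ?mulr_ge0 ?(ltW t0)//.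
    by rewrite /e ler_piMl// mulr_ge0// ltW.
  apply: le_trans _ h1; rewrite ler_piMl ?q1// mulr_ge0 ?exprn_ge0 ?expR_ge0//; exact: ltW.
exists K; first exact: ltW.
move=> eps t /andP[e0 e1] t0; rewrite MA// jE//.
set e := eps * (t * t); have ee0 : 0 < e by rewrite !mulr_gt0.
rewrite normrM (ger0_norm (powR_ge0 _ (- j%:R))) [leRHS]mulrA ler_wpM2r ?powR_ge0//.
have q0 : 0 < 1 + t `^ alpha by rewrite addr_gt0// powR_gt0.
set r := t `^ alpha / (1 + t `^ alpha).
have r0 : 0 <= r by rewrite divr_ge0 ?powR_ge0// ltW.
have r1 : r <= 1 by rewrite ler_pdivrMr// mul1r lerDr.
have rt : r <= t `^ alpha.
  by rewrite ler_pdivrMr// ler_peMr ?powR_ge0// lerDl powR_ge0.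
have E0 : 0 <= e ^+ n * expR (- e) by rewrite mulr_ge0 ?exprn_ge0 ?expR_ge0//; exact: ltW.
rewrite ger0_norm ?(mulr_ge0 (mulr_ge0 (exprn_ge0 _ r0) (powR_ge0 _ _)) E0)//.
rewrite mulrC; apply: ler_pM => //; first by rewrite mulr_ge0 ?exprn_ge0 ?powR_ge0.
  by apply: expn_le; exact: ltW.
apply: le_trans _ rt; rewrite exprS -mulrA ler_piMr// mulr_ile1 ?exprn_ge0 ?powR_ge0 ?q1//.
by rewrite exprn_ile1.
Qed.

Let bounded3 (f : R -> R -> R) := exists2 K : R, 0 <= K &
  forall eps t : R, 0 < eps <= 1 -> 0 < t -> `|f eps t| <= K * t `^ (- (3 - alpha)).

Let bounded3D f g : bounded3 f -> bounded3 g -> bounded3 (fun eps t => f eps t + g eps t).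
Proof.
move=> [K K0 HK] [L L0 HL]; exists (K + L); first exact: addr_ge0.
move=> eps t e0 t0; rewrite mulrDl; apply: le_trans (ler_normD _ _) _.
by apply: lerD; [exact: HK|exact: HL].
Qed.

Let bounded3Z c f : bounded3 f -> bounded3 (fun eps t => c * f eps t).
Proof.
move=> [K K0 HK]; exists (`|c| * K); first exact: mulr_ge0.
by move=> eps t e0 t0; rewrite normrM -mulrA ler_wpM2l// HK.
Qed.

Let g (eps t : R) := expR (- (eps * (t * t))) * cauchy_cov alpha beta t.

(** The function itself is the monomial with j = m = n = 0, for which the first coefficient in [D]
    is 0. From the first derivative on, only monomials with m + n > 0 occur, and [M_le] at j = 3
    applies to all of them. *)
Lemma smoothed_cov_derivatives : exists g1 g2 g3 : R -> R -> R,
  [/\ forall eps t : R, 0 < t -> is_derive t 1 (g eps) (g1 eps t),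
      forall eps t : R, 0 < t -> is_derive t 1 (g1 eps) (g2 eps t),
      forall eps t : R, 0 < t -> is_derive t 1 (g2 eps) (g3 eps t) &
      exists2 K : R, 0 <= K & forall eps t : R, 0 < eps <= 1 -> 0 < t ->
        `|g3 eps t| <= K * t `^ (- (3 - alpha))].
Proof.
pose ab := - (alpha * (beta + 0%:R)).
pose g1 eps t := ab * M eps 1 1 0 t + -2 * M eps 1 0 1 t.
pose g2 eps t := ab * D eps 1 1 0 t + -2 * D eps 1 0 1 t.
pose D2 eps m n t := (alpha * m%:R + 2 * n%:R - 1%:R) * D eps 2 m n t +
  (- (alpha * (beta + m%:R)) * D eps 2 m.+1 n t + -2 * D eps 2 m n.+1 t).
pose g3 eps t := ab * D2 eps 1 0 t + -2 * D2 eps 0 1 t.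
exists g1, g2, g3; split.
- move=> eps t t0.
  have h := is_derive_even t0 (is_derive_M eps 0 0 0 t0).
  have <- : D eps 0 0 0 t = g1 eps t by rewrite /D /g1 /ab; ring.
  have -> : g eps = (fun t => M eps 0 0 0 `|t|); last exact: h.
  apply/funext => u; rewrite /M /g /cauchy_cov expr0 mul1r addr0.
  have -> : alpha * 0%:R + 2 * 0%:R - 0%:R = 0 :> R by ring.
  by rewrite powRr0 mul1r -[in RHS]expr2 real_normK ?num_real// expr2 mulrC.
- move=> eps t t0.
  exact: (is_derive_add (is_derive_scale ab (is_derive_M eps 1 1 0 t0)) (is_derive_scale (-2) (is_derive_M eps 1 0 1 t0))).
- have dD eps m n (t : R) : 0 < t -> is_derive t 1 (D eps 1 m n) (D2 eps m n t).
    move=> t0; exact: (is_derive_add (is_derive_scale _ (is_derive_M eps 2 m n t0)) (is_derive_add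
      (is_derive_scale _ (is_derive_M eps 2 m.+1 n t0)) (is_derive_scale _ (is_derive_M eps 2 m n.+1 t0)))).
  move=> eps t t0.
  exact: (is_derive_add (is_derive_scale ab (dD eps 1 0 t t0)) (is_derive_scale (-2) (dD eps 0 1 t t0))).
- have bM m n : (0 < m + n)%N -> bounded3 (fun eps t => M eps 3 m n t) by exact: M_le.
  have bD m n : (0 < m + n)%N -> bounded3 (fun eps t => D eps 2 m n t).
    move=> mn; apply: bounded3D; first by apply: bounded3Z; exact: bM.
    by apply: bounded3D; apply: bounded3Z; apply: bM; rewrite ?addSn ?addnS.
  have bD2 m n : (0 < m + n)%N -> bounded3 (fun eps t => D2 eps m n t).
    move=> mn; apply: bounded3D; first by apply: bounded3Z; exact: bD.
    by apply: bounded3D; apply: bounded3Z; apply: bD; rewrite ?addSn ?addnS.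
  by apply: bounded3D; apply: bounded3Z; exact: bD2.
Qed.

End estimates.
End smoothed_covariance.

Section stable_tail.
Context {R : realType}.
Notation mu := (@lebesgue_measure R).
Notation pos := (`]0, +oo[%classic : set R).

(** The factor 1 / (2 pi) of Fourier inversion is left out, hence the later comparisons with 2 pi *
    [high_freq]. *)
Definition smoothed_density (alpha beta eps x : R) : R :=
  \int[mu]_t (expR (- (eps * (t * t))) * cauchy_cov alpha beta t * cos (x * t)).

Lemma cauchy_cov_ge0 (alpha beta t : R) : 0 <= cauchy_cov alpha beta t.
Proof. exact: powR_ge0. Qed.

Lemma cauchy_cov_le1 (alpha beta t : R) : 0 < beta -> cauchy_cov alpha beta t <= 1.
Proof.
move=> b0; rewrite -[leRHS](powRr0 (1 + `|t| `^ alpha)); apply: ler_powR.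
  by rewrite lerDl powR_ge0.
by rewrite oppr_le0 ltW.
Qed.

Lemma measurable_cauchy_cov (alpha beta : R) : measurable_fun setT (cauchy_cov alpha beta).
Proof.
have m1 : measurable_fun setT (fun t : R => 1 + `|t| `^ alpha).
  apply: measurable_funD => //.
  exact: (measurableT_comp (@measurable_powR R alpha) (@normr_measurable R setT)).
exact: (measurableT_comp (@measurable_powR R (- beta)) m1).
Qed.

Lemma integrable_smoothed_cov (alpha beta eps : R) : 0 < beta -> 0 < eps ->
  mu.-integrable setT (EFin \o (fun t => expR (- (eps * (t * t))) * cauchy_cov alpha beta t)).
Proof.
move=> b0 e0; apply: (integrable_mul_bounded measurableT (integrable_gaussian e0)).
  exact: measurable_cauchy_cov.
by move=> t; rewrite ger0_norm ?cauchy_cov_ge0// cauchy_cov_le1.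
Qed.

Lemma powRN_ge_tangent (beta u : R) : 0 < beta -> 0 <= u ->
  1 - beta * u <= (1 + u) `^ (- beta).
Proof.
move=> b0 u0; have q0 : 0 < 1 + u by lra.
rewrite /powR gt_eqF//; apply: le_trans _ (expR_ge1Dx _).
have : ln (1 + u) <= u by apply: le_ln1Dx; lra.
by nra.
Qed.

(** exp (beta L) >= 1 + beta L, where L = ln (1 + u) >= u / (1 + u). This bound has slope - beta at
    0, like the tangent bound above; the two squeeze the rescaled covariance. *)
Lemma powRN_le_chord (beta u : R) : 0 < beta -> 0 <= u ->
  (1 + u) `^ (- beta) <= 1 - beta * u / (1 + (1 + beta) * u).
Proof.
move=> b0 u0; have q0 : 0 < 1 + u by lra.
rewrite /powR gt_eqF// mulNr expRN.
set L := ln (1 + u).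
have Lu : u / (1 + u) <= L.
  have iq : -1 < (1 + u)^-1 - 1 by rewrite ltrBrDl subrr invr_gt0.
  have := le_ln1Dx iq; rewrite addrC subrK lnV ?posrE// -/L => h.
  have -> : u / (1 + u) = 1 - (1 + u)^-1 by field; rewrite gt_eqF.
  lra.
have L0 : 0 <= L by apply: le_trans Lu; rewrite divr_ge0// ltW.
have bL : 0 < 1 + beta * L by rewrite ltr_pwDl// mulr_ge0// ltW.
have E : (expR (beta * L))^-1 <= (1 + beta * L)^-1.
  by rewrite lef_pV2 ?posrE ?expR_gt0// expR_ge1Dx.
apply: le_trans E _.
have p : 0 < 1 + (1 + beta) * u by rewrite ltr_pwDl// mulr_ge0// addr_ge0// ltW.
have -> : 1 - beta * u / (1 + (1 + beta) * u) = (1 + u) / (1 + (1 + beta) * u).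
  by field; rewrite gt_eqF.
rewrite -div1r ler_pdivrMr// mulrAC ler_pdivlMr// mul1r.
have : u <= (1 + u) * L by rewrite mulrC -ler_pdivrMr.
by nra.
Qed.

Section low_alpha.
Variables alpha beta : R.
Hypothesis alpha02 : 0 < alpha < 2.
Hypothesis beta0 : 0 < beta.

Let alpha0 : 0 < alpha. Proof. by case/andP : alpha02. Qed.

Let L := 2 * beta * Gamma (alpha + 1) * sin (pi * alpha / 2).

Let g (eps t : R) := expR (- (eps * (t * t))) * cauchy_cov alpha beta t.

Let g_le1 eps t : 0 < eps -> g eps t <= cauchy_cov alpha beta t.
Proof.
move=> e0; rewrite /g ler_piMl ?cauchy_cov_ge0// -expR0 ler_expR oppr_le0.
by apply: mulr_ge0; [exact: ltW|rewrite -expr2 sqr_ge0].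
Qed.

Let g_ge eps t : 0 < eps -> 1 - beta * `|t| `^ alpha - eps * (t * t) <= g eps t.
Proof.
move=> e0; have c1 := cauchy_cov_le1 alpha t beta0.
have c0 := cauchy_cov_ge0 alpha beta t.
have h1 := powRN_ge_tangent beta0 (powR_ge0 `|t| alpha).
rewrite -/(cauchy_cov alpha beta t) in h1.
have h2 := ler_wpM2r c0 (expR_ge1Dx (- (eps * (t * t)))).
have v0 : 0 <= eps * (t * t) by apply: mulr_ge0; [exact: ltW|rewrite -expr2 sqr_ge0].
have h3 := ler_piMr v0 c1.
move: h1 h2 h3; rewrite /g; set c := cauchy_cov _ _ _; set E := expR _; set v := eps * _; set w := `|t| `^ _.
by move=> h1 h2 h3; lra.
Qed.

(** For |t| >= 1, [g] lies in [0, 1] and |t|^alpha >= 1. For |t| < 1 the Gaussian costs at most eps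
    t^2 <= |t|^alpha, since eps <= 1 and alpha < 2. *)
Let g_near1 eps t : 0 < eps <= 1 -> `|g eps t - 1| <= (beta + 1) * `|t| `^ alpha.
Proof.
move=> /andP[e0 e1].
have g1 : g eps t <= 1 by apply: le_trans (g_le1 t e0) (cauchy_cov_le1 _ _ beta0).
have g0 : 0 <= g eps t by rewrite mulr_ge0 ?expR_ge0 ?cauchy_cov_ge0.
have ta : 0 <= `|t| `^ alpha by exact: powR_ge0.
rewrite ler0_norm ?subr_le0// opprB.
have [t1|t1] := leP 1 `|t|.
  have : 1 <= `|t| `^ alpha by rewrite -[leLHS](powRr0 `|t|); apply: ler_powR => //; exact: ltW.
  by have := mulr_ge0 (ltW beta0) ta; lra.
have h : t * t <= `|t| `^ alpha.
  rewrite -expr2 -real_normK ?num_real//.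
  have [->|t0] := eqVneq t 0; first by rewrite normr0 expr0n powR_ge0.
  have n0 : 0 < `|t| by rewrite normr_gt0.
  rewrite -(powR_mulrn 2 (ltW n0)); apply: ger_powR; first by rewrite n0 ltW.
  by case/andP: alpha02 => _ /ltW.
have tt : 0 <= t * t by rewrite -expr2 sqr_ge0.
by have := g_ge t e0; have := ler_piMl tt e1; lra.
Qed.

(** No relation between [a k] and [eps k] is assumed, which is what makes the tail uniform in [eps].
    The abelian statement is applied with singularity coefficient - beta and value 1 at the
    origin. *)
Let sequential_tail (a eps : nat -> R) : (forall k, 0 < a k) -> (forall k, 0 < eps k <= 1) ->
  a k @[k --> \oo] --> +oo ->
  a k `^ (alpha + 1) * smoothed_density alpha beta (eps k) (a k) @[k --> \oo] --> L.
Proof.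
move=> a0 e01 ay.
have [g1 [g2 [g3 [d1 d2 d3 [K K0 HK]]]]] := smoothed_cov_derivatives alpha02 beta0.
have e0 k : 0 < eps k by case/andP: (e01 k).
have -> : L = - beta * abel_const alpha by rewrite abel_constE// /L; ring.
have ia : (a k)^-1 @[k --> \oo] --> (0 : R).
  by apply/(gtr0_cvgV0 (f := a)) => //; exact: nearW.
have ipow p : 0 < p -> (a k)^-1 `^ p @[k --> \oo] --> (0 : R).
  move=> p0; move/cvg_at_rightP : (@powR_cvg0 R p p0) => /(_ (fun k => (a k)^-1)); apply.
  by split => // k; rewrite invr_gt0.
apply: (@cos_transform_abel_scaled R alpha alpha02 (fun k => g (eps k)) (fun k => g1 (eps k))
  (fun k => g2 (eps k)) (fun k => g3 (eps k)) (fun=> 1) a (K + (beta + 1)) (- beta)).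
- by apply: addr_ge0 => //; apply: addr_ge0 => //; exact: ltW.
- exact: a0.
- by move=> k; exact: integrable_smoothed_cov.
- by move=> k y; rewrite /g /cauchy_cov normrN mulrNN.
- move=> k t t0; apply: le_trans (HK _ _ (e01 k) t0) _.
  rewrite ler_wpM2r ?powR_ge0// lerDl; apply: addr_ge0 => //; exact: ltW.
- move=> k t; apply: le_trans (g_near1 t (e01 k)) _.
  by rewrite ler_wpM2r ?powR_ge0// lerDr.
move=> y; set Y := `|y| `^ alpha.
have Y0 : 0 <= Y by exact: powR_ge0.
pose u k := (a k)^-1 `^ alpha * Y.
have uE k : `|y / a k| `^ alpha = u k.
  have ik : 0 < (a k)^-1 by rewrite invr_gt0.
  by rewrite normrM normfV (gtr0_norm (a0 k)) (powRM _ (normr_ge0 y) (ltW ik)) mulrC.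
have uA k : a k `^ alpha * u k = Y.
  have ik : 0 < (a k)^-1 by rewrite invr_gt0.
  by rewrite mulrA -(powRM _ (ltW (a0 k)) (ltW ik)) mulfV ?gt_eqF// powR1 mul1r.
have u0 : u k @[k --> \oo] --> (0 : R).
  by rewrite -(mul0r Y); apply: cvgM; [exact: ipow|exact: cvg_cst].
have u_ge0 k : 0 <= u k by rewrite mulr_ge0 ?powR_ge0.
have a2 : 0 < 2 - alpha by case/andP: alpha02 => _ ?; lra.
(* The Gaussian contributes at most a^alpha (y / a)^2 = a^(alpha - 2) y^2, which vanishes in the
   limit because alpha < 2. *)
have lo : - beta * Y - (a k)^-1 `^ (2 - alpha) * (y * y) @[k --> \oo] --> - beta * Y.
  rewrite -[X in _ --> X]subr0 -(mul0r (y * y)); apply: cvgB; first exact: cvg_cst.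
  by apply: cvgM; [exact: ipow|exact: cvg_cst].
have hi : - beta * Y / (1 + (1 + beta) * u k) @[k --> \oo] --> - beta * Y.
  have h1 : 1 + (1 + beta) * u k @[k --> \oo] --> (1 : R).
    rewrite -[X in _ --> X]addr0 -(mulr0 (1 + beta)).
    by apply: cvgD; [exact: cvg_cst|apply: cvgM => //; exact: cvg_cst].
  rewrite -[X in _ --> X]divr1; apply: cvgM; first exact: cvg_cst.
  exact: cvgV (oner_neq0 R) h1.
apply: squeeze_cvgr lo hi; apply: nearW => k.
have ak := a0 k; have ik : 0 < (a k)^-1 by rewrite invr_gt0.
have ap : 0 <= a k `^ alpha by exact: powR_ge0.
apply/andP; split.
  have := g_ge (y / a k) (e0 k); rewrite uE => h.
  have h2 : - beta * u k - (y / a k) * (y / a k) <= g (eps k) (y / a k) - 1.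
    have : 0 <= (y / a k) * (y / a k) by rewrite -expr2 sqr_ge0.
    by case/andP: (e01 k) => _; nra.
  apply: le_trans (ler_wpM2l ap h2); rewrite mulrBr [X in _ <= X - _]mulrCA uA.
  rewrite lerD2l lerN2.
  have -> : (a k)^-1 `^ (2 - alpha) = a k `^ alpha * ((a k)^-1 * (a k)^-1).
    rewrite powRB ?(gt_eqF ik) ?implybT// (powR_mulrn 2 (ltW ik)) expr2 mulrC.
    congr (_ * _); rewrite -powRN -(powR_inv1 (ltW ak)) -powRrM; congr (_ `^ _); ring.
  by rewrite le_eqVlt; apply/orP; left; apply/eqP; ring.
have := powRN_le_chord beta0 (u_ge0 k); rewrite -{1}uE -/(cauchy_cov alpha beta (y / a k)) => h.
have h2 : g (eps k) (y / a k) - 1 <= - (beta * u k / (1 + (1 + beta) * u k)).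
  by have := g_le1 (y / a k) (e0 k); lra.
apply: le_trans (ler_wpM2l ap h2) _.
by rewrite le_eqVlt; apply/orP; left; apply/eqP; rewrite -(uA k); ring.
Qed.

(** A failure beyond every threshold k + 1 would provide sequences contradicting
    [sequential_tail]. *)
Lemma smoothed_density_tail (eta : R) : 0 < eta -> exists2 M : R, 0 < M &
  forall a eps : R, M < a -> 0 < eps <= 1 ->
    `|a `^ (alpha + 1) * smoothed_density alpha beta eps a - L| <= eta.
Proof.
move=> eta0; apply: contrapT => /forall2NP nM.
have ex (k : nat) : exists p : R * R, [/\ k.+1%:R < p.1, 0 < p.2 <= 1 &
    eta < `|p.1 `^ (alpha + 1) * smoothed_density alpha beta p.2 p.1 - L|].
  have [|] := nM k.+1%:R; first by rewrite ltr0n.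
  move=> /existsNP[a /existsNP[eps /not_implyP[ka /not_implyP[e01 /negP]]]].
  by rewrite -ltNge => h; exists (a, eps).
have [p Hp] := choice ex.
have a0 k : 0 < (p k).1 by have [+ _ _] := Hp k; apply: lt_trans.
have e01 k : 0 < (p k).2 <= 1 by have [_ + _] := Hp k.
have ay : (p k).1 @[k --> \oo] --> +oo.
  apply/cvgryPge => r; near=> k; have [+ _ _] := Hp k; move=> /ltW; apply: le_trans.
  rewrite (@le_trans _ _ k%:R)// ?ler_nat//.
  by near: k; exact: nbhs_infty_ger.
have /cvgrPdist_le/(_ _ eta0)[N _ /(_ N (leqnn N))] := sequential_tail a0 e01 ay.
by rewrite /= distrC leNgt; have [_ _ ->] := Hp N.
Unshelve. all: by end_near. Qed.

End low_alpha.
End stable_tail.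

(** * The case alpha = 2 *)

Section dominated_fubini.
Context d1 d2 (T1 : measurableType d1) (T2 : measurableType d2) {R : realType}.
Variables (m1 : {sigma_finite_measure set T1 -> \bar R})
  (m2 : {sigma_finite_measure set T2 -> \bar R}).
Variables (F : T1 * T2 -> R) (f1 : T1 -> R) (f2 : T2 -> R).
Hypothesis mF : measurable_fun setT F.
Hypothesis f1i : m1.-integrable setT (EFin \o f1).
Hypothesis f2i : m2.-integrable setT (EFin \o f2).
Hypothesis Ff : forall x y, `|F (x, y)| <= f1 x * f2 y.

Lemma integrable_dominated_section1 x : m2.-integrable setT (EFin \o (fun y => F (x, y))).
Proof.
apply: (integrable_bounded_by measurableT _ (integrable_scale measurableT (f1 x) f2i)).
  exact: (measurableT_comp mF (measurable_pair1 x)).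
by move=> y _.
Qed.

Lemma integrable_dominated_section2 y : m1.-integrable setT (EFin \o (fun x => F (x, y))).
Proof.
apply: (integrable_bounded_by measurableT _ (integrable_scale measurableT (f2 y) f1i)).
  exact: (measurableT_comp mF (measurable_pair2 y)).
by move=> x _; rewrite mulrC.
Qed.

Let Fi : (m1 \x m2)%E.-integrable setT (EFin \o F).
Proof.
apply/(integrable12ltyP _) => //; first exact/measurable_EFinP.
have mf2 := integrable_measurable f2i.
have mf1 := integrable_measurable f1i.
have mnF : measurable_fun setT (fun z => `|(EFin \o F) z|)%E.
  by apply: measurableT_comp => //; exact/measurable_EFinP.
apply: (@le_lt_trans _ _ (\int[m1]_x (`|f1 x|%:E * \int[m2]_y `|f2 y|%:E))%E).
  apply: ge0_le_integral => //.
  - by move=> x _; exact: integral_ge0.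
  - exact: (measurable_fun_fubini_tonelli_F _ mnF).
  - apply: emeasurable_funM => //; apply/measurable_EFinP; exact: measurableT_comp.
  - move=> x _; rewrite -ge0_integralZl//; last first.
      by apply/measurable_EFinP; exact: measurableT_comp.
    apply: ge0_le_integral => //.
    + exact: (measurableT_comp mnF (measurable_pair1 x)).
    + by apply: emeasurable_funM => //; apply/measurable_EFinP; exact: measurableT_comp.
    + move=> y _; rewrite lee_fin (le_trans (Ff x y))// -normrM ler_norm//.
have /integrableP[_ h1] := f1i; have /integrableP[_ h2] := f2i.
have c : (\int[m2]_y `|f2 y|%:E)%E \is a fin_num.
  by rewrite ge0_fin_numE//; exact: integral_ge0.
rewrite ge0_integralZr//; last first.
- exact: integral_ge0.
- by apply/measurable_EFinP; exact: measurableT_comp.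
- by apply: lte_mul_pinfty => //; [exact: integral_ge0|rewrite ge0_fin_numE//; exact: integral_ge0].
Qed.

(** Real integrals are [fine] of extended ones; the domination holds at every point, so every
    section is integrable and the inner [fine] loses nothing. *)
Lemma Rintegral_fubini : \int[m1]_x \int[m2]_y F (x, y) = \int[m2]_y \int[m1]_x F (x, y).
Proof.
have := Fubini Fi; rewrite /Rintegral => h.
transitivity (fine (\int[m1]_x \int[m2]_y (EFin \o F) (x, y)))%E.
  congr fine; apply: eq_integral => x _; rewrite fineK//.
  exact: (integrable_fin_num measurableT (integrable_dominated_section1 x)).
rewrite h; congr fine; apply: eq_integral => y _; rewrite fineK//.
exact: (integrable_fin_num measurableT (integrable_dominated_section2 y)).
Qed.

End dominated_fubini.

(** * The Fourier transform of a Gaussian *)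

Section gaussian_fourier.
Context {R : realType}.
Notation mu := (@lebesgue_measure R).
Notation pos := (`]0, +oo[%classic : set R).

(** As a function of [x], 2 pi times the heat kernel at time [s]. *)
Definition gaussian_kernel (x s : R) : R :=
  Num.sqrt pi * s `^ (- 2^-1) * expR (- (x ^+ 2 / (4 * s))).

Lemma gaussian_fourier (s x : R) : 0 < s ->
  \int[mu]_t (expR (- (s * (t * t))) * cos (x * t)) = gaussian_kernel x s.
Proof.
move=> s0; pose r := Num.sqrt s; have r0 : 0 < r by rewrite sqrtr_gt0.
pose y := x / r; pose f (t : R) := expR (- t ^+ 2) * cos (y * t).
have fi : mu.-integrable setT (EFin \o f).
  apply: (integrable_mul_bounded measurableT (@integrableT_gauss R) (@measurable_cos_scale R y _)) => t.
  exact: cos_le1_norm.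
have fE (t : R) : f `|t| = f t.
  rewrite /f real_normK ?num_real//; congr (_ * _).
  by have [_|//] := ler0P t; rewrite mulrN cosN.
have fip : mu.-integrable pos (EFin \o f).
  exact: (integrableS measurableT measurable_pos _ fi).
have := (integrable_even_extension fip).2.
rewrite gaussian_cos_transform => h.
have := Rintegral_affine 0 (lt0r_neq0 r0) fi.
have -> : \int[mu]_t f t = \int[mu]_t f `|t| by apply: eq_Rintegral => t _; rewrite fE.
rewrite h gtr0_norm// => /esym h2; apply: (mulfI (lt0r_neq0 r0)).
have rr : r ^+ 2 = s by rewrite sqr_sqrtr// ltW.
transitivity (r * \int[mu]_t f (r * t + 0)).
  congr (_ * _); apply: eq_Rintegral => t _; rewrite /f addr0 exprMn rr expr2.
  by rewrite (_ : y * (r * t) = x * t)// /y; field; rewrite gt_eqF.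
rewrite h2 /gaussian_kernel powRN powR12_sqrt ?(ltW s0)// -/r /y expr_div_n rr.
have -> : - (x ^+ 2 / s) / 4 = - (x ^+ 2 / (4 * s)) by field; rewrite gt_eqF.
by field; rewrite gt_eqF.
Qed.

Lemma gaussian_kernel_ge0 (x s : R) : 0 <= gaussian_kernel x s.
Proof. by rewrite /gaussian_kernel mulr_ge0 ?expR_ge0// mulr_ge0 ?powR_ge0// sqrtr_ge0. Qed.

(** The bound of powers by exponentials, applied to 1 / s: for x != 0 the factor exp (- x^2 / (4 s))
    offsets s^(-1/2) near 0. The constant [K] serves for domination as [eps] tends to 0. *)
Lemma gaussian_kernel_bounded (x : R) : x != 0 ->
  exists2 K : R, 0 < K & forall s, 0 < s -> gaussian_kernel x s <= K.
Proof.
move=> x0; have c0 : 0 < x ^+ 2 / 4 by rewrite divr_gt0// exprn_even_gt0.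
have h0 : (0 : R) <= 2^-1 by rewrite invr_ge0.
have [K K0 HK] := powR_le_expR h0 c0.
exists (Num.sqrt pi * K); first by rewrite mulr_gt0// sqrtr_gt0 pi_gt0.
move=> s s0; rewrite /gaussian_kernel -mulrA ler_wpM2l ?sqrtr_ge0//.
have is0 : 0 <= s^-1 by rewrite invr_ge0 ltW.
have := HK _ is0.
have -> : s^-1 `^ 2^-1 = s `^ (- 2^-1) by rewrite -(powR_inv1 (ltW s0)) -powRrM mulN1r.
have -> : x ^+ 2 / 4 * s^-1 = x ^+ 2 / (4 * s) by field; rewrite gt_eqF.
by rewrite expRN -ler_pdivrMr ?expR_gt0.
Qed.

End gaussian_fourier.

Section bessel_tail.
Context {R : realType}.
Notation mu := (@lebesgue_measure R).
Notation pos := (`]0, +oo[%classic : set R).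
Variable beta : R.
Hypothesis beta0 : 0 < beta.

Let w (u : R) := u `^ (beta - 1) * expR (- u).

Let wi : mu.-integrable pos (EFin \o w) := integrable_gamma_weight beta0.

Lemma cauchy_cov2 (t : R) : cauchy_cov 2 beta t = (1 + t * t) `^ (- beta).
Proof.
by rewrite /cauchy_cov (powR_mulrn 2 (normr_ge0 t)) real_normK ?num_real// expr2.
Qed.

(** The covariance is written as a gamma mixture and the integrals are exchanged; the inner one is
    the transform of exp (- (eps + u) t^2). The factor exp (- eps t^2) provides the integrable bound
    in [t]. *)
Lemma smoothed_density2 (eps x : R) : 0 < eps ->
  Gamma beta * smoothed_density 2 beta eps x =
  \int[mu]_(u in pos) (w u * gaussian_kernel x (eps + u)).
Proof.
move=> e0; pose wp : R -> R := w \_ pos.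
have wpi : mu.-integrable setT (EFin \o wp).
  by have /(integrable_mkcond _ measurable_pos) := wi; rewrite restrict_EFin.
pose F (z : measurableTypeR R * measurableTypeR R) : R :=
  wp z.2 * (expR (- ((eps + z.2) * (z.1 * z.1))) * cos (x * z.1)).
have mwp : measurable_fun setT wp := integrable_measurable wpi.
have mF : measurable_fun setT F.
  have m1 : measurable_fun setT (fun z : measurableTypeR R * measurableTypeR R => z.1 : R) by exact: measurable_fst.
  have m2 : measurable_fun setT (fun z : measurableTypeR R * measurableTypeR R => z.2 : R) by exact: measurable_snd.
  apply: measurable_funM; first exact: (measurableT_comp mwp m2).
  apply: measurable_funM; last exact: (measurableT_comp (@measurable_cos_scale R x setT) m1).
  apply: (measurableT_comp (@measurable_expR R)).
  apply: measurable_funN; apply: measurable_funM; last exact: measurable_funM.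
  by apply: measurable_funD.
have wp0 u : 0 <= wp u.
  by rewrite /wp patchE; case: ifPn => // _; rewrite mulr_ge0 ?powR_ge0 ?expR_ge0.
have wpN u : u <= 0 -> wp u = 0.
  by move=> u0; rewrite /wp patchE memNset//= in_itv/= andbT ltNge u0.
have gi := integrable_gaussian e0.
have Ff (t u : R) : `|F (t, u)| <= expR (- (eps * (t * t))) * wp u.
  rewrite /F /= normrM (ger0_norm (wp0 u)) mulrC.
  have [u0|u0] := leP u 0; first by rewrite wpN// !mulr0.
  rewrite ler_wpM2r// normrM (ger0_norm (expR_ge0 _)).
  apply: (@le_trans _ _ (expR (- ((eps + u) * (t * t))))).
    by rewrite ler_piMr ?expR_ge0// cos_le1_norm.
  rewrite ler_expR lerN2 ler_wpM2r//; first by rewrite -expr2 sqr_ge0.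
  by rewrite lerDl ltW.
have := @Rintegral_fubini _ _ _ _ R (@lebesgue_measure R) (@lebesgue_measure R) F _ wp mF gi wpi Ff.
have inner1 (t : R) : \int[mu]_u F (t, u) =
    Gamma beta * (expR (- (eps * (t * t))) * cauchy_cov 2 beta t * cos (x * t)).
  have t1 : 0 < 1 + t * t by rewrite ltr_pwDl// -expr2 sqr_ge0.
  have [hi hE] := Gamma_scale beta0 t1.
  rewrite cauchy_cov2.
  transitivity (expR (- (eps * (t * t))) * cos (x * t) * \int[mu]_(u in pos) (u `^ (beta - 1) * expR (- ((1 + t * t) * u)))).
    rewrite -(RintegralZl _ measurable_pos hi) [RHS]Rintegral_mkcond.
    apply: eq_Rintegral => u _; rewrite /F /wp /= !patchE; case: ifPn => _; last by rewrite mul0r.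
    rewrite /w.
    have -> : - ((eps + u) * (t * t)) = - (eps * (t * t)) + - (u * (t * t)) by ring.
    have -> : - ((1 + t * t) * u) = - u + - (u * (t * t)) by ring.
    by rewrite !expRD; ring.
  by rewrite hE; ring.
have inner2 (u : R) : \int[mu]_t F (t, u) = wp u * gaussian_kernel x (eps + u).
  have [u0|u0] := leP u 0.
    rewrite wpN// mul0r /F; under eq_Rintegral do rewrite /= wpN// mul0r.
    by rewrite Rintegral_cst// mul0r.
  have eu : 0 < eps + u by rewrite addr_gt0.
  rewrite -gaussian_fourier// -RintegralZl//.
  apply: (integrable_mul_bounded measurableT (integrable_gaussian eu) (@measurable_cos_scale R x _)) => t.
  exact: cos_le1_norm.
under eq_Rintegral do rewrite inner1.
rewrite RintegralZl//; last first.
  apply: (integrable_mul_bounded measurableT (integrable_smoothed_cov 2 beta0 e0) (@measurable_cos_scale R x _)) => t.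
  exact: cos_le1_norm.
rewrite -/(smoothed_density 2 beta eps x) => ->.
rewrite [RHS]Rintegral_mkcond; apply: eq_Rintegral => u _; rewrite inner2 /wp !patchE.
by case: ifPn => // _; rewrite mul0r.
Qed.

End bessel_tail.

(** * Laplace's method for the mixture *)

Section bessel_asymptotics.
Context {R : realType}.
Notation mu := (@lebesgue_measure R).
Notation pos := (`]0, +oo[%classic : set R).
Variable beta : R.
Hypothesis beta0 : 0 < beta.

Let w (u : R) := u `^ (beta - 1) * expR (- u).
Let wi : mu.-integrable pos (EFin \o w) := integrable_gamma_weight beta0.
(** For x > 0 this is 2 sqrt pi (x / 2)^(beta - 1/2) times the modified Bessel function of the
    second kind of order beta - 1/2. *)
Let J (x : R) := \int[mu]_(u in pos) (w u * gaussian_kernel x u).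

Let continuous_gaussian_kernel (x s : R) : 0 < s -> {for s, continuous (gaussian_kernel x)}.
Proof.
move=> s0; apply: continuous_for_mul.
  by apply: continuous_for_mul; [exact: continuous_for_const|exact: continuous_powR].
apply: (@continuous_for_comp _ (fun s : R => - (x ^+ 2 / (4 * s))) expR); last exact: continuous_expR.
apply: (@continuous_for_comp _ (fun s : R => x ^+ 2 / (4 * s)) -%R); last exact: opp_continuous.
apply: continuous_for_mul; first exact: continuous_for_const.
apply: (@continuousV _ _ (fun s : R => 4 * s)); first by rewrite mulf_neq0// gt_eqF.
exact: (is_derive_continuous (is_derive_scale_var 4 s)).
Qed.

Let w_ge0 u : 0 <= w u. Proof. by rewrite mulr_ge0 ?powR_ge0 ?expR_ge0. Qed.

Let continuous_w (t : R) : 0 < t -> {for t, continuous w}.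
Proof.
move=> t0; apply: continuous_for_mul; first exact: continuous_powR.
exact: is_derive_continuous (is_derive_expRN t).
Qed.

Let smoothed_density2_cvgn (x : R) (e : nat -> R) : x != 0 -> (forall k, 0 < e k) ->
  e k @[k --> \oo] --> (0 : R) ->
  mu.-integrable pos (EFin \o (fun u => w u * gaussian_kernel x u)) /\
  Gamma beta * smoothed_density 2 beta (e k) x @[k --> \oo] --> J x.
Proof.
move=> x0 e0 ecv; have [K K0 HK] := gaussian_kernel_bounded x0.
have Kwi := integrable_scale measurable_pos K wi.
have -> : (fun k => Gamma beta * smoothed_density 2 beta (e k) x) =
    (fun k => \int[mu]_(u in pos) (w u * gaussian_kernel x (e k + u))).
  by apply/funext => k; rewrite smoothed_density2.
apply: (@Rintegral_dominated_cvg _ _ R mu pos (fun k u => w u * gaussian_kernel x (e k + u))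
  (fun u => w u * gaussian_kernel x u) _ measurable_pos _ _ Kwi).
- move=> k; apply: measurable_pos_continuous => u u0.
  apply: continuous_for_mul; first exact: continuous_w.
  apply: (@continuous_for_comp _ (fun u => e k + u) (gaussian_kernel x)).
    exact: (is_derive_continuous (is_derive_add (is_derive_const (e k) u) (is_derive_var u))).
  by apply: continuous_gaussian_kernel; rewrite addr_gt0.
- move=> u; rewrite /= in_itv/= andbT => u0.
  apply: cvgM; first exact: cvg_cst.
  apply: continuous_cvg; first exact: continuous_gaussian_kernel.
  by rewrite -[X in _ --> X]add0r; apply: cvgD => //; exact: cvg_cst.
- move=> k u; rewrite /= in_itv/= andbT => u0.
  rewrite normrM (ger0_norm (w_ge0 u)) ger0_norm ?gaussian_kernel_ge0// mulrC.
  by rewrite ler_wpM2r// HK// addr_gt0.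
Qed.

Lemma smoothed_density2_cvg (x : R) : x != 0 ->
  Gamma beta * smoothed_density 2 beta e x @[e --> 0^'+] --> J x.
Proof.
move=> x0; apply/cvg_at_rightP => e [e0 ecv].
by have [] := smoothed_density2_cvgn x0 e0 ecv.
Qed.

Let Ji (x : R) : x != 0 -> mu.-integrable pos (EFin \o (fun u => w u * gaussian_kernel x u)).
Proof.
move=> x0; have [] // := @smoothed_density2_cvgn x (fun k => k.+1%:R^-1) x0.
exact: cvg_harmonic.
Qed.

Let p := beta - 3 / 2.

(** The exponent u + x^2 / (4 u) is minimal at u = x / 2. With u = x v / 2 it is x + (x / 2) (v -
    1)^2 / v, so the critical point is v = 1 for every [x] and exp (- x) factors out. The power [p]
    collects beta - 1 from the gamma weight and - 1/2 from the kernel. *)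
Let shape (x v : R) := v `^ p * expR (- (x / 2 * ((v - 1) ^+ 2 / v))).

Let JE (x : R) : 0 < x ->
  mu.-integrable pos (EFin \o (shape x)) /\
  J x = Num.sqrt pi * (x / 2) `^ (beta - 2^-1) * expR (- x) * \int[mu]_(v in pos) shape x v.
Proof.
move=> x0; have c0 : 0 < x / 2 by rewrite divr_gt0.
have [hi hE] := Rintegral_pos_scale c0 (Ji (lt0r_neq0 x0)).
pose C := Num.sqrt pi * (x / 2) `^ p * expR (- x).
have C0 : C != 0.
  by rewrite !mulf_neq0// gt_eqF ?sqrtr_gt0 ?pi_gt0 ?powR_gt0 ?expR_gt0.
have E (v : R) : 0 < v -> w (x / 2 * v) * gaussian_kernel x (x / 2 * v) = C * shape x v.
  move=> v0; rewrite /w /gaussian_kernel /C /shape.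
  have -> : p = (beta - 1) + - 2^-1 by rewrite /p; field.
  rewrite !(powRM _ (ltW c0) (ltW v0)).
  rewrite (@powRD _ (x / 2) (beta - 1) (- 2^-1)) ?(gt_eqF c0) ?implybT//.
  rewrite (@powRD _ v (beta - 1) (- 2^-1)) ?(gt_eqF v0) ?implybT//.
  have e : - (x / 2 * v) + - (x ^+ 2 / (4 * (x / 2 * v))) = - x + - (x / 2 * ((v - 1) ^+ 2 / v)).
    by field; rewrite !gt_eqF.
  have e2 : expR (- (x / 2 * v)) * expR (- (x ^+ 2 / (4 * (x / 2 * v)))) =
      expR (- x) * expR (- (x / 2 * ((v - 1) ^+ 2 / v))) by rewrite -!expRD e.
  set a := (x / 2) `^ (beta - 1); set b := (x / 2) `^ (- 2^-1).
  set a' := v `^ (beta - 1); set b' := v `^ (- 2^-1); set q := Num.sqrt pi.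
  transitivity (q * a * b * a' * b' * (expR (- (x / 2 * v)) * expR (- (x ^+ 2 / (4 * (x / 2 * v)))))); first by ring.
  by rewrite e2; ring.
have si : mu.-integrable pos (EFin \o (shape x)).
  have := integrable_scale measurable_pos C^-1 hi.
  apply: eq_integrable; first exact: measurable_pos.
  by move=> v; rewrite inE/= in_itv/= andbT => v0; rewrite E// mulKf.
split => //; rewrite /J hE.
transitivity (x / 2 * \int[mu]_(v in pos) (C * shape x v)).
  by congr (_ * _); apply: eq_Rintegral => v; rewrite inE/= in_itv/= andbT => v0; rewrite E.
rewrite (RintegralZl _ measurable_pos si) !mulrA; congr (_ * _).
have -> : beta - 2^-1 = p + 1 by rewrite /p; field.
rewrite powRD ?(gt_eqF c0) ?implybT// (powRr1 (ltW c0)) /C; ring.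
Qed.

(** Since (v - 1)^2 / (4 v) = v / 4 + 1 / (4 v) - 1/2, the exponential controls v^p at both ends,
    through v for v >= 1 and through 1 / v otherwise. *)
Let shape_bound : exists2 K : R, 0 < K & forall v : R, 0 < v ->
  v `^ p * expR (- ((v - 1) ^+ 2 / (4 * v))) <= K.
Proof.
have q0 : (0 : R) < 4^-1 by rewrite invr_gt0.
have [K K0 HK] := powR_le_expR (normr_ge0 p) q0.
exists (K * expR 2^-1); first by rewrite mulr_gt0 ?expR_gt0.
move=> v v0; have iv0 : 0 < v^-1 by rewrite invr_gt0.
have -> : - ((v - 1) ^+ 2 / (4 * v)) = - (4^-1 * v + 4^-1 * v^-1) + 2^-1.
  by field; rewrite gt_eqF.
rewrite expRD mulrA ler_wpM2r ?expR_ge0// expRN ler_pdivrMr ?expR_gt0// expRD.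
have e1 : 1 <= expR (4^-1 * v) by rewrite -expR0 ler_expR mulr_ge0// ltW.
have e2 : 1 <= expR (4^-1 * v^-1) by rewrite -expR0 ler_expR mulr_ge0// ltW.
have [v1|v1] := leP 1 v.
  have h : v `^ p <= v `^ `|p| by apply: ler_powR => //; exact: ler_norm.
  apply: le_trans h _; apply: le_trans (HK v (ltW v0)) _.
  by rewrite ler_wpM2l ?(ltW K0)// ler_peMr ?expR_ge0.
have -> : v `^ p = v^-1 `^ (- p).
  by rewrite -(powR_inv1 (ltW v0)) -powRrM mulN1r opprK.
have h : v^-1 `^ (- p) <= v^-1 `^ `|p|.
  by apply: ler_powR; rewrite ?invf_ge1 ?(ltW v1)// -normrN ler_norm.
apply: le_trans h _; apply: le_trans (HK _ (ltW iv0)) _.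
by rewrite ler_wpM2l ?(ltW K0)// ler_peMl ?expR_ge0.
Qed.

Let integrable_exponential : mu.-integrable setT (EFin \o (fun y => expR (- (4^-1 * `|y|)))).
Proof.
have q0 : (0 : R) < 4^-1 by rewrite invr_gt0.
have [h _] := Gamma_scale (ltr01 : (0 : R) < 1) q0.
have [+ _] := integrable_even_extension h; apply: eq_integrable => // y _ /=.
by rewrite subrr powRr0 mul1r.
Qed.

(** At the scale v = 1 + y / sqrt x the exponent is - y^2 / (2 v), which tends to - y^2 / 2; the
    limit is a Gauss integral. *)
Let shape_cvg (x : nat -> R) : (forall k, 1 <= x k) -> x k @[k --> \oo] --> +oo ->
  Num.sqrt (x k) * \int[mu]_(v in pos) shape (x k) v @[k --> \oo] --> Num.sqrt (2 * pi).
Proof.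
move=> x1 xy; have x0 k : 0 < x k := lt_le_trans ltr01 (x1 k).
pose r k := (Num.sqrt (x k))^-1.
have r0 k : 0 < r k by rewrite invr_gt0 sqrtr_gt0.
have rr k : r k ^+ 2 = (x k)^-1 by rewrite exprVn sqr_sqrtr// ltW.
pose f k y := (shape (x k) \_ pos) (r k * y + 1).
have si k : mu.-integrable setT (EFin \o (shape (x k) \_ pos)).
  by have [/(integrable_mkcond _ measurable_pos)] := JE (x0 k); rewrite restrict_EFin.
have fi k : mu.-integrable setT (EFin \o f k).
  by apply: integrable_affine => //; rewrite gt_eqF.
have -> : (fun k => Num.sqrt (x k) * \int[mu]_(v in pos) shape (x k) v) =
    (fun k => \int[mu]_y f k y).
  apply/funext => k; rewrite Rintegral_mkcond.
  rewrite (Rintegral_affine 1 (lt0r_neq0 (r0 k)) (si k)) gtr0_norm//.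
  by rewrite mulrA /r mulfV ?mul1r// gt_eqF// sqrtr_gt0.
have lim : \int[mu]_y expR (- (2^-1 * (y * y))) = Num.sqrt (2 * pi).
  have h2 : (0 : R) < 2^-1 by rewrite invr_gt0.
  have := gaussian_fourier 0 h2.
  under eq_Rintegral do rewrite mul0r cos0 mulr1.
  move=> ->; rewrite /gaussian_kernel expr0n /= mul0r oppr0 expR0 mulr1.
  have -> : 2^-1 `^ (- 2^-1) = 2 `^ 2^-1 :> R.
    by rewrite -[X in X `^ _](powR_inv1 (ler0n R 2)) -powRrM mulN1r opprK.
  by rewrite powR12_sqrt// -sqrtrM ?pi_ge0// mulrC.
rewrite -lim.
have [K K0 HK] := shape_bound.
have Ki := integrable_scale measurableT (K * expR 4^-1) integrable_exponential.
have rcv : r k @[k --> \oo] --> (0 : R).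
  have h2 : (0 : R) < 2^-1 by rewrite invr_gt0.
  have c0 := powR_cvg0 h2.
  have -> : r = (fun k => (x k)^-1 `^ 2^-1).
    by apply/funext => k; rewrite powR12_sqrt ?invr_ge0 ?(ltW (x0 k))// /r sqrtrV// ltW.
  move/cvg_at_rightP : c0 => /(_ (fun k => (x k)^-1)); apply.
  split => [k|]; first by rewrite invr_gt0.
  by apply/(gtr0_cvgV0 (f := x)) => //; exact: nearW.
have fE k y : 0 < r k * y + 1 ->
    f k y = (r k * y + 1) `^ p * expR (- (y ^+ 2 / (2 * (r k * y + 1)))).
  move=> v0; rewrite /f patchE mem_set/= ?in_itv/= ?andbT// /shape addrK exprMn rr.
  by congr (_ * expR (- _)); field; rewrite !gt_eqF.
have f0 k y : r k * y + 1 <= 0 -> f k y = 0.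
  by move=> v0; rewrite /f patchE memNset//= in_itv/= andbT ltNge v0.
have [] // := @Rintegral_dominated_cvg _ _ R mu setT f (fun y => expR (- (2^-1 * (y * y)))) _ measurableT _ _ Ki.
- by move=> k; exact: integrable_measurable (fi k).
- move=> y _.
  have vcv : r k * y + 1 @[k --> \oo] --> (1 : R).
    rewrite -[X in _ --> X]add0r -(mul0r y); apply: cvgD; last exact: cvg_cst.
    by apply: cvgM => //; exact: cvg_cst.
  have : (r k * y + 1) `^ p * expR (- (y ^+ 2 / (2 * (r k * y + 1)))) @[k --> \oo] -->
     (1 : R) `^ p * expR (- (y ^+ 2 / (2 * 1))).
    apply: cvgM; first exact: (continuous_cvg _ (continuous_powR ltr01) vcv).
    apply: continuous_cvg; first exact: continuous_expR.
    apply: cvgN; apply: cvgM; first exact: cvg_cst.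
    apply: cvgV; first by rewrite mulr1.
    by apply: cvgM => //; exact: cvg_cst.
  rewrite powR1 mul1r mulr1 expr2 (mulrC _ 2^-1); apply: cvg_trans; apply: near_eq_cvg.
  near=> k; rewrite fE ?expr2//.
  near: k; exact: (cvgr_gt _ vcv _ ltr01).
- move=> k y _; have [v0|v0] := leP (r k * y + 1) 0.
    by rewrite f0// normr0 mulr_ge0 ?expR_ge0// mulr_ge0 ?expR_ge0// ltW.
  rewrite fE// ger0_norm ?mulr_ge0 ?powR_ge0 ?expR_ge0//.
  set v := r k * y + 1.
  have vy : v <= 1 + `|y|.
    rewrite /v addrC lerD2l; apply: le_trans (ler_norm _) _.
    rewrite normrM (gtr0_norm (r0 k)) ler_piMl// /r invf_le1 ?sqrtr_gt0//.
    by rewrite -sqrtr1 ler_wsqrtr.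
  (* One half of y^2 / (2 v) is at least (v - 1)^2 / (4 v), as x >= 1, and pays for v^p through
     [shape_bound]; the other half is at least (|y| - 1) / 4, as v <= 1 + |y|, and gives
     integrability in [y]. *)
  have e1 : - (y ^+ 2 / (2 * v)) <= - ((v - 1) ^+ 2 / (4 * v)) + (4^-1 + - (4^-1 * `|y|)).
    have -> : (v - 1) ^+ 2 = (x k)^-1 * y ^+ 2 by rewrite /v addrK exprMn rr.
    have y2 : 0 <= y ^+ 2 by exact: sqr_ge0.
    have h1 : (x k)^-1 * y ^+ 2 / (4 * v) <= y ^+ 2 / (4 * v).
      by rewrite ler_wpM2r ?invr_ge0 ?mulr_ge0 ?(ltW v0)// ler_piMl// invf_le1.
    have h2 : 4^-1 * `|y| - 4^-1 <= y ^+ 2 / (4 * v).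
      rewrite ler_pdivlMr ?mulr_gt0//.
      have n2 : `|y| ^+ 2 = y ^+ 2 by rewrite real_normK ?num_real.
      have n0 := normr_ge0 y.
      have -> : (4^-1 * `|y| - 4^-1) * (4 * v) = (`|y| - 1) * v by field.
      rewrite -n2; have [y1|y1] := leP 1 `|y|; last first.
        have := sqr_ge0 `|y|; have : 0 <= (1 - `|y|) * v by rewrite mulr_ge0 ?subr_ge0 ?ltW.
        by lra.
      have : (`|y| - 1) * v <= (`|y| - 1) * (1 + `|y|) by rewrite ler_wpM2l// subr_ge0.
      by nra.
    have -> : y ^+ 2 / (2 * v) = y ^+ 2 / (4 * v) + y ^+ 2 / (4 * v) by field; rewrite gt_eqF.
    lra.
  apply: (@le_trans _ _ (v `^ p * (expR (- ((v - 1) ^+ 2 / (4 * v))) * (expR 4^-1 * expR (- (4^-1 * `|y|)))))).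
    by rewrite ler_wpM2l ?powR_ge0// -!expRD ler_expR.
  by rewrite !mulrA ler_wpM2r ?expR_ge0// ler_wpM2r ?expR_ge0// HK.
Unshelve. all: by end_near. Qed.

Let bessel_cvg (x : nat -> R) : (forall k, 1 <= x k) -> x k @[k --> \oo] --> +oo ->
  J (x k) / (2 * pi * Gamma beta * high_freq 2 beta (x k)) @[k --> \oo] --> (1 : R).
Proof.
move=> x1 xy; have x0 k : 0 < x k := lt_le_trans ltr01 (x1 k).
have s0 : Num.sqrt (2 * pi) != 0 :> R by rewrite gt_eqF// sqrtr_gt0 mulr_gt0 ?pi_gt0.
have := shape_cvg x1 xy => h.
have : (Num.sqrt (x k) * \int[mu]_(v in pos) shape (x k) v) / Num.sqrt (2 * pi) @[k --> \oo] --> (1 : R).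
  by rewrite -[X in _ --> X](mulfV s0); exact: (cvgM h (cvg_cst _)).
(* The constants match because sqrt pi (x / 2)^(beta - 1/2) sqrt (2 pi / x) = 2 pi x^(beta - 1) /
   2^beta. *)
suff -> : (fun k => J (x k) / (2 * pi * Gamma beta * high_freq 2 beta (x k))) =
    (fun k => (Num.sqrt (x k) * \int[mu]_(v in pos) shape (x k) v) / Num.sqrt (2 * pi)) by [].
apply/funext => k; have xk := x0 k.
have [_ ->] := JE xk; set I := Rintegral _ _ _.
rewrite /high_freq eqxx (gtr0_norm xk).
have b0 := Gamma_gt0 beta0.
have e1 : (x k / 2) `^ (beta - 2^-1) = x k `^ (beta - 1) * Num.sqrt (x k) * (Num.sqrt 2 / 2 `^ beta).
  have i2 : (0 : R) <= 2^-1 by rewrite invr_ge0.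
  rewrite (powRM _ (ltW xk) i2).
  have -> : 2^-1 `^ (beta - 2^-1) = Num.sqrt 2 / 2 `^ beta :> R.
    rewrite -(powR_inv1 (ler0n R 2)) -powRrM -powR12_sqrt// -powRN -powRD ?pnatr_eq0 ?implybT//.
    by congr (_ `^ _); rewrite powR_inv1//; ring.
  congr (_ * _); rewrite -(powR12_sqrt (ltW xk)) -powRD ?(gt_eqF xk) ?implybT//.
  by congr (_ `^ _); field.
have p0 : 0 < pi :> R := pi_gt0 R.
have sp : Num.sqrt pi ^+ 2 = pi :> R by rewrite sqr_sqrtr// ltW.
have s2 : Num.sqrt 2 ^+ 2 = 2 :> R by rewrite sqr_sqrtr.
rewrite e1 sqrtrM//.
have q1 : 0 < Num.sqrt pi :> R by rewrite sqrtr_gt0.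
have q2 : 0 < Num.sqrt 2 :> R by rewrite sqrtr_gt0.
have q3 : 0 < 2 `^ beta :> R by rewrite powR_gt0.
have q4 : 0 < x k `^ (beta - 1) by rewrite powR_gt0.
have q5 := expR_gt0 (- x k).
move: sp s2 q1 q2 q3 q4 q5 b0; set a := Num.sqrt pi; set b := Num.sqrt 2; set c := 2 `^ beta.
set d := x k `^ _; set e := expR _; set g := Gamma _; set s := Num.sqrt (x k).
move=> sp s2 q1 q2 q3 q4 q5 b0.
have -> : 2 * pi = (b * a) ^+ 2 by rewrite exprMn sp s2.
field; rewrite !gt_eqF//.
Qed.

(** Half of [eta] is spent on Laplace's method, whose threshold concerns [x] alone, and half on the
    limit in [e] at fixed [x]. *)
Lemma smoothed_density2_tail (eta : R) : 0 < eta -> exists2 M : R, 0 < M &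
  forall x : R, M < x -> \forall e \near 0^'+,
    `|smoothed_density 2 beta e x / (2 * pi * high_freq 2 beta x) - 1| <= eta.
Proof.
move=> eta0; have eta2 : 0 < eta / 2 by rewrite divr_gt0.
have G0 := Gamma_gt0 beta0.
have [M M0 HM] : exists2 M : R, 0 < M & forall x, M < x ->
    `|J x / (2 * pi * Gamma beta * high_freq 2 beta x) - 1| <= eta / 2.
  apply: contrapT => /forall2NP nM.
  have ex (k : nat) : exists x : R, k.+1%:R < x /\
      eta / 2 < `|J x / (2 * pi * Gamma beta * high_freq 2 beta x) - 1|.
    have [|] := nM k.+1%:R; first by rewrite ltr0n.
    by move=> /existsNP[x /not_implyP[kx /negP]]; rewrite -ltNge => h; exists x.
  have [x Hx] := choice ex.
  have x1 k : 1 <= x k by have [/ltW + _] := Hx k; apply: le_trans; rewrite ler1n.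
  have xy : x k @[k --> \oo] --> +oo.
    apply/cvgryPge => r; near=> k; have [/ltW + _] := Hx k; apply: le_trans.
    rewrite (@le_trans _ _ k%:R)// ?ler_nat//.
    by near: k; exact: nbhs_infty_ger.
  have /cvgrPdist_le/(_ _ eta2)[N _ /(_ N (leqnn N))] := bessel_cvg x1 xy.
  by rewrite /= distrC leNgt; have [_ ->] := Hx N.
exists M => // x Mx; have x0 := lt_trans M0 Mx.
have h := smoothed_density2_cvg (lt0r_neq0 x0).
pose c := (2 * pi * Gamma beta * high_freq 2 beta x)^-1.
have hc : Gamma beta * smoothed_density 2 beta e x * c @[e --> 0^'+] --> J x * c.
  by apply: cvgM => //; exact: cvg_cst.
have /cvgrPdist_le/(_ _ eta2) := hc; apply: filterS => e he.
have -> : smoothed_density 2 beta e x / (2 * pi * high_freq 2 beta x) = Gamma beta * smoothed_density 2 beta e x * c.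
  have H0 : 0 < high_freq 2 beta x.
    rewrite /high_freq eqxx mulr_gt0 ?expR_gt0// divr_gt0 ?mulr_gt0 ?powR_gt0//.
    by rewrite normr_gt0 gt_eqF.
  rewrite /c; move: (pi_gt0 R); move: (pi : R) => q q0.
  by field; rewrite !gt_eqF.
have := HM x Mx; rewrite -/c => h1.
rewrite (splitr eta); apply: le_trans (_ : _ <= `|J x * c - Gamma beta * smoothed_density 2 beta e x * c| + `|J x * c - 1|) _.
  rewrite -[X in _ <= X + _]normrN opprB; apply: le_trans (ler_normD _ _).
  by rewrite addrA subrK.
by apply: lerD.
Unshelve. all: by end_near. Qed.

End bessel_asymptotics.

(** * Inversion in several variables *)

Section coordinate_inversion.
Context {R : realType} (n : nat).
Notation mu := (@lebesgue_measure R).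
Notation T := (measurableTypeR R).
Notation nu := (lebesgue_tuple R n).
Variables (s : n.-tuple T -> R) (c : 'I_n -> R -> R) (a : 'I_n -> R) (eps : R).
Hypothesis si : nu.-integrable setT (EFin \o s).
Hypothesis eps0 : 0 < eps.
Hypothesis c0 : forall i, c i 0 = 1.
Hypothesis cN : forall i t, c i (- t) = c i t.
Hypothesis ci : forall i,
  mu.-integrable setT (EFin \o (fun t => expR (- (eps * (t * t))) * c i t)).

Let L (th : 'I_n -> R) (x : n.-tuple T) : R := \sum_(i < n) th i * tnth x i.

Hypothesis s_cos : forall th, \int[nu]_x (cos (L th x) * s x) = \prod_(i < n) c i (th i).
Hypothesis s_sin : forall th, \int[nu]_x (sin (L th x) * s x) = 0.

Let mL th : measurable_fun setT (L th).
Proof.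
apply: measurable_sum => i; apply: measurable_funM => //.
exact: measurable_tnth.
Qed.

Let mcosL th phi : measurable_fun setT (fun x => cos (L th x + phi)).
Proof.
apply: (measurableT_comp measurable_cos_setT).
by apply: measurable_funD.
Qed.

Let G (i : 'I_n) (x : n.-tuple T) := gaussian_kernel (tnth x i - a i) eps.

Let Q : R := Num.sqrt pi * eps `^ (- 2^-1).

Let Q0 : 0 <= Q. Proof. by rewrite mulr_ge0 ?sqrtr_ge0 ?powR_ge0. Qed.

Let G_ge0 i x : 0 <= G i x. Proof. exact: gaussian_kernel_ge0. Qed.

Let G_le i x : G i x <= Q.
Proof.
rewrite /G /gaussian_kernel ler_piMr// -expR0 ler_expR oppr_le0.
by apply: divr_ge0; rewrite ?sqr_ge0 ?mulr_ge0 ?(ltW eps0).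
Qed.

Let mG i : measurable_fun setT (G i).
Proof.
have m1 : measurable_fun setT (fun x : n.-tuple T => tnth x i - a i).
  by apply: measurable_funB => //; exact: measurable_tnth.
apply: measurable_funM => //; apply: (measurableT_comp (@measurable_expR R)).
apply: measurable_funN; apply: measurable_funM => //.
exact: measurable_funX.
Qed.

Let P (r : seq 'I_n) (x : n.-tuple T) := \prod_(i <- r) G i x.

Let mP r : measurable_fun setT (P r).
Proof. by apply: measurable_prod => i _. Qed.

Let P_le r x : `|P r x| <= Q ^+ size r.
Proof.
rewrite /P; elim: r => [|i r IH]; first by rewrite big_nil normr1.
rewrite big_cons normrM exprS; apply: ler_pM => //.
by rewrite ger0_norm.
Qed.

Let I (i : 'I_n) : R := \int[mu]_t (expR (- (eps * (t * t))) * c i t * cos (a i * t)).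

Let nsi : nu.-integrable setT (EFin \o (fun x => `|s x|)).
Proof. by have := integrable_abse si; apply: eq_integrable. Qed.

Let ms : measurable_fun setT s := integrable_measurable si.

Let sPi r th phi : nu.-integrable setT (EFin \o (fun x => s x * P r x * cos (L th x + phi))).
Proof.
apply: (integrable_bounded_by measurableT _ (integrable_scale measurableT (Q ^+ size r) nsi)).
  by apply: measurable_funM => //; exact: measurable_funM.
move=> x _; rewrite normrM; apply: le_trans (_ : _ <= `|s x * P r x|) _.
  by rewrite ler_piMr// cos_le1_norm.
by rewrite normrM mulrC ler_wpM2r// P_le.
Qed.

(** The kernels of the coordinates in [r] are removed one at a time: each is written as a cosine
    integral in [t], and Fubini applies. The new cosine changes both a frequency and the phase, so
    the induction carries arbitrary [th] and [phi], with frequency 0 at the coordinates still to be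
    treated. *)
Let coordinate_inversion_seq (r : seq 'I_n) : uniq r -> forall th phi,
  (forall i, i \in r -> th i = 0) ->
  \int[nu]_x (s x * P r x * cos (L th x + phi)) =
  cos phi * \prod_(i <- r) I i * \prod_(i < n) c i (th i).
Proof.
elim: r => [_ th phi _|j r IH /= /andP[jr ur] th phi th0].
  have i1 : nu.-integrable setT (EFin \o (fun x => cos (L th x) * s x)).
    apply: (integrable_bounded_by measurableT _ nsi).
      apply: measurable_funM => //; exact: (measurableT_comp measurable_cos_setT (mL th)).
    by move=> x _; rewrite normrM ler_piMl// cos_le1_norm.
  have i2 : nu.-integrable setT (EFin \o (fun x => sin (L th x) * s x)).
    apply: (integrable_bounded_by measurableT _ nsi).
      apply: measurable_funM => //.
      by apply: (measurableT_comp _ (mL th)); apply: continuous_measurable_fun; exact: continuous_sin.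
    by move=> x _; rewrite normrM ler_piMl// sin_le1_norm.
  rewrite big_nil mulr1 -s_cos.
  transitivity (\int[nu]_x (cos phi * (cos (L th x) * s x) - sin phi * (sin (L th x) * s x))).
    by apply: eq_Rintegral => x _; rewrite /P big_nil cosD; ring.
  rewrite (RintegralB measurableT (integrable_scale measurableT _ i1) (integrable_scale measurableT _ i2)).
  by rewrite !RintegralZl// s_sin mulr0 subr0.
pose e (t : R) (i : 'I_n) := if i == j then t else th i.
have Le t x : L (e t) x = L th x + t * tnth x j.
  rewrite /L (bigD1 j)//= [in RHS](bigD1 j)//= th0 ?mem_head// mul0r add0r addrC.
  congr (_ + _); last by rewrite /e eqxx.
  by apply: eq_bigr => i ij; rewrite /e (negbTE ij).
have er t i : i \in r -> e t i = 0.
  move=> ir; rewrite /e; case: eqP => [ij|_]; first by rewrite -ij ir in jr.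
  by apply: th0; rewrite inE ir orbT.
have ce t : \prod_(i < n) c i (e t i) = c j t * \prod_(i < n) c i (th i).
  rewrite (bigD1 j)//= [in RHS](bigD1 j)//= th0 ?mem_head// c0 mul1r.
  by rewrite {1}/e eqxx; congr (_ * _); apply: eq_bigr => i ij; rewrite /e (negbTE ij).
pose F (z : n.-tuple T * T) : R := s z.1 * P r z.1 * cos (L th z.1 + phi) *
  (expR (- (eps * (z.2 * z.2))) * cos ((tnth z.1 j - a j) * z.2)).
have m1 : measurable_fun setT (fun z : n.-tuple T * T => z.1) by exact: measurable_fst.
have m2 : measurable_fun setT (fun z : n.-tuple T * T => z.2 : R) by exact: measurable_snd.
have mF : measurable_fun setT F.
  apply: measurable_funM.
    exact: (measurableT_comp (measurable_funM (measurable_funM ms (mP r)) (mcosL th phi)) m1).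
  apply: measurable_funM.
    apply: (measurableT_comp (@measurable_expR R)).
    by apply: measurable_funN; apply: measurable_funM => //; exact: measurable_funM.
  apply: (measurableT_comp measurable_cos_setT); apply: measurable_funM => //.
  apply: measurable_funB => //.
  exact: (measurableT_comp (measurable_tnth j) m1).
have Ff x t : `|F (x, t)| <= Q ^+ size r * `|s x| * expR (- (eps * (t * t))).
  rewrite /F /= normrM; apply: ler_pM => //.
    rewrite normrM; apply: le_trans (_ : _ <= `|s x * P r x|) _.
      by rewrite ler_piMr// cos_le1_norm.
    by rewrite normrM mulrC ler_wpM2r// P_le.
  by rewrite normrM ger0_norm ?expR_ge0// ler_piMr ?expR_ge0// cos_le1_norm.
have := Rintegral_fubini mF (integrable_scale measurableT (Q ^+ size r) nsi) (integrable_gaussian eps0) Ff.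
have inner1 x : \int[mu]_t F (x, t) = s x * P (j :: r) x * cos (L th x + phi).
  rewrite /F /= RintegralZl//; last first.
    apply: (integrable_mul_bounded measurableT (integrable_gaussian eps0) (@measurable_cos_scale R _ _)) => t.
    exact: cos_le1_norm.
  by rewrite gaussian_fourier// /P big_cons -/(G j x); ring.
have inner2 t : \int[nu]_x F (x, t) = cos phi * \prod_(i <- r) I i * \prod_(i < n) c i (th i) *
    (expR (- (eps * (t * t))) * c j t * cos (a j * t)).
  (* A product of cosines is turned into a sum: coordinate [j] receives the frequencies t and - t,
     and the phase moves by a j t in opposite directions. By evenness of [c j] both terms carry the
     same covariance, and the phases recombine into cos phi cos (a j t). *)
  transitivity (\int[nu]_x (expR (- (eps * (t * t))) / 2 *
     (s x * P r x * cos (L (e t) x + (phi - a j * t)) + s x * P r x * cos (L (e (- t)) x + (phi + a j * t))))).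
    apply: eq_Rintegral => x _; rewrite /F /= !Le.
    have -> : L th x + t * tnth x j + (phi - a j * t) = (L th x + phi) + (tnth x j - a j) * t by ring.
    have -> : L th x + - t * tnth x j + (phi + a j * t) = (L th x + phi) - (tnth x j - a j) * t by ring.
    set u := L th x + phi; set v := (tnth x j - a j) * t.
    by rewrite (cosB u v) (cosD u v); field.
  have i12 := integrable_add measurableT (sPi r (e t) (phi - a j * t)) (sPi r (e (- t)) (phi + a j * t)).
  rewrite (RintegralZl _ measurableT i12) (RintegralD measurableT (sPi _ _ _) (sPi _ _ _)).
  rewrite (IH ur _ _ (er t)) (IH ur _ _ (er (- t))) !ce cN cosB cosD; by field.
move=> h; transitivity (\int[nu]_x \int[mu]_t F (x, t)).
  by apply: eq_Rintegral => x _; rewrite inner1.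
rewrite h; under eq_Rintegral do rewrite inner2.
rewrite RintegralZl//; first by rewrite -/(I j) big_cons; ring.
by apply: (integrable_mul_bounded measurableT (ci j) (@measurable_cos_scale R _ _)) => t; exact: cos_le1_norm.
Qed.

(** Parseval's identity between density and covariance, tested on a product of Gaussians: the
    induction above with all coordinates, zero frequencies and zero phase. *)
Lemma coordinate_inversion :
  \int[nu]_x (s x * \prod_(i < n) gaussian_kernel (tnth x i - a i) eps) =
  \prod_(i < n) \int[mu]_t (expR (- (eps * (t * t))) * c i t * cos (a i * t)).
Proof.
have := @coordinate_inversion_seq (index_enum 'I_n) (index_enum_uniq _) (fun=> 0) 0 (fun _ _ => erefl).
have -> : \prod_(i < n) c i 0 = 1 by apply: big1 => i _; rewrite c0.
rewrite cos0 mul1r mulr1 => <-; apply: eq_Rintegral => x _.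
have -> : L (fun=> 0) x = 0 by apply: big1 => i _; rewrite mul0r.
by rewrite addr0 cos0 mulr1.
Qed.

End coordinate_inversion.

(** * Product integrals and the Gaussian approximate identity *)

Section tuple_products.
Context {R : realType}.
Notation mu := (@lebesgue_measure R).
Notation T := (measurableTypeR R).

(** Induction along [cons_measure], with Tonelli at each step; the base case is the unit mass at the
    empty tuple. *)
Let integral_tuple_prod (n : nat) (f : 'I_n -> R -> R) (r : 'I_n -> R) :
  (forall i, measurable_fun setT (f i)) -> (forall i t, 0 <= f i t) ->
  (forall i, \int[mu]_t (f i t)%:E = (r i)%:E)%E ->
  (\int[lebesgue_tuple R n]_x (\prod_(i < n) f i (tnth x i))%:E = (\prod_(i < n) r i)%:E)%E.
Proof.
elim: n f r => [|n IH] f r mf f0 fr.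
  under eq_integral do rewrite big_ord0.
  by rewrite big_ord0 integral_cst//= diracT mul1e.
have mp m (h : 'I_m -> R -> R) : (forall i, measurable_fun setT (h i)) ->
    measurable_fun setT (fun x : m.-tuple T => (\prod_(i < m) h i (tnth x i))%:E).
  move=> mh; apply/measurable_EFinP; apply: measurable_prod => i _.
  exact: (measurableT_comp (mh i) (measurable_tnth i)).
have p0 m (h : 'I_m -> R -> R) (x : m.-tuple T) : (forall i t, 0 <= h i t) ->
    (0 <= (\prod_(i < m) h i (tnth x i))%:E)%E.
  by move=> h0; rewrite lee_fin; apply: prodr_ge0.
rewrite /= /cons_measure ge0_integral_pushforward//=; first last.
- by move=> x _; exact: p0.
- exact: mp.
- exact: measurable_tuple_cons.
rewrite preimage_setT.
have E (z : T * n.-tuple T) : (\prod_(i < n.+1) f i (tnth (tuple_cons z) i))%:E =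
    ((f ord0 z.1)%:E * (\prod_(i < n) f (lift ord0 i) (tnth z.2 i))%:E)%E.
  rewrite big_ord_recl -EFinM; congr (_ * _)%:E.
  by apply: eq_bigr => i _; congr (f _ _); rewrite !(tnth_nth 0).
rewrite (eq_integral (fun z : T * n.-tuple T => (f ord0 z.1)%:E * (\prod_(i < n) f (lift ord0 i) (tnth z.2 i))%:E)%E); last first.
  by move=> z _; rewrite /= E.
rewrite fubini_tonelli1; first last.
- move=> z; apply: mule_ge0; first by rewrite lee_fin.
  exact: (p0 n (fun i => f (lift ord0 i)) z.2 (fun i => f0 _)).
- have mf' i : measurable_fun setT (f (lift ord0 i)) by [].
  apply: emeasurable_funM.
    apply: (measurableT_comp (f := fun t => (f ord0 t)%:E)); last exact: measurable_fst.
    exact/measurable_EFinP.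
  exact: (measurableT_comp (mp _ _ mf') measurable_snd).
rewrite /fubini_F /=.
have inner y : (\int[lebesgue_tuple R n]_x ((f ord0 y)%:E * (\prod_(i < n) f (lift ord0 i) (tnth x i))%:E) =
    (f ord0 y)%:E * (\prod_(i < n) r (lift ord0 i))%:E)%E.
  rewrite -(IH (fun i => f (lift ord0 i)) (fun i => r (lift ord0 i)))//.
  rewrite ge0_integralZl//; first exact: (mp n (fun i => f (lift ord0 i))).
  - by move=> x _; exact: (p0 n (fun i => f (lift ord0 i)) x (fun i => f0 _)).
  - by rewrite lee_fin.
transitivity (\int[mu]_y ((f ord0 y)%:E * (\prod_(i < n) r (lift ord0 i))%:E))%E.
  by apply: eq_integral => y _; exact: inner.
have rge (i : 'I_n.+1) : 0 <= r i.
  by rewrite -lee_fin -fr; apply: integral_ge0 => t _; rewrite lee_fin.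
rewrite ge0_integralZr//; first last.
- by rewrite lee_fin; exact: prodr_ge0.
- by move=> t _; rewrite lee_fin.
- by apply/measurable_EFinP; exact: (mf ord0).
by rewrite fr -EFinM big_ord_recl.
Qed.

Lemma Rintegral_tuple_prod (n : nat) (f : 'I_n -> R -> R) :
  (forall i t, 0 <= f i t) -> (forall i, mu.-integrable setT (EFin \o f i)) ->
  (lebesgue_tuple R n).-integrable setT (EFin \o (fun x => \prod_(i < n) f i (tnth x i))) /\
  \int[lebesgue_tuple R n]_x (\prod_(i < n) f i (tnth x i)) = \prod_(i < n) \int[mu]_t f i t.
Proof.
move=> f0 fi; have mf i := integrable_measurable (fi i).
have fr i : (\int[mu]_t (f i t)%:E = (\int[mu]_t f i t)%:E)%E.
  by rewrite /Rintegral fineK//; exact: integrable_fin_num (fi i).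
have E := integral_tuple_prod mf f0 fr.
split; last by rewrite {1}/Rintegral E.
apply/integrableP; split.
  apply/measurable_EFinP; apply: measurable_prod => i _.
  exact: (measurableT_comp (mf i) (measurable_tnth i)).
apply: le_lt_trans (_ : (\prod_(i < n) \int[mu]_t f i t)%:E < +oo)%E; last exact: ltry.
rewrite -E le_eqVlt; apply/orP; left; apply/eqP; apply: eq_integral => x _.
by rewrite /= ger0_norm// prodr_ge0.
Qed.

(** In [y] the kernel is a Gaussian of parameter 1 / (4 e), whose integral is given by
    [gaussian_fourier] at frequency 0. *)
Lemma gaussian_kernel_total (a e : R) : 0 < e ->
  mu.-integrable setT (EFin \o (fun y => gaussian_kernel (y - a) e)) /\
  \int[mu]_y gaussian_kernel (y - a) e = 2 * pi.
Proof.
move=> e0; pose q := (4 * e)^-1; have q0 : 0 < q by rewrite invr_gt0 mulr_gt0.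
pose C := Num.sqrt pi * e `^ (- 2^-1) : R.
pose g (y : R) := C * expR (- (q * (y * y))).
have gi : mu.-integrable setT (EFin \o g).
  exact: (integrable_scale measurableT C (integrable_gaussian q0)).
have gE y : gaussian_kernel (y - a) e = g (1 * y + - a).
  by rewrite /g /gaussian_kernel mul1r -expr2 /q (mulrC _ (_ ^+ 2)).
have -> : (fun y => gaussian_kernel (y - a) e) = (fun y => g (1 * y + - a)).
  by apply/funext => y; rewrite gE.
split; first by apply: integrable_affine.
have := Rintegral_affine (- a) (oner_neq0 R) gi; rewrite normr1 mul1r => <-.
rewrite (RintegralZl _ measurableT (integrable_gaussian q0)).
have := gaussian_fourier 0 q0.
under eq_Rintegral do rewrite mul0r cos0 mulr1.
move=> ->; rewrite /gaussian_kernel expr0n /= mul0r oppr0 expR0 mulr1.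
have -> : q `^ (- 2^-1) = 2 * e `^ 2^-1.
  rewrite /q -(powR_inv1 (ltW (mulr_gt0 _ e0)))// -powRrM mulN1r opprK.
  rewrite (powRM _ (ler0n R 4) (ltW e0)); congr (_ * _).
  have -> : 4 = 2 ^+ 2 :> R by ring.
  by rewrite powR12_sqrt// sqrtr_sqr ger0_norm.
rewrite /C; have ee : e `^ (- 2^-1) * e `^ 2^-1 = 1 by rewrite mulrC powR_mulN.
transitivity (2 * Num.sqrt pi ^+ 2 * (e `^ (- 2^-1) * e `^ 2^-1)); first by ring.
by rewrite ee mulr1 sqr_sqrtr// pi_ge0.
Qed.

Section approximate_identity.
Variables (n : nat) (s : n.-tuple T -> R) (a : 'I_n -> R) (v : R).
Notation nu := (lebesgue_tuple R n).
Hypothesis si : nu.-integrable setT (EFin \o s).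
Hypothesis sv : forall eta : R, 0 < eta -> exists2 delta : R, 0 < delta &
  forall x, (forall i, `|tnth x i - a i| < delta) -> `|s x - v| <= eta.

Let K (e : R) (x : n.-tuple T) := \prod_(i < n) gaussian_kernel (tnth x i - a i) e.

(** A fixed integrable weight, needed because the constant [v], unlike [s], is not integrable over
    the whole space. *)
Let W (x : n.-tuple T) := \prod_(i < n) expR (- (8^-1 * (tnth x i - a i) ^+ 2)).

Let K_ge0 e x : 0 <= K e x.
Proof. by apply: prodr_ge0 => i _; exact: gaussian_kernel_ge0. Qed.

Let W_ge0 x : 0 <= W x.
Proof. by apply: prodr_ge0 => i _; exact: expR_ge0. Qed.

Let W_le1 x : W x <= 1.
Proof.
apply: prodr_ile1 => i _; rewrite expR_ge0/= -expR0 ler_expR oppr_le0.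
by rewrite mulr_ge0 ?sqr_ge0.
Qed.

Let Wi : nu.-integrable setT (EFin \o W).
Proof.
have [//||h _] := @Rintegral_tuple_prod n (fun i y => expR (- (8^-1 * (y - a i) ^+ 2))).
- move=> i; have q0 : (0 : R) < 8^-1 by rewrite invr_gt0.
  have := integrable_affine (- a i) (oner_neq0 R) (integrable_gaussian q0).
  by apply: eq_integrable => // y _ /=; rewrite mul1r -expr2.
- exact: h.
Qed.

Let KiE e : 0 < e -> nu.-integrable setT (EFin \o (K e)) /\
  \int[nu]_x K e x = (2 * pi) ^+ n.
Proof.
move=> e0; have [||h ->] := @Rintegral_tuple_prod n (fun i y => gaussian_kernel (y - a i) e).
- by move=> i t; exact: gaussian_kernel_ge0.
- by move=> i; have [] := gaussian_kernel_total (a i) e0.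
- split; first exact: h.
  rewrite (eq_bigr (fun=> 2 * pi)) => [|i _]; last by have [] := gaussian_kernel_total (a i) e0.
  by rewrite prodr_const card_ord.
Qed.

Let rho (delta e : R) := (Num.sqrt pi * e `^ (- 2^-1)) ^+ n * expR (- (delta ^+ 2 / 8 * e^-1)).

(** Half of the exponent y^2 / (4 e) in the distant coordinate gives exp (- delta^2 / (8 e)); the
    other half, like the exponents of the remaining coordinates, is at least y^2 / 8 since e <=
    1. *)
Let K_far delta e x : 0 < delta -> 0 < e <= 1 -> (exists i, delta <= `|tnth x i - a i|) ->
  K e x <= rho delta e * W x.
Proof.
move=> d0 /andP[e0 e1] [j dj]; rewrite /K /gaussian_kernel big_split/= /rho.
rewrite prodr_const card_ord -mulrA ler_wpM2l ?exprn_ge0 ?mulr_ge0 ?sqrtr_ge0 ?powR_ge0//.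
have ie : 1 <= e^-1 by rewrite invf_ge1.
have h i : expR (- ((tnth x i - a i) ^+ 2 / (4 * e))) <=
    expR (- (8^-1 * (tnth x i - a i) ^+ 2)).
  rewrite ler_expR lerN2 invfM [leRHS]mulrC ler_wpM2r ?sqr_ge0//; lra.
rewrite /W (bigD1 j)//= [in leRHS](bigD1 j)//= mulrA; apply: ler_pM.
- exact: expR_ge0.
- by apply: prodr_ge0 => i _; exact: expR_ge0.
- rewrite -expRD ler_expR -opprD lerN2 invfM.
  set y := tnth x j - a j.
  have y2 : delta ^+ 2 <= y ^+ 2.
    by rewrite -(@real_normK _ y) ?num_real// lerXn2r ?nnegrE ?(ltW d0).
  have y0 : 0 <= y ^+ 2 by exact: sqr_ge0.
  have h1 : delta ^+ 2 * e^-1 <= y ^+ 2 * e^-1 by rewrite ler_wpM2r// (le_trans ler01).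
  have h2 : y ^+ 2 * 1 <= y ^+ 2 * e^-1 by rewrite ler_wpM2l.
  lra.
- by apply: ler_prod => i _; rewrite expR_ge0 h.
Qed.

Let rho_le delta : 0 < delta -> exists2 C : R, 0 < C &
  forall e, 0 < e -> rho delta e <= C * e.
Proof.
move=> d0; have c0 : 0 < delta ^+ 2 / 8 by rewrite divr_gt0// exprn_gt0.
(* The exponent n / 2 accounts for the prefactor e^(-n/2), and 1 more leaves a factor [e]. *)
have p0 : 0 <= n%:R / 2 + 1 :> R by rewrite addr_ge0 ?divr_ge0.
have [C C0 HC] := powR_le_expR p0 c0.
exists (Num.sqrt pi ^+ n * C); first by rewrite mulr_gt0// exprn_gt0// sqrtr_gt0 pi_gt0.
move=> e e0; have ie0 : 0 < e^-1 by rewrite invr_gt0.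
rewrite /rho exprMn -[leLHS]mulrA -[leRHS]mulrA ler_wpM2l ?exprn_ge0 ?sqrtr_ge0//.
have -> : (e `^ (- 2^-1)) ^+ n = e^-1 `^ (n%:R / 2).
  rewrite -(powR_mulrn _ (powR_ge0 _ _)) -powRrM -(powR_inv1 (ltW e0)) -powRrM.
  by congr (_ `^ _); field.
have := HC _ (ltW ie0); rewrite powRD ?(gt_eqF ie0) ?implybT// (powRr1 (ltW ie0)) => h.
by rewrite expRN ler_pdivrMr ?expR_gt0// [leRHS]mulrAC -ler_pdivrMr.
Qed.

(** Near [a] the error is at most [eta1] times the kernel, of mass (2 pi)^n. Elsewhere the kernel is
    at most rho W, with W <= 1, so the error is at most rho (|s| + |v| W), of integral rho B = O(e).
    Each part costs eta / 2. *)
Lemma gaussian_approximate_identity :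
  \int[nu]_x (s x * \prod_(i < n) gaussian_kernel (tnth x i - a i) e) @[e --> 0^'+] -->
  (2 * pi) ^+ n * v.
Proof.
have nsi : nu.-integrable setT (EFin \o (fun x => `|s x|)).
  by have := integrable_abse si; apply: eq_integrable.
have P0 : 0 < (2 * pi) ^+ n :> R by rewrite exprn_gt0// mulr_gt0// pi_gt0.
apply/cvgrPdist_le => eta eta0.
pose eta1 := eta / (2 * (2 * pi) ^+ n).
have eta10 : 0 < eta1 by rewrite divr_gt0// mulr_gt0.
have [delta d0 near_v] := sv eta10.
have [C C0 HC] := rho_le d0.
pose B := \int[nu]_x `|s x| + `|v| * \int[nu]_x W x.
have B0 : 0 <= B.
  by apply: addr_ge0; [exact: Rintegral_ge0|apply: mulr_ge0 => //; exact: Rintegral_ge0].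
have e_small : \forall e \near 0^'+, [/\ 0 < e, e <= 1 & C * e * B <= eta / 2].
  pose m : R := Num.min 1 (eta / (2 * (C * B + 1))).
  have CB : 0 < C * B + 1 by rewrite ltr_wpDl// mulr_ge0// ltW.
  have m0 : 0 < m by rewrite lt_min ltr01/= divr_gt0// mulr_gt0.
  near=> e.
  have e0 : 0 < e by near: e; exact: nbhs_right_gt.
  have em : e <= m by near: e; exact: nbhs_right_le.
  move: em; rewrite le_min => /andP[e1]; rewrite ler_pdivlMr ?mulr_gt0// => e2.
  split => //; have : 0 <= e * (C * B + 1) - C * e * B by rewrite subr_ge0; lra.
  by lra.
apply: filterS e_small => e [e0 e1 eB].
have [Ki KE] := KiE e0.
have mK := integrable_measurable Ki; have ms := integrable_measurable si.
have rho0 : 0 <= rho delta e.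
  by rewrite mulr_ge0 ?expR_ge0// exprn_ge0// mulr_ge0 ?sqrtr_ge0 ?powR_ge0.
have vKi := integrable_scale measurableT v Ki.
pose D x := eta1 * K e x + rho delta e * (`|s x| + `|v| * W x).
have vWi := integrable_scale measurableT `|v| Wi.
have svi := integrable_add measurableT nsi vWi.
have Di : nu.-integrable setT (EFin \o D).
  exact: (integrable_add measurableT (integrable_scale measurableT eta1 Ki)
    (integrable_scale measurableT (rho delta e) svi)).
have bound x : `|s x * K e x - v * K e x| <= D x.
  rewrite -mulrBl normrM (ger0_norm (K_ge0 e x)).
  have r2 : 0 <= rho delta e * (`|s x| + `|v| * W x).
    by rewrite mulr_ge0// addr_ge0// mulr_ge0.
  have [xa|/existsNP[i /negP]] := pselect (forall i, `|tnth x i - a i| < delta).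
    apply: le_trans (_ : _ <= eta1 * K e x) _; first by rewrite ler_wpM2r// near_v.
    by rewrite lerDl.
  rewrite -leNgt => far.
  have KW : K e x <= rho delta e * W x by apply: K_far => //; [rewrite e0 e1|exists i].
  apply: le_trans (_ : _ <= rho delta e * (`|s x| + `|v| * W x)) _; last first.
    by rewrite lerDr mulr_ge0// ltW.
  apply: le_trans (ler_wpM2r (K_ge0 e x) (ler_normB _ _)) _.
  rewrite mulrDl mulrDr; apply: lerD.
    rewrite mulrC ler_wpM2r//; apply: le_trans KW _.
    by rewrite ler_piMr.
  by rewrite mulrCA ler_wpM2l.
have dKi : nu.-integrable setT (EFin \o (fun x => s x * K e x - v * K e x)).
  apply: (integrable_bounded_by measurableT _ Di) => [|x _]; last exact: bound.
  apply: measurable_funB; first exact: measurable_funM.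
  exact: (integrable_measurable vKi).
have sKi : nu.-integrable setT (EFin \o (fun x => s x * K e x)).
  have := integrable_add measurableT dKi vKi.
  by apply: eq_integrable => // x _ /=; rewrite subrK.
have -> : (2 * pi) ^+ n * v = \int[nu]_x (v * K e x).
  by rewrite (RintegralZl _ measurableT Ki) KE mulrC.
rewrite distrC -(RintegralB measurableT sKi vKi).
apply: le_trans (le_normr_Rintegral measurableT dKi) _.
have ndKi : nu.-integrable setT (EFin \o (fun x => `|s x * K e x - v * K e x|)).
  by have := integrable_abse dKi; apply: eq_integrable.
apply: le_trans (le_Rintegral measurableT ndKi Di (fun x _ => bound x)) _.
rewrite (RintegralD measurableT (integrable_scale measurableT eta1 Ki) (integrable_scale measurableT (rho delta e) svi)).
rewrite (RintegralZl _ measurableT Ki) (RintegralZl _ measurableT svi).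
rewrite (RintegralD measurableT nsi vWi) (RintegralZl _ measurableT Wi) KE -/B.
have -> : eta1 * (2 * pi) ^+ n = eta / 2.
  by rewrite /eta1; move: ((2 * pi) ^+ n) P0 => q q0; field; rewrite gt_eqF.
rewrite [leRHS]splitr lerD2l; apply: le_trans eB.
by rewrite ler_wpM2r// HC.
Unshelve. all: by end_near. Qed.

End approximate_identity.
End tuple_products.

(** * Asymptotics of the spectral density *)

Section spectral_density.
Context {R : realType}.
Notation mu := (@lebesgue_measure R).
Notation T := (measurableTypeR R).

Lemma smoothed_density_even (alpha beta eps x : R) :
  smoothed_density alpha beta eps `|x| = smoothed_density alpha beta eps x.
Proof.
have [_|//] := ler0P x; apply: eq_Rintegral => t _.
by rewrite mulNr cosN.
Qed.

Lemma high_freq_even (a b x : R) : high_freq a b `|x| = high_freq a b x.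
Proof. by rewrite /high_freq normr_id. Qed.

Lemma sin_half_pi_gt0 (alpha : R) : 0 < alpha < 2 -> 0 < sin (pi * alpha / 2).
Proof.
move=> /andP[a0 a2]; have p0 := pi_gt0 R.
by apply: sin_gt0_pi; apply/andP; split; [rewrite divr_gt0// mulr_gt0|nra].
Qed.

Lemma high_freq_gt0 (a b x : R) : 0 < a <= 2 -> 0 < b -> x != 0 -> 0 < high_freq a b x.
Proof.
move=> /andP[a0 a2] b0 x0; have n0 : 0 < `|x| by rewrite normr_gt0.
rewrite /high_freq; case: eqP => [_|/eqP a2'].
  by rewrite mulr_gt0 ?expR_gt0// divr_gt0 ?mulr_gt0 ?powR_gt0 ?Gamma_gt0.
have a02 : 0 < a < 2 by rewrite a0 lt_neqAle a2' a2.
rewrite mulr_gt0 ?powR_gt0// mulr_gt0 ?sin_half_pi_gt0// mulr_gt0 ?divr_gt0 ?pi_gt0// Gamma_gt0//.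
by rewrite addr_gt0.
Qed.

(** [M] does not depend on [e], while how small [e] must be may depend on [x]: this form covers both
    cases and suffices for a limit in [e] at fixed frequency. *)
Lemma smoothed_density_ratio (alpha beta eta : R) : 0 < alpha <= 2 -> 0 < beta -> 0 < eta ->
  exists2 M : R, 0 < M & forall x : R, M < `|x| -> \forall e \near 0^'+,
    `|smoothed_density alpha beta e x / (2 * pi * high_freq alpha beta x) - 1| <= eta.
Proof.
move=> /andP[a0 a2] b0 eta0.
suff [M M0 HM] : exists2 M : R, 0 < M & forall x : R, M < x -> \forall e \near 0^'+,
    `|smoothed_density alpha beta e x / (2 * pi * high_freq alpha beta x) - 1| <= eta.
  exists M => // x /HM; apply: filterS => e.
  by rewrite smoothed_density_even high_freq_even.
move: a2; rewrite le_eqVlt => /predU1P[->|a2]; first exact: smoothed_density2_tail.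
have a02 : 0 < alpha < 2 by rewrite a0.
pose L := 2 * beta * Gamma (alpha + 1) * sin (pi * alpha / 2).
have L0 : 0 < L.
  by rewrite mulr_gt0 ?sin_half_pi_gt0// mulr_gt0 ?Gamma_gt0 ?addr_gt0// mulr_gt0.
(* An absolute error eta L becomes the relative error eta after division by the limit [L]. *)
have [M M0 HM] := smoothed_density_tail a02 b0 (mulr_gt0 eta0 L0).
exists M => // x Mx; have x0 := lt_trans M0 Mx.
near=> e.
have e01 : 0 < e <= 1.
  apply/andP; split; near: e; first exact: nbhs_right_gt.
  exact: nbhs_right_le.
have := HM x e Mx e01; rewrite -/L => h.
have xp : 0 < x `^ (alpha + 1) by rewrite powR_gt0.
have -> : 2 * pi * high_freq alpha beta x = L / x `^ (alpha + 1).
  rewrite /high_freq (lt_eqF a2) (gtr0_norm x0) -powRN opprD /L.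
  move: (sin _) => sn; move: (pi_gt0 R); move: (pi : R) => p p0.
  by field; rewrite gt_eqF.
have -> : smoothed_density alpha beta e x / (L / x `^ (alpha + 1)) - 1 =
    (x `^ (alpha + 1) * smoothed_density alpha beta e x - L) / L.
  by field; rewrite !gt_eqF.
by rewrite normrM normfV (gtr0_norm L0) ler_pdivrMr.
Unshelve. all: by end_near. Qed.

(** Induction on f p - 1 = (f - 1) p + (p - 1), where |p| <= (1 + eta)^(size r). *)
Lemma prod_near1 (I : Type) (r : seq I) (f : I -> R) (eta : R) : 0 <= eta ->
  (forall i, `|f i - 1| <= eta) -> `|\prod_(i <- r) f i - 1| <= (1 + eta) ^+ size r - 1.
Proof.
move=> eta0 f1; elim: r => [|i r IH]; first by rewrite big_nil !subrr normr0.
rewrite big_cons exprS; set p := \prod_(j <- r) f j in IH *; set q := _ ^+ size r in IH *.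
have -> : f i * p - 1 = (f i - 1) * p + (p - 1) by ring.
have p1 : `|p| <= q.
  have -> : p = (p - 1) + 1 by rewrite subrK.
  by apply: le_trans (ler_normD _ _) _; rewrite normr1 -lerBrDr.
apply: le_trans (ler_normD _ _) _; rewrite normrM.
have := ler_pM (normr_ge0 _) (normr_ge0 _) (f1 i) p1; move: IH; lra.
Qed.

Variables (n : nat) (alpha beta : 'I_n -> R) (S : 'rV[R]_n -> R).
Hypothesis alpha02 : forall i, 0 < alpha i <= 2.
Hypothesis beta0 : forall i, 0 < beta i.
Hypothesis hS : is_spectral_density (cauchy_sheet_cov alpha beta) S.

Lemma spectral_density_inversion (w : 'rV[R]_n) : {for w, continuous S} ->
  \prod_(i < n) smoothed_density (alpha i) (beta i) e (w ord0 i) @[e --> 0^'+] -->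
  (2 * pi) ^+ n * S w.
Proof.
move=> Sw; have [Si hC] := hS.
pose s (x : n.-tuple T) := S (rV_of_tuple x).
have si : (lebesgue_tuple R n).-integrable setT (EFin \o s) by exact: Si.
have dotE (th : 'I_n -> R) (x : n.-tuple T) :
    dotrV (rV_of_tuple x) (\row_i th i) = \sum_(i < n) th i * tnth x i.
  by apply: eq_bigr => i _; rewrite !mxE mulrC.
have s_cos (th : 'I_n -> R) : \int[lebesgue_tuple R n]_x (cos (\sum_(i < n) th i * tnth x i) * s x) =
    \prod_(i < n) cauchy_cov (alpha i) (beta i) (th i).
  have [+ _] := hC (\row_i th i); rewrite /cauchy_sheet_cov.
  under [in RHS]eq_bigr do rewrite mxE.
  by move=> <-; apply: eq_Rintegral => x _; rewrite dotE.
have s_sin (th : 'I_n -> R) : \int[lebesgue_tuple R n]_x (sin (\sum_(i < n) th i * tnth x i) * s x) = 0.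
  have [_ h0] := hC (\row_i th i); rewrite -[RHS]h0.
  by apply: eq_Rintegral => x _; rewrite dotE.
have sv (eta : R) : 0 < eta -> exists2 delta : R, 0 < delta &
    forall x, (forall i, `|tnth x i - w ord0 i| < delta) -> `|s x - S w| <= eta.
  move=> eta0; have /cvgrPdist_le/(_ _ eta0)/nbhs_ballP[delta d0 hd] := Sw.
  exists delta => // x xw; rewrite distrC; apply: hd; split=> // i j.
  by rewrite ord1 mxE /ball/= distrC; exact: xw.
have c00 (i : 'I_n) : cauchy_cov (alpha i) (beta i) 0 = 1.
  by rewrite /cauchy_cov normr0 powR0 ?addr0 ?powR1// gt_eqF//; case/andP: (alpha02 i).
have cN (i : 'I_n) t : cauchy_cov (alpha i) (beta i) (- t) = cauchy_cov (alpha i) (beta i) t.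
  by rewrite /cauchy_cov normrN.
have := gaussian_approximate_identity si sv; apply: cvg_trans; apply: near_eq_cvg.
near=> e; have e0 : 0 < e by near: e; exact: nbhs_right_gt.
have ci (i : 'I_n) := integrable_smoothed_cov (alpha i) (beta0 i) e0.
exact: (coordinate_inversion (fun i => w ord0 i) si e0 c00 cN ci s_cos s_sin).
Unshelve. all: by end_near. Qed.

End spectral_density.

Unset Implicit Arguments.

Theorem proposition4p8 (R : realType) (n : nat) (hn : (1 <= n)%N)
    (alpha beta : 'I_n -> R)
    (halpha : forall i, 0 < alpha i <= 2)
    (hbeta : forall i, 0 < beta i)
    (S : 'rV[R]_n -> R)
    (hS : is_spectral_density (cauchy_sheet_cov alpha beta) S)
    (hSc : forall w : 'rV[R]_n,
       (forall i, w ord0 i != 0) -> {for w, continuous S}) :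
  S ~_(high_frequency R n)
    (fun w : 'rV[R]_n => \prod_(i < n) high_freq (alpha i) (beta i) (w ord0 i)).
Proof.
apply/eqaddoP => eta eta0.
have n0 : 0 < n%:R :> R by rewrite ltr0n.
(* Chosen so that (1 + eta1)^n <= exp (n eta1) = 1 + eta. *)
pose eta1 := ln (1 + eta) / n%:R.
have eta1_gt0 : 0 < eta1 by rewrite divr_gt0// ln_gt0// ltrDl.
have eta1n : (1 + eta1) ^+ n - 1 <= eta.
  rewrite lerBlDl; apply: le_trans (_ : _ <= expR eta1 ^+ n) _.
    by apply: lerXn2r; rewrite ?nnegrE ?addr_ge0 ?expR_ge0 ?expR_ge1Dx// ltW.
  rewrite -expRM_natr /eta1 divfK ?gt_eqF// lnK// posrE addr_gt0//.
have ex i : exists m : R, 0 < m /\ forall x : R, m < `|x| -> \forall e \near 0^'+,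
    `|smoothed_density (alpha i) (beta i) e x / (2 * pi * high_freq (alpha i) (beta i) x) - 1| <= eta1.
  by have [m m0 Hm] := smoothed_density_ratio (halpha i) (hbeta i) eta1_gt0; exists m.
have [M HM] := choice ex.
(* The thresholds are positive, so their sum is at least each of them. *)
exists (\sum_(i < n) M i) => w Mw /=.
have Mi i : M i < `|w ord0 i|.
  apply: le_lt_trans (Mw i); rewrite (bigD1 i)//= lerDl sumr_ge0// => j _.
  by have [/ltW] := HM j.
have w0 i : w ord0 i != 0.
  by rewrite -normr_gt0; apply: lt_trans (Mi i); have [] := HM i.
pose h i := high_freq (alpha i) (beta i) (w ord0 i).
have h0 i : 0 < h i by exact: high_freq_gt0.
have H0 : 0 < \prod_(i < n) h i by exact: prodr_gt0.
have P0 : 0 < (2 * pi) ^+ n :> R by rewrite exprn_gt0// mulr_gt0// pi_gt0.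
pose ratio e i := smoothed_density (alpha i) (beta i) e (w ord0 i) / (2 * pi * h i).
have ratioE e : \prod_(i < n) ratio e i =
    (\prod_(i < n) smoothed_density (alpha i) (beta i) e (w ord0 i)) / ((2 * pi) ^+ n * \prod_(i < n) h i).
  by rewrite /ratio prodf_div big_split/= prodr_const card_ord.
(* Only the product is known to converge, by inversion and continuity of [S] at [w], none of whose
   coordinates vanishes. *)
have ratio_cvg : \prod_(i < n) ratio e i @[e --> 0^'+] --> S w / \prod_(i < n) h i.
  under eq_fun do rewrite ratioE.
  have -> : S w / \prod_(i < n) h i = (2 * pi) ^+ n * S w / ((2 * pi) ^+ n * \prod_(i < n) h i).
    by rewrite invfM mulrACA mulfV ?mul1r// gt_eqF.
  apply: cvgM; last exact: cvg_cst.
  have inv := spectral_density_inversion halpha hbeta hS (hSc w w0); exact: inv.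
have ratio_near : \forall e \near 0^'+, `|\prod_(i < n) ratio e i - 1| <= eta.
  have all_near : \forall e \near 0^'+, forall i, `|ratio e i - 1| <= eta1.
    by apply: filter_forall => i; have [_ /(_ _ (Mi i))] := HM i.
  apply: filterS all_near => e He.
  have := prod_near1 (index_enum 'I_n) (ltW eta1_gt0) He.
  have -> : size (index_enum 'I_n) = n by rewrite -sum1_size big_const_ord iter_addn_0 mul1n.
  by move=> /le_trans; apply.
(* The bound passes to the limit: at a common [e] the product is within [r] of its limit and within
   [eta] of 1. *)
have : `|S w / \prod_(i < n) h i - 1| <= eta.
  apply/ler_addgt0Pr => r r0.
  have /cvgrPdist_le/(_ _ r0) := ratio_cvg => close.
  have near_both : \forall e \near (0 : R)^'+,
      `|S w / \prod_(i < n) h i - \prod_(i < n) ratio e i| <= r /\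
      `|\prod_(i < n) ratio e i - 1| <= eta by exact: filterI.
  have [e [e1 e2]] := @filter_ex _ _ (at_right_proper_filter 0) _ near_both.
  have -> : S w / \prod_(i < n) h i - 1 = (S w / \prod_(i < n) h i - \prod_(i < n) ratio e i) + (\prod_(i < n) ratio e i - 1) by ring.
  by apply: le_trans (ler_normD _ _) _; rewrite addrC lerD.
move=> close.
have -> : (S - (fun w : 'rV[R]_n => \prod_(i < n) high_freq (alpha i) (beta i) (w ord0 i))) w =
    (S w / \prod_(i < n) h i - 1) * \prod_(i < n) h i.
  by rewrite mulrBl mul1r divfK ?gt_eqF.
by rewrite normrM ler_wpM2r.
Qed.
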